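(* Suppose that for some $\eta>0$ we have $\beta^{n,\pm},\beta^\pm\in L^{1+\eta}([0,1]^2_T)$ for all $n\ge1$ and $\beta^{n,\pm}\to\beta^\pm$ in $L^{1+\eta}$ as $n\to\infty$. Then the sequence $\{H^n:n\ge1\}$ satisfies a large deviation principle in $\mathcal W_0$ equipped with the weak topology, with speed $a(n)n^2$ and rate function $$J^{(\beta^+,\beta^-)}(\phi)=\int_{[0,1]^2\times[0,T]}\mathcal Q_1\big(\phi_s(x,y),\beta^+_s(x,y),\beta^-_s(x,y)\big)\,dx\,dy\,ds,\qquad\phi\in\mathcal W_0,$$ where $\mathcal Q_1:[0,1]\times[0,\infty)^2\to\mathbb R$ is $\mathcal Q_1(u,v^+,v^-)=\big(\sqrt{v^+(1-u)}-\sqrt{v^-u}\big)^2$.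
   Context: Fix $T\in(0,\infty)$; write $[0,1]^2_T=[0,1]^2\times[0,T]$ and $[n]=\{1,\dots,n\}$. All $L^p$ spaces are with respect to Lebesgue measure. Let $Q^n_1=[0,1/n]$, $Q^n_i=((i-1)/n,i/n]$ for $2\le i\le n$, and $Q^n_{i,j}=Q^n_i\times Q^n_j$. Rates. $\beta^+,\beta^-:[0,1]^2\times[0,T]\to[0,\infty)$ are measurable, with $\beta^\pm_t(x,y)=\beta^\pm(x,y,t)$. For each $n$ and $i,j\in[n]$, $\beta^{n,\pm}_{i,j}:[0,T]\to[0,\infty)$ are measurable and $\beta^{n,\pm}_t(x,y)=\beta^{n,\pm}(x,y,t)=\sum_{i,j=1}^n\beta^{n,\pm}_{i,j}(t)\mathbf 1_{Q^n_{i,j}}(x,y)$. Standing assumptions: (a) $\beta^{n,\pm},\beta^\pm\in L^1([0,1]^2_T)$ and $\beta^{n,\pm}\to\beta^\pm$ in $L^1([0,1]^2_T)$; (b) there is $c_\beta>0$ with $\beta^{n,\pm}_{i,j}(t)\ge c_\beta$ for all $n\ge1$, $i,j\in[n]$, $t\in[0,T]$; (c) $t\mapsto\beta^\pm_t(x,y)$ is bounded and left-continuous for a.e. $(x,y)\in[0,1]^2$, and $t\mapsto\beta^{n,\pm}_{i,j}(t)$ is bounded and left-continuous for all $i,j\in[n]$ and all large enough $n$. Graph process. $a(n)\in(0,\infty)$ with $a(n)\to\infty$. For each $n$, $\{X^n_{i,j}(t):t\in[0,T]\}_{i,j\in[n]}$ are $n^2$ mutually independent (càdlàg) Markov chains on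 $\{0,1\}$, with deterministic initial values $X^n_{i,j}(0)=x^n_{i,j}\in\{0,1\}$, jumping at time $t$ from $0$ to $1$ at rate $a(n)\beta^{n,+}_{i,j}(t)$ and from $1$ to $0$ at rate $a(n)\beta^{n,-}_{i,j}(t)$; all are defined on one probability space $(\Omega,\mathcal F,\mathbb P)$. Put $H^n(x,y,t)=H^n_t(x,y)=\sum_{i,j=1}^nX^n_{i,j}(t)\mathbf 1_{Q^n_{i,j}}(x,y)$. $\mathcal W_0$ is the set of measurable $\phi:[0,1]^2\times[0,T]\to\mathbb R$ with $0\le\phi\le1$ a.e. (identified if equal a.e.), $\phi_s=\phi(\cdot,\cdot,s)$. The weak topology on $\mathcal W_0$ is inherited from the weak topology of $L^2([0,1]^2_T)$; it is compact and metrizable. LDP. For a metric space $S$, a rate function is $I:S\to[0,\infty]$ with $\{I\le r\}$ compact for every $r<\infty$. $S$-valued random variables $Y_n$ satisfy an LDP with speed $b(n)>0$ and rate function $I$ if $\limsup_n b(n)^{-1}\log\mathbb P(Y_n\in F)\le-\inf_FI$ for all closed $F\subseteq S$ and $\liminf_nb(n)^{-1}\log\mathbb P(Y_n\in G)\ge-\inf_GI$ for all open $G\subseteq S$. *)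

(* Defs.v *)
From HB Require Import structures.
From mathcomp Require Import all_boot all_order all_algebra.
From mathcomp Require Import all_classical all_reals all_analysis.

Set Implicit Arguments.
Unset Strict Implicit.
Unset Printing Implicit Defensive.

Import Order.TTheory GRing.Theory Num.Theory.
Import numFieldNormedType.Exports.

Local Open Scope classical_set_scope.
Local Open Scope ring_scope.
Local Open Scope quotient_scope.

(* The real line carrying the structure on which lebesgue_measure is defined. *)
Notation mR := measurableTypeR.
Notation R2 R := (mR R * mR R)%type.
Notation R3 R := (mR R * mR R * mR R)%type.

Section cube.
Context {R : realType}.

Definition leb2 : set (R2 R) -> \bar R :=
  (@lebesgue_measure R \x @lebesgue_measure R)%E.
HB.instance Definition _ := Measure.on leb2.

Let sigma_finite_leb2 : sigma_finite setT leb2.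
Proof.
have /sigma_finiteP[F [TF ndF Foo]] := sigma_finiteT (@lebesgue_measure R).
exists (fun n => F n `*` F n).
  rewrite -setXTT TF predeqE => -[x y]; split.
    move=> [/= [n _ Fnx] [k _ Fky]]; exists (maxn n k) => //; split.
    - by move: x Fnx; exact/subsetPset/ndF/leq_maxl.
    - by move: y Fky; exact/subsetPset/ndF/leq_maxr.
  by move=> [n _ []/= ? ?]; split; exists n.
move=> k; have [? ?] := Foo k; split; first exact: measurableX.
by rewrite /leb2 product_measure1E// lte_mul_pinfty// ge0_fin_numE.
Qed.
HB.instance Definition _ := Measure_isSigmaFinite.Build _ _ _ leb2
  sigma_finite_leb2.

Definition leb3 : {measure set (R3 R) -> \bar R} :=
  (leb2 \x @lebesgue_measure R)%E.

Definition square : set (R2 R) := `[0, 1] `*` `[0, 1].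
Definition cube (T : R) : set (R3 R) := square `*` `[0, T].

Lemma measurable_cube T : measurable (cube T).
Proof. by apply: measurableX => //; apply: measurableX. Qed.

(* Lebesgue measure of [0,1]^2 x [0,T], seen as a measure on R^3. *)
Definition leb_cube (T : R) : {measure set (R3 R) -> \bar R} :=
  mrestr leb3 (measurable_cube T).

(* A function on [0,1]^2 x [0,T] is given by a total function on R^3 of which
   only the restriction to the cube is relevant. *)
Definition inLp (T p : R) (f : R3 R -> R) : Prop :=
  f \_ (cube T) \in Lfun (leb_cube T) p%:E.

Definition cvgLp (T p : R) (f_ : nat -> R3 R -> R) (f : R3 R -> R) : Prop :=
  ('N[leb_cube T]_(p%:E) [EFin \o (f_ n \- f)%R \_ (cube T)])%E
    @[n --> \oo] --> 0%E.

(* Indices are shifted: i : 'I_n stands for i + 1 in {1, ..., n}. *)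
Definition cell (n : nat) (i : 'I_n) : set (mR R) :=
  if i == 0%N :> nat then `[0, n%:R^-1]%classic
  else `]i%:R / n%:R, i.+1%:R / n%:R]%classic.

Definition step_kernel (n : nat) (b : 'I_n -> 'I_n -> R -> R) (z : R3 R) : R :=
  \sum_(i < n) \sum_(j < n) b i j z.2 * \1_(cell i `*` cell j) z.1.

Definition bounded_left_continuous (T : R) (f : R -> R) : Prop :=
  [bounded f t | t in `[0, T]] /\
  forall t, 0 < t <= T -> f s @[s --> t^'-] --> f t.

End cube.

Section W0.
Context {R : realType}.
Variable T : R.

Local Notation Mfun := {mfun_ leb_cube T, R3 R >-> mR R}.

Definition in_W0 : pred Mfun :=
  fun phi => `[< {ae leb_cube T, forall z, 0 <= (phi z : R) <= 1} >].

Definition W0 : Type := {phi : Mfun | in_W0 phi}.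

HB.instance Definition _ := Choice.on W0.

Definition W0_fun (phi : W0) : R3 R -> R := val phi.
Coercion W0_fun : W0 >-> Funclass.

Definition W0_pairing (phi : W0) :
    {ptws LfunType (leb_cube T) (lee1n 2) -> R} :=
  fun g => \int[leb3]_(z in cube T) (phi z * g z).

(* The trace on W0 of the weak topology of L^2: the dual of L^2 is L^2 acting by
   integration, so this is the coarsest topology for which every
   phi |-> W0_pairing phi g is continuous. *)
HB.instance Definition _ := Topological.copy W0 (initial_topology W0_pairing).

Lemma pi_ae (f : {mfun R3 R >-> mR R}) :
  {ae leb_cube T, forall z, (\pi_Mfun f : Mfun) z = f z}.
Proof.
have : repr (\pi_Mfun f) = f %[mod Mfun] by rewrite reprK.
move=> /eqP; rewrite eqmodE => /asboolP.
by apply: filterS => z; rewrite /= /aqEqMfun_to_fun => ->.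
Qed.

Lemma in_W0_pi (f : {mfun R3 R >-> mR R}) :
  {ae leb_cube T, forall z, 0 <= (f z : R) <= 1} -> in_W0 (\pi_Mfun f).
Proof.
move=> f01; apply/asboolP.
by apply: filterS2 f01 (pi_ae f) => z fz01 ->.
Qed.

Let in_W0_zero : in_W0 (\pi_Mfun (cst 0 : {mfun R3 R >-> mR R})).
Proof. by apply: in_W0_pi; apply: aeW => z /=; rewrite lexx ler01. Qed.

(* The class of f in W0. If f is not measurable on the cube or not almost
   everywhere in [0,1], this is the class of 0; see W0_classE. *)
Definition W0_class (f : R3 R -> R) : W0 :=
  insubd (exist (fun phi => in_W0 phi) _ in_W0_zero : W0)
    (\pi_Mfun (insubd (cst 0 : {mfun R3 R >-> mR R}) (f \_ (cube T)))).

Lemma W0_classE (f : R3 R -> R) : measurable_fun (cube T) f ->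
  (forall z, cube T z -> 0 <= f z <= 1) ->
  {ae leb_cube T, forall z, cube T z -> W0_class f z = f z}.
Proof.
move=> mf f01.
have mfc : (f \_ (cube T) : R3 R -> mR R) \in mfun.
  by rewrite inE/=; apply/(measurable_restrictT _ (measurable_cube T)).
have fcE : insubd (cst 0 : {mfun R3 R >-> mR R}) (f \_ (cube T)) =
    f \_ (cube T) :> (R3 R -> R) by rewrite (insubdK _ mfc).
have fc01 : in_W0 (\pi_Mfun (insubd (cst 0 : {mfun R3 R >-> mR R})
    (f \_ (cube T)))).
  apply: in_W0_pi; apply: aeW => z; rewrite fcE patchE.
  by case: ifPn => [/set_mem/f01//|_]; rewrite lexx ler01.
apply: filterS (pi_ae (insubd (cst 0 : {mfun R3 R >-> mR R})
  (f \_ (cube T)))) => z zE cz.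
rewrite /W0_fun /W0_class (insubdK _ fc01) zE fcE patchE mem_set//.
Qed.

End W0.


Section two_state_chain.
Context {R : realType} d (Omega : measurableType d) (P : probability Omega R).

(* The states 0 and 1 are false and true. A chain with jump rate lp from 0 to 1
   and lm from 1 to 0 has generator  ( - lp   lp )
                                     (   lm - lm ). *)
Definition generator (lp lm : R -> R) (t : R) (x y : bool) : R :=
  (if x == y then -1 else 1) * (if x then lm t else lp t).

(* p s t x y is the probability to go from x at time s to y at time t; p is
   determined by the last condition, the (integrated) Kolmogorov forward
   equation d/dt p_{s,t} = p_{s,t} Q_t, p_{s,s} = id. *)
Record transition_function (T : R) (Q : R -> bool -> bool -> R)
    (p : R -> R -> bool -> bool -> R) : Prop := TransitionFunction {
  transition_ge0 : forall s t x y, 0 <= s -> s <= t -> t <= T -> 0 <= p s t x y;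
  transition_sum1 : forall s t x, 0 <= s -> s <= t -> t <= T ->
    \sum_(y : bool) p s t x y = 1;
  transition_chapman_kolmogorov : forall s t u x y,
    0 <= s -> s <= t -> t <= u -> u <= T ->
    p s u x y = \sum_(z : bool) p s t x z * p t u z y;
  transition_measurable : forall s x y, 0 <= s -> s <= T ->
    measurable_fun `[s, T] (fun t => p s t x y);
  transition_forward : forall s t x y, 0 <= s -> s <= t -> t <= T ->
    p s t x y = (x == y)%:R +
      \int[@lebesgue_measure R]_(u in `[s, t])
        (\sum_(z : bool) p s u x z * Q u z y) }.

Definition cadlag (T : R) (f : R -> bool) : Prop :=
  (forall t, 0 <= t < T -> f s @[s --> t^'+] --> f t) /\
  (forall t, 0 < t <= T -> cvg (f s @[s --> t^'-])).

(* The sigma-algebra generated by (X_u), 0 <= u <= t. *)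
Definition past (X : R -> Omega -> bool) (t : R) : set_system Omega :=
  <<s [set X u @^-1` B | u in `[0, t] & B in [set: set bool]] >>.

Record markov_chain (T : R) (X : R -> Omega -> bool) (x0 : bool)
    (lp lm : R -> R) : Prop := MarkovChain {
  chain_measurable : forall t, 0 <= t <= T -> measurable_fun setT (X t);
  chain_cadlag : forall w, cadlag T (X ^~ w);
  chain_init : forall w, X 0 w = x0;
  chain_markov : exists2 p, transition_function T (generator lp lm) p &
    forall s t x y A, 0 <= s -> s <= t -> t <= T -> past X s A ->
      P (A `&` X s @^-1` [set x] `&` X t @^-1` [set y]) =
      (P (A `&` X s @^-1` [set x]) * (p s t x y)%:E)%E }.

Definition mutually_independent (I : finType) (G : I -> set_system Omega) :=
  forall (J : {set I}) (A : I -> set Omega), (forall i, i \in J -> G i (A i)) ->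
    P (\bigcap_(i in [set` J]) A i) = (\prod_(i in J) fine (P (A i)))%:E.

End two_state_chain.

Section large_deviations.
Context {R : realType} d (Omega : measurableType d) (P : probability Omega R).
Context {S : topologicalType}.
Local Open Scope ereal_scope.

Record rate_function (I : S -> \bar R) : Prop := RateFunction {
  rate_ge0 : forall x, 0 <= I x;
  rate_compact : forall r : R, compact [set x | I x <= r%:E] }.

(* lne is the logarithm on [0, +oo], with lne 0 = -oo. *)
Record LDP (Y : nat -> Omega -> S) (b : nat -> R) (I : S -> \bar R) : Prop :=
    MkLDP {
  LDP_measurable : forall n A, open A -> measurable (Y n @^-1` A);
  LDP_rate : rate_function I;
  LDP_upper : forall F, closed F ->
    limn_esup (fun n => ((b n)^-1)%:E * lne (P (Y n @^-1` F)))
      <= - ereal_inf [set I x | x in F];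
  LDP_lower : forall G, open G ->
    - ereal_inf [set I x | x in G]
      <= limn_einf (fun n => ((b n)^-1)%:E * lne (P (Y n @^-1` G))) }.

End large_deviations.

Section graph_process.
Context {R : realType}.

(* Standing assumptions on the limiting rate b (one of beta^+, beta^-), its
   approximations bn and their lower bound c. *)
Record rate_assumptions (T c : R) (b : R3 R -> R)
    (bn : forall n, 'I_n -> 'I_n -> R -> R) : Prop := RateAssumptions {
  rate_nonneg : forall z, cube T z -> 0 <= b z;
  rate_n_nonneg : forall n i j t, 0 <= t <= T -> 0 <= bn n i j t;
  rate_n_measurable : forall n i j, measurable_fun `[0, T] (bn n i j);
  rate_L1 : inLp T 1 b;
  rate_n_L1 : forall n, inLp T 1 (step_kernel (bn n));
  rate_cvg_L1 : cvgLp T 1 (fun n => step_kernel (bn n)) b;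
  rate_lower_bound : forall n i j t, 0 <= t <= T -> c <= bn n i j t;
  rate_left_continuous : {ae leb2, forall xy, square xy ->
    bounded_left_continuous T (fun t => b (xy, t))};
  rate_n_left_continuous : \forall n \near \oo, forall i j,
    bounded_left_continuous T (bn n i j) }.

Definition graphon_process (Omega : Type) (T : R)
    (X : forall n, 'I_n -> 'I_n -> R -> Omega -> bool)
    (n : nat) (w : Omega) : W0 T :=
  W0_class T (step_kernel (fun i j t => (X n i j t w)%:R)).

Definition Q1 (u vp vm : R) : R :=
  (Num.sqrt (vp * (1 - u)) - Num.sqrt (vm * u)) ^+ 2.

Definition rate_J (T : R) (bp bm : R3 R -> R) (phi : W0 T) : \bar R :=
  (\int[leb3]_(z in cube T) (Q1 (phi z) (bp z) (bm z))%:E)%E.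

End graph_process.

(* Main.v *)
(** The Gärtner-Ellis scheme, with tilts by bounded measurable kernels.  Adding
    [h] to the generator of a two-state chain with rates [p], [q] on the state 1
    gives a matrix whose principal eigenvalue [Lam h p q] is the Legendre dual of
    [u |-> Q1 u p q].  Comparing the Feynman-Kac recursion of each chain with the
    eigenvector [(1, eigr h p q)], frozen on a grid of N time cells, bounds the
    exponential moment of [<h, H^n>] from above and below by
    [exp (a n^2 (\int Lam + o(1)))], up to a factor [K ^ (2 N n^2)] that is
    negligible because [a n -> oo].

    W0 is weakly compact, so the upper bound follows from Chebyshev's inequality
    on a finite cover.  For the lower bound at [phi], one moves [phi] slightly so
    that [h := dQ1 phi] is bounded, tilts by [h], and controls the
    fluctuations under the tilted law with the quadratic bound
    [Lam (dQ1 u + t) <= Lam (dQ1 u) + t u + t^2 / (8 c)].  The same [h] shows that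
    the rate is a supremum of weakly continuous functions. *)

From HB Require Import structures.
Require Import Defs.
From mathcomp Require Import all_boot all_order all_algebra.
From mathcomp Require Import all_classical all_reals all_analysis measurable_realfun.
From mathcomp Require Import ring lra.

Set Implicit Arguments.
Unset Strict Implicit.
Unset Printing Implicit Defensive.

Import Order.TTheory GRing.Theory Num.Theory.
Import numFieldNormedType.Exports.

Local Open Scope classical_set_scope.
Local Open Scope ring_scope.

(** * The Legendre dual of Q1 *)

(** The eigenvector varies along a path, with no more regularity in time than the rates, which are
    controlled only in L^1. Freezing it is affordable because the ratio of its coordinates stays in
    [1/K, K] with K = 1 + 2 H / c: only the bound H of the tilt and the lower bound c of the rates
    enter, never the size of the rates. The constants are therefore chosen in a fixed order: K, a
    truncation level of the rates, the number N of time cells, and only then n. The spatial mesh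
    cannot be chosen, it is dictated by n; so functions have to be approximated on every fine grid,
    not on one convenient grid. Exponentials of time integrals are limits of exponentials of Riemann
    sums, so that only finite-dimensional laws of the chains intervene. The tilted law is never
    constructed: both halves of the principle are read off from unnormalised exponential moments. *)

Section Legendre.
Context {R : realType}.
Implicit Types h p q u v t c e : R.

(* The larger root of [x^2 + x (p + q - h) = p h], the characteristic equation of
   the generator of rates [p], [q] with [h] added on the state 1. *)
Definition Lam (h p q : R) : R :=
  (h - p - q + Num.sqrt ((h + p - q) ^+ 2 + 4 * p * q)) / 2.

Lemma Q1E u p q : 0 <= u <= 1 -> 0 <= p -> 0 <= q ->
  Q1 u p q = p * (1 - u) + q * u - 2 * Num.sqrt (p * q) * Num.sqrt (u * (1 - u)).
Proof.
move=> /andP[u0 u1] p0 q0; rewrite /Q1 sqrrB.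
have u1' : 0 <= 1 - u by rewrite subr_ge0.
rewrite !sqr_sqrtr ?mulr_ge0//.
rewrite -mulr_natl -sqrtrM ?mulr_ge0// -mulrA -sqrtrM ?mulr_ge0//.
rewrite (_ : p * (1 - u) * _ = p * q * (u * (1 - u))); last by ring.
ring.
Qed.

Lemma Lam_root h p q : 0 < p -> 0 < q ->
  Lam h p q ^+ 2 + Lam h p q * (p + q - h) = p * h.
Proof.
move=> p0 q0; rewrite /Lam.
have : 0 <= (h + p - q) ^+ 2 + 4 * p * q by rewrite addr_ge0 ?sqr_ge0// !mulr_ge0// ltW.
move/sqr_sqrtr; set S := Num.sqrt _ => SE.
have -> : ((h - p - q + S) / 2) ^+ 2 + (h - p - q + S) / 2 * (p + q - h) =
  (S ^+ 2 - (h - p - q) ^+ 2) / 4 by field.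
by rewrite SE; field.
Qed.

Lemma Lam_addp_gt0 h p q : 0 < p -> 0 < q -> 0 < p + Lam h p q.
Proof.
move=> p0 q0; rewrite /Lam.
have S0 : `|h + p - q| < Num.sqrt ((h + p - q) ^+ 2 + 4 * p * q).
  rewrite -sqrtr_sqr ltr_sqrt; last by rewrite ltr_wpDl ?sqr_ge0// !mulr_gt0.
  by rewrite ltrDl !mulr_gt0.
set S := Num.sqrt _ in S0 *.
have := ler_norm (- (h + p - q)); rewrite normrN; lra.
Qed.

(** The characteristic equation reads (p + L)(q + L - h) = p q. Hence sqrt(p q) sqrt(u (1 - u)) is
    the geometric mean of (p + L)(1 - u) and (q + L - h) u, and the inequality between the two means
    is the claim. *)
Lemma Lam_young h p q u : 0 < p -> 0 < q -> 0 <= u <= 1 ->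
  h * u - Lam h p q <= Q1 u p q.
Proof.
move=> p0 q0 u01; rewrite Q1E//; [|exact: ltW|exact: ltW].
have L0 := Lam_addp_gt0 h p0 q0.
have Lr := Lam_root h p0 q0.
set L := Lam h p q in L0 Lr *.
have E : (p + L) * (q + L - h) = p * q by move: Lr; rewrite expr2; lra.
have L1 : 0 < q + L - h by rewrite -(pmulr_rgt0 _ L0) E mulr_gt0.
case/andP: u01 => u0 u1.
have u1' : 0 <= 1 - u by lra.
rewrite -mulrA -sqrtrM ?(mulr_ge0 (ltW p0) (ltW q0))// -E.
rewrite (_ : (p + L) * _ * _ = ((p + L) * (1 - u)) * ((q + L - h) * u)); last by ring.
have A0 : 0 <= (p + L) * (1 - u) by rewrite mulr_ge0// ltW.
have B0 : 0 <= (q + L - h) * u by rewrite mulr_ge0// ltW.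
rewrite sqrtrM//.
have := sqr_ge0 (Num.sqrt ((p + L) * (1 - u)) - Num.sqrt ((q + L - h) * u)).
rewrite sqrrB !sqr_sqrtr//; nra.
Qed.

(** The lower bound is [Lam_young] at the zero u = p / (p + q) of [Q1]; the upper bound compares the
    discriminant with a square. *)
Lemma Lam_le h p q : 0 < p -> 0 < q -> `|Lam h p q| <= `|h|.
Proof.
move=> p0 q0.
have pq0 : 0 < p + q by rewrite addr_gt0.
rewrite ler_norml; apply/andP; split.
  have u01 : 0 <= p / (p + q) <= 1.
    by rewrite divr_ge0 ?(ltW p0) ?(ltW pq0)//= ler_pdivrMr// mul1r lerDl ltW.
  have := Lam_young h p0 q0 u01.
  have -> : Q1 (p / (p + q)) p q = 0.
    rewrite /Q1 (_ : p * (1 - _) = q * (p / (p + q))) ?subrr ?expr0n//.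
    by field; rewrite gt_eqF.
  rewrite subr_le0; apply: le_trans.
  rewrite lerNl -mulNr; apply: le_trans (_ : `|h| * 1 <= _); last by rewrite mulr1.
  apply: le_trans (_ : `|h| * (p / (p + q)) <= _).
    by rewrite ler_wpM2r ?(andP u01).1// -normrN ler_norm.
  by rewrite ler_wpM2l// (andP u01).2.
rewrite /Lam ler_pdivrMr//.
suff : Num.sqrt ((h + p - q) ^+ 2 + 4 * p * q) <= 2 * `|h| - h + p + q by lra.
have hh := ler_norm h.
have hh' := ler_norm (- h); rewrite normrN in hh'.
rewrite -[leRHS]ger0_norm; last by lra.
rewrite -sqrtr_sqr ler_wsqrtr//.
have h2 : h ^+ 2 = `|h| ^+ 2 by rewrite -normrX ger0_norm ?sqr_ge0.
have : 0 <= `|h| by [].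
set k := `|h| in hh hh' h2 *.
nra.
Qed.

(* [(1, eigr h p q)] is the eigenvector of [Lam h p q]. *)
Definition eigr h p q : R := 1 + Lam h p q / p.

Lemma eigr_gt0 h p q : 0 < p -> 0 < q -> 0 < eigr h p q.
Proof.
move=> p0 q0; rewrite /eigr -(pmulr_rgt0 _ p0) mulrDr mulr1 mulrCA divff ?gt_eqF//.
by rewrite mulr1; exact: Lam_addp_gt0.
Qed.

(** The row of the state 0 in the eigenvector equation; [eigr1] is the row of the state 1 divided by
    [eigr]. Together they say that both coordinates grow at the rate [Lam]. *)
Lemma eigr0 h p q : 0 < p -> p * (eigr h p q - 1) = Lam h p q.
Proof. by move=> p0; rewrite /eigr; field; rewrite gt_eqF. Qed.

Lemma eigrV h p q : 0 < p -> 0 < q ->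
  (eigr h p q)^-1 = 1 + (Lam h p q - h) / q.
Proof.
move=> p0 q0; have r0 := eigr_gt0 h p0 q0.
apply: (mulfI (lt0r_neq0 r0)); rewrite divff ?gt_eqF// /eigr.
apply: (mulfI (lt0r_neq0 p0)); apply: (mulfI (lt0r_neq0 q0)).
have := Lam_root h p0 q0; set L := Lam h p q => E.
have -> : q * (p * ((1 + L / p) * (1 + (L - h) / q))) =
  (L ^+ 2 + L * (p + q - h)) + p * q - p * h by field; rewrite !gt_eqF.
by rewrite E; ring.
Qed.

Lemma eigr1 h p q : 0 < p -> 0 < q ->
  q * ((eigr h p q)^-1 - 1) + h = Lam h p q.
Proof. by move=> p0 q0; rewrite eigrV//; field; rewrite gt_eqF. Qed.

(** Both [eigr] = 1 + L / p and its inverse 1 + (L - h) / q are controlled through |L| <= m and |L -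
    h| <= 2 m. The bound is independent of the size of p and q, which is essential for unbounded
    rates. *)
Lemma eigr_bounds h p q c m : 0 < c -> c <= p -> c <= q -> `|h| <= m ->
  (1 + 2 * m / c)^-1 <= eigr h p q <= 1 + 2 * m / c.
Proof.
move=> c0 cp cq hm.
have p0 : 0 < p by apply: lt_le_trans cp.
have q0 : 0 < q by apply: lt_le_trans cq.
have m0 : 0 <= m by apply: le_trans hm.
have K0 : 0 < 1 + 2 * m / c.
  by rewrite ltr_pwDl// divr_ge0// ?mulr_ge0// ltW.
have Lh := Lam_le h p0 q0.
have key x y : c <= y -> `|x| <= 2 * m -> 1 + x / y <= 1 + 2 * m / c.
  move=> cy xm; rewrite lerD2l.
  have y0 : 0 < y by apply: lt_le_trans cy.
  apply: le_trans (_ : 2 * m / y <= _).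
    by rewrite ler_wpM2r ?invr_ge0 ?(ltW y0)// (le_trans (ler_norm _)).
  by rewrite ler_wpM2l ?mulr_ge0// lef_pV2.
apply/andP; split; last first.
  by apply: key => //; apply: (le_trans Lh); lra.
rewrite -[leRHS]invrK lef_pV2 ?posrE ?invr_gt0 ?eigr_gt0//.
rewrite eigrV//; apply: key => //.
apply: le_trans (ler_normB _ _) _; lra.
Qed.

(** The derivative of [Q1] in u on (0, 1), that is, the h for which [Lam_young] is an equality at u
    ([Lam_dQ1]). It blows up at the end points of the interval when p and q are positive. *)
Definition dQ1 u p q : R :=
  q - p - Num.sqrt (p * q) * (1 - 2 * u) / Num.sqrt (u * (1 - u)).

Lemma Lam_dQ1_sqrt u p q : 0 < u < 1 -> 0 < p -> 0 < q ->
  Num.sqrt ((dQ1 u p q + p - q) ^+ 2 + 4 * p * q) =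
  Num.sqrt (p * q) / Num.sqrt (u * (1 - u)).
Proof.
move=> /andP[u0 u1] p0 q0; rewrite /dQ1.
have w2 : 0 < u * (1 - u) by rewrite mulr_gt0// subr_gt0.
have s2 : 0 < p * q by rewrite mulr_gt0.
have w0 : 0 < Num.sqrt (u * (1 - u)) by rewrite sqrtr_gt0.
have s0 : 0 < Num.sqrt (p * q) by rewrite sqrtr_gt0.
have := sqr_sqrtr (ltW w2); have := sqr_sqrtr (ltW s2).
set s := Num.sqrt (p * q) in s0 *; set w := Num.sqrt (u * _) in w0 * => sE wE.
rewrite -[RHS]ger0_norm; last by rewrite divr_ge0 ?ltW.
rewrite -sqrtr_sqr; congr Num.sqrt.
rewrite -[4 * p * q]mulrA -sE (_ : (_ + p - q) ^+ 2 = s ^+ 2 * (1 - 2 * u) ^+ 2 / w ^+ 2); last first.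
  by field; rewrite gt_eqF.
rewrite (_ : (s / w) ^+ 2 = s ^+ 2 / w ^+ 2); last by field; rewrite gt_eqF.
have -> : (1 - 2 * u) ^+ 2 = 1 - 4 * w ^+ 2 by rewrite wE; ring.
by field; rewrite gt_eqF.
Qed.

Lemma Lam_dQ1 u p q : 0 < u < 1 -> 0 < p -> 0 < q ->
  Lam (dQ1 u p q) p q = dQ1 u p q * u - Q1 u p q.
Proof.
move=> u01 p0 q0; rewrite /Lam Lam_dQ1_sqrt// Q1E; [|by case/andP: u01 => *; rewrite !ltW|exact: ltW|exact: ltW].
rewrite /dQ1; case/andP: u01 => u0 u1.
have w2 : 0 < u * (1 - u) by rewrite mulr_gt0// subr_gt0.
have w0 : 0 < Num.sqrt (u * (1 - u)) by rewrite sqrtr_gt0.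
have := sqr_sqrtr (ltW w2).
set s := Num.sqrt (p * q); set w := Num.sqrt (u * _) in w0 * => wE.
transitivity (- p + s * u / w); first by field; rewrite gt_eqF.
have -> : s * u / w = s * (2 * w ^+ 2 - u + 2 * u ^+ 2) / w.
  by rewrite wE; field; rewrite gt_eqF.
by field; rewrite gt_eqF.
Qed.

(** A second-order Taylor bound: u is the derivative of [Lam] at [dQ1 u]. The discriminant is at
    least 4 p q, so its root S is at least 2 c, and the remainder t^2 / (4 S) is at most t^2 / (8
    c). *)
Lemma Lam_dQ1D u p q t c : 0 < u < 1 -> 0 < c -> c <= p -> c <= q ->
  Lam (dQ1 u p q + t) p q <= dQ1 u p q * u - Q1 u p q + t * u + t ^+ 2 / (8 * c).
Proof.
move=> u01 c0 cp cq.
have p0 : 0 < p by apply: lt_le_trans cp.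
have q0 : 0 < q by apply: lt_le_trans cq.
rewrite -Lam_dQ1//.
have SE := Lam_dQ1_sqrt u01 p0 q0.
(* The right-hand side is the derivative of h |-> Lam h p q at [dQ1 u p q]. *)
have uE : u = (1 + (dQ1 u p q + p - q) / Num.sqrt ((dQ1 u p q + p - q) ^+ 2 + 4 * p * q)) / 2.
  rewrite SE /dQ1; case/andP: u01 => u0 u1; field.
  by rewrite !gt_eqF// sqrtr_gt0 ?mulr_gt0 ?subr_gt0.
have Sc : 2 * c <= Num.sqrt ((dQ1 u p q + p - q) ^+ 2 + 4 * p * q).
  have c20 : 0 <= 2 * c by rewrite mulr_ge0// ltW.
  rewrite -(ger0_norm c20) -sqrtr_sqr ler_wsqrtr//.
  have := sqr_ge0 (dQ1 u p q + p - q); nra.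
rewrite [t * u](congr1 (fun x => t * x) uE) /Lam.
set x := dQ1 u p q in Sc uE SE *.
have xE : (x + t + p - q) ^+ 2 = (x + p - q + t) ^+ 2 by congr (_ ^+ 2); ring.
have : 0 <= (x + p - q) ^+ 2 + 4 * p * q by rewrite addr_ge0 ?sqr_ge0// !mulr_ge0// ltW.
rewrite xE; set y := x + p - q in Sc uE xE *.
move/sqr_sqrtr; set S := Num.sqrt (y ^+ 2 + _) in Sc uE * => S2.
have S0 : 0 < S by apply: lt_le_trans Sc; rewrite mulr_gt0.
(* By concavity, the square root lies below its tangent at S^2. *)
suff : Num.sqrt ((y + t) ^+ 2 + 4 * p * q) <= S + (2 * y * t + t ^+ 2) / (2 * S).
  have : t ^+ 2 / S <= t ^+ 2 / (2 * c).
    rewrite ler_wpM2l ?sqr_ge0// lef_pV2 ?posrE//.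
    by rewrite mulr_gt0.
  have -> : (2 * y * t + t ^+ 2) / (2 * S) = y * t / S + (t ^+ 2 / S) / 2.
    by field; rewrite gt_eqF.
  have -> : t * ((1 + y / S) / 2) = t / 2 + (y * t / S) / 2 by field; rewrite gt_eqF.
  have -> : t ^+ 2 / (8 * c) = (t ^+ 2 / (2 * c)) / 4 by field; rewrite gt_eqF.
  lra.
have Z : 0 <= S + (2 * y * t + t ^+ 2) / (2 * S).
  have -> : S + (2 * y * t + t ^+ 2) / (2 * S) = (S ^+ 2 + (S ^+ 2 - y ^+ 2) + (y + t) ^+ 2) / (2 * S).
    by field; rewrite gt_eqF.
  rewrite divr_ge0// ?mulr_ge0// ?(ltW S0)//.
  by rewrite S2 (addrC (y ^+ 2)) addrK !addr_ge0 ?sqr_ge0// !mulr_ge0// ltW.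
rewrite -(ger0_norm Z) -sqrtr_sqr ler_wsqrtr//.
have -> : (S + (2 * y * t + t ^+ 2) / (2 * S)) ^+ 2 =
   S ^+ 2 + (2 * y * t + t ^+ 2) + ((2 * y * t + t ^+ 2) / (2 * S)) ^+ 2.
  by field; rewrite gt_eqF.
rewrite S2; have := sqr_ge0 ((2 * y * t + t ^+ 2) / (2 * S)); lra.
Qed.

Lemma sqrtM_le p q : 0 <= p -> 0 <= q -> Num.sqrt (p * q) <= (p + q) / 2.
Proof.
move=> p0 q0; have Z : 0 <= (p + q) / 2 by rewrite divr_ge0 ?addr_ge0.
rewrite -(ger0_norm Z) -sqrtr_sqr ler_wsqrtr//.
have := sqr_ge0 (p - q); nra.
Qed.

(** A contraction towards 1/2 that keeps [dQ1] finite. The scale is e^2 because sqrt(v (1 - v)) is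
    then at least e / 2: [dQ1] is of order (p + q) / e while the displacement is of order e^2, so
    that their product is still of order e (p + q). *)
Definition shrink e u : R := (1 - e ^+ 2) * u + e ^+ 2 / 2.

Section shrink.
Variables (e u p q : R).
Hypotheses (e0 : 0 < e) (e1 : e <= 1) (u01 : 0 <= u <= 1) (p0 : 0 < p) (q0 : 0 < q).

Let e2 : e ^+ 2 <= e. Proof. by rewrite expr2 ger_pMl. Qed.
Let e20 : 0 < e ^+ 2. Proof. by rewrite exprn_gt0. Qed.

Lemma shrink_itv : e ^+ 2 / 2 <= shrink e u <= 1 - e ^+ 2 / 2.
Proof.
case/andP: u01 => u0 u1; rewrite /shrink.
have : (1 - e ^+ 2) * u <= 1 - e ^+ 2 by rewrite ler_piMr// subr_ge0; move: e2 e1; lra.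
have : 0 <= (1 - e ^+ 2) * u by rewrite mulr_ge0// subr_ge0; move: e2 e1; lra.
by move=> ? ?; apply/andP; split; lra.
Qed.

Lemma shrink01 : 0 < shrink e u < 1.
Proof. by case/andP: shrink_itv => ? ?; apply/andP; split; move: e20; lra. Qed.

Lemma shrink_dist : `|shrink e u - u| <= e ^+ 2 / 2.
Proof.
by case/andP: u01 => ? ?; rewrite /shrink ler_norml; apply/andP; split; nra.
Qed.

Lemma shrink_sqrt_ge : e / 2 <= Num.sqrt (shrink e u * (1 - shrink e u)).
Proof.
have Z : 0 <= e / 2 by rewrite divr_ge0// ltW.
rewrite -(ger0_norm Z) -sqrtr_sqr ler_wsqrtr//.
case/andP: shrink_itv => ? ?; nra.
Qed.

(** [Q1] is only Hoelder of exponent 1/2 at the end points: (sqrt x - sqrt y)^2 <= |x - y| turns the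
    displacement e^2 into an error of order e. *)
Lemma Q1_shrink : `|Q1 (shrink e u) p q - Q1 u p q| <= 2 * e * (p + q).
Proof.
have v01 : 0 <= shrink e u <= 1 by case/andP: shrink01 => *; rewrite !ltW.
rewrite !Q1E//; [|exact: ltW|exact: ltW|exact: ltW|exact: ltW].
have sD := shrink_dist.
have ss := sqrtM_le (ltW p0) (ltW q0).
have s0 : 0 <= Num.sqrt (p * q) by exact: sqrtr_ge0.
set s := Num.sqrt (p * q) in ss s0 *.
have wD : `|Num.sqrt (shrink e u * (1 - shrink e u)) - Num.sqrt (u * (1 - u))| <= e.
  case/andP: u01 => u0 u1; case/andP: v01 => v0 v1.
  have a0 : 0 <= shrink e u * (1 - shrink e u) by rewrite mulr_ge0// subr_ge0.
  have b0 : 0 <= u * (1 - u) by rewrite mulr_ge0// subr_ge0.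
  have abd : `|shrink e u * (1 - shrink e u) - u * (1 - u)| <= e ^+ 2.
    have -> : shrink e u * (1 - shrink e u) - u * (1 - u) =
      (shrink e u - u) * (1 - shrink e u - u) by ring.
    rewrite normrM.
    have : `|1 - shrink e u - u| <= 2 by rewrite ler_norml; apply/andP; split; lra.
    have := normr_ge0 (shrink e u - u); nra.
  set x := _ * _ in a0 abd *; set y := u * _ in b0 abd *.
  have E : (Num.sqrt x - Num.sqrt y) ^+ 2 <= e ^+ 2.
    apply: le_trans abd.
    have -> : x - y = (Num.sqrt x - Num.sqrt y) * (Num.sqrt x + Num.sqrt y).
      by rewrite -subr_sqr !sqr_sqrtr.
    rewrite normrM [X in _ * X]ger0_norm ?addr_ge0 ?sqrtr_ge0//.
    rewrite -real_normK ?num_real// expr2 ler_wpM2l//.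
    apply: le_trans (ler_normB _ _) _.
    by rewrite !ger0_norm ?sqrtr_ge0.
  rewrite -(ger0_norm (ltW e0)).
  by rewrite -ler_sqr ?nnegrE// !real_normK ?num_real.
set w := Num.sqrt (_ * (1 - shrink e u)) in wD *; set w' := Num.sqrt (u * _) in wD *.
have -> : p * (1 - shrink e u) + q * shrink e u - 2 * s * w - (p * (1 - u) + q * u - 2 * s * w') =
  (q - p) * (shrink e u - u) - 2 * s * (w - w') by ring.
apply: le_trans (ler_normB _ _) _.
rewrite !normrM (ger0_norm s0) (@ger0_norm _ 2)//.
have : `|q - p| <= p + q by rewrite ler_norml; apply/andP; split; move: p0 q0; lra.
have := normr_ge0 (q - p).
have := normr_ge0 (w - w').
have := normr_ge0 (shrink e u - u).
move: sD wD; set A := `|_ - u|; set B := `|w - w'|; set D := `|q - p| => *.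
have : D * A <= (p + q) * (e / 2) by apply: ler_pM => //; move: e2; lra.
have : s * B <= ((p + q) / 2) * e by apply: ler_pM.
set DA := D * A; have -> : 2 * s * B = 2 * (s * B) by rewrite mulrA.
set sB := s * B; have -> : 2 * e * (p + q) = (p + q) * (e / 2) + 2 * ((p + q) / 2 * e) + (p + q) * (e / 2) by field.
have : 0 <= (p + q) * (e / 2) by rewrite mulr_ge0 ?addr_ge0 ?divr_ge0 ?(ltW p0) ?(ltW q0) ?(ltW e0).
lra.
Qed.

Lemma dQ1_shrink_bound : `|dQ1 (shrink e u) p q| <= (p + q) * (1 + e^-1).
Proof.
rewrite /dQ1.
have ss := sqrtM_le (ltW p0) (ltW q0).
have s0 : 0 <= Num.sqrt (p * q) by exact: sqrtr_ge0.
have w0 := shrink_sqrt_ge.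
have w00 : 0 < Num.sqrt (shrink e u * (1 - shrink e u)).
  by apply: lt_le_trans w0; rewrite divr_gt0.
apply: le_trans (ler_normB _ _) _.
rewrite [leRHS]mulrDr mulr1; apply: lerD.
  by rewrite ler_norml; apply/andP; split; move: p0 q0; lra.
rewrite !normrM (ger0_norm s0) normfV (gtr0_norm w00).
have vv : `|1 - 2 * shrink e u| <= 1.
  by case/andP: shrink01 => ? ?; rewrite ler_norml; apply/andP; split; lra.
apply: le_trans (_ : (p + q) / 2 * 1 * (e / 2)^-1 <= _); last first.
  by rewrite le_eqVlt; apply/orP; left; apply/eqP; field; rewrite gt_eqF.
apply: ler_pM => //; rewrite ?mulr_ge0 ?invr_ge0 ?(ltW w00)//.
  by apply: ler_pM.
by rewrite lef_pV2 ?posrE// divr_gt0.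
Qed.

Lemma dQ1_shrink_dist : `|dQ1 (shrink e u) p q * (u - shrink e u)| <= e * (p + q).
Proof.
rewrite normrM (distrC u).
apply: le_trans (_ : (p + q) * (1 + e^-1) * (e ^+ 2 / 2) <= _).
  by apply: ler_pM => //; [exact: dQ1_shrink_bound|exact: shrink_dist].
have -> : (p + q) * (1 + e^-1) * (e ^+ 2 / 2) = (p + q) * (e ^+ 2 / 2 + e / 2).
  by field; rewrite gt_eqF.
rewrite mulrC ler_wpM2r ?addr_ge0 ?(ltW p0) ?(ltW q0)//; move: e2; lra.
Qed.

End shrink.

End Legendre.

(** * Transition probabilities over short times *)

Lemma bounded_integrable d (T : measurableType d) (R : realType)
    (mu : {measure set T -> \bar R}) (f : T -> R) (D : set T) (M : R) :
  measurable D -> (mu D < +oo)%E -> measurable_fun D f ->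
  (forall x, D x -> `|f x| <= M) -> mu.-integrable D (EFin \o f).
Proof.
move=> mD Doo mf fM; apply: measurable_bounded_integrable => //.
exists M; split; first exact: num_real.
by move=> y My x Dx; apply: (le_trans (fM _ Dx)); exact: ltW.
Qed.

Section paths.
Context {R : realType} d (Omega : measurableType d) (P : probability Omega R).
Variables (T : R) (X : R -> Omega -> bool).

Lemma past_mono s t : s <= t -> past X s `<=` past X t.
Proof.
move=> st; apply: sub_sigma_algebra2 => A [u us [B _ <-]].
exists u; last by exists B.
by move: us; rewrite /= !in_itv/= => /andP[-> /le_trans->].
Qed.

Lemma past_state u t (B : set bool) : 0 <= u <= t -> past X t (X u @^-1` B).
Proof.
by move=> ut; apply: sub_sigma_algebra; exists u; [rewrite /= in_itv|exists B].
Qed.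

Lemma pastI t A B : past X t A -> past X t B -> past X t (A `&` B).
Proof.
set G := [set X u @^-1` B | u in `[0, t] & B in [set: set bool]].
by move=> ? ?; exact: (@measurableI _ (g_sigma_algebraType G)).
Qed.

Lemma past_bigI t (n : nat) (F : 'I_n -> set Omega) :
  (forall i, past X t (F i)) -> past X t (\bigcap_(i in [set: 'I_n]) F i).
Proof.
set G := [set X u @^-1` B | u in `[0, t] & B in [set: set bool]].
by move=> FP; exact: (@fin_bigcap_measurable _ (g_sigma_algebraType G) _ [set: 'I_n] F finite_finset (fun i _ => FP i)).
Qed.

Hypothesis mX : forall t, 0 <= t <= T -> measurable_fun setT (X t).

Lemma past_measurable t : t <= T -> past X t `<=` measurable.
Proof.
move=> tT; apply: smallest_sub; first exact: sigma_algebra_measurable.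
move=> A [u + [B _ <-]]; rewrite /= in_itv/= => /andP[u0 ut].
rewrite -[_ @^-1` _]setTI; apply: mX => //.
by rewrite u0 (le_trans ut).
Qed.

End paths.

Section two_state.
Context {R : realType} (T B : R) (lp lm : R -> R) (p : R -> R -> bool -> bool -> R).
Hypothesis tf : transition_function T (generator lp lm) p.
Hypotheses (mlp : measurable_fun `[0, T] lp) (mlm : measurable_fun `[0, T] lm).
Hypotheses (lpB : forall t, 0 <= t <= T -> 0 <= lp t <= B).
Hypotheses (lmB : forall t, 0 <= t <= T -> 0 <= lm t <= B).

Local Notation mu := (@lebesgue_measure R).

Lemma transition_le1 s t x y : 0 <= s -> s <= t -> t <= T -> p s t x y <= 1.
Proof.
move=> s0 st tT; have := transition_sum1 tf x s0 st tT.
rewrite big_bool/= => <-.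
by case: y; rewrite ?lerDl ?lerDr (transition_ge0 tf).
Qed.

Let mup (s t : R) : s <= t -> fine (mu `[s, t]) = t - s.
Proof.
move=> st; rewrite /= lebesgue_measure_itv/= lte_fin; case: ltP => // ts.
by have -> : t = s by [apply/eqP; rewrite eq_le ts st]; rewrite subrr.
Qed.

Let mufin (s t : R) : (mu `[s, t] < +oo)%E.
Proof.
by rewrite /= lebesgue_measure_itv/=; case: ifP => // _; rewrite -EFinB ltry.
Qed.

Let itv_integrable (s t : R) (f : R -> R) : 0 <= s -> s <= t -> t <= T ->
  measurable_fun `[0, T] f -> (forall u, 0 <= u <= T -> 0 <= f u <= B) ->
  mu.-integrable `[s, t] (EFin \o f).
Proof.
move=> s0 st tT mf fB; apply: (@bounded_integrable _ _ _ _ _ _ B) => //.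
- exact: mufin.
- apply: measurable_funS mf => //; apply: subset_itv; rewrite bnd_simp//.
- move=> u; rewrite /= in_itv/= => /andP[su ut].
  have /andP[f0 fb] : 0 <= f u <= B.
    by apply: fB; rewrite (le_trans s0 su) (le_trans ut tT).
  by rewrite ger0_norm.
Qed.

(* Off-diagonal entries from state [x], with exit rate [f] and return rate [g]. *)
Let transition_off (x : bool) (f g : R -> R) : (forall u, 0 <= u <= T -> 0 <= f u <= B) ->
  (forall u, 0 <= u <= T -> 0 <= g u <= B) ->
  measurable_fun `[0, T] f -> measurable_fun `[0, T] g ->
  (forall s t, 0 <= s -> s <= t -> t <= T -> p s t x (~~ x) =
     \int[mu]_(u in `[s, t]) (p s u x x * f u - p s u x (~~ x) * g u)) ->
  forall s t, 0 <= s -> s <= t -> t <= T ->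
  `|p s t x (~~ x) - \int[mu]_(u in `[s, t]) f u| <= 2 * (B * (t - s)) ^+ 2.
Proof.
move=> fB gB mf mg pE.
have fI (s t : R) : 0 <= s -> s <= t -> t <= T -> mu.-integrable `[s, t] (EFin \o f).
  by move=> *; exact: itv_integrable.
have B0 s : 0 <= s <= T -> 0 <= B by move=> /fB /andP[/le_trans h /h].
have mfg (s t : R) (h : R -> R) : 0 <= s -> s <= t -> t <= T -> measurable_fun `[0, T] h ->
    measurable_fun `[s, t] h.
  move=> s0 st tT; apply: measurable_funS => //; apply: subset_itv; rewrite bnd_simp//.
have mp s t y : 0 <= s -> s <= t -> t <= T ->
    measurable_fun `[s, t] (fun u => p s u x y).
  move=> s0 st tT; apply: measurable_funS (transition_measurable tf x y s0 (le_trans st tT)) => //.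
  by apply: subset_itv; rewrite bnd_simp.
have inT (s t u : R) : 0 <= s -> t <= T -> `[s, t]%classic u -> [/\ s <= u, u <= T & 0 <= u <= T].
  move=> s0 tT; rewrite /= in_itv/= => /andP[su ut]; rewrite su (le_trans ut tT).
  by rewrite (le_trans s0 su).
have p01 (s t u : R) y : 0 <= s -> t <= T -> `[s, t]%classic u -> 0 <= p s u x y <= 1.
  by move=> s0 tT /(inT _ _ _ s0 tT)[su uT _]; rewrite (transition_ge0 tf)// transition_le1.
have I1 s t : 0 <= s -> s <= t -> t <= T ->
    mu.-integrable `[s, t] (EFin \o (fun u => p s u x x * f u - p s u x (~~ x) * g u)).
  move=> s0 st tT; apply: (@bounded_integrable _ _ _ _ _ _ (B + B)) => //.
  - exact: mufin.
  - by apply: measurable_funB; apply: measurable_funM; try exact: mp; apply: mfg.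
- move=> u su; have [su' uT u0] := inT _ _ _ s0 tT su.
  apply: le_trans (ler_normB _ _) _; rewrite !normrM.
  have bd y (h : R -> R) : (forall u, 0 <= u <= T -> 0 <= h u <= B) -> `|p s u x y| * `|h u| <= B.
    move=> hB; case/andP: (hB _ u0) => h0 hb; case/andP: (p01 _ _ _ y s0 tT su) => pp0 pp1.
    by rewrite !ger0_norm// -[leRHS]mul1r ler_pM.
  by rewrite lerD// bd.
have up s t : 0 <= s -> s <= t -> t <= T ->
    p s t x (~~ x) <= \int[mu]_(u in `[s, t]) f u.
  move=> s0 st tT; rewrite pE//; apply: le_Rintegral => //.
  - exact: I1.
  - exact: fI.
  - move=> u su; have [su' uT u0] := inT _ _ _ s0 tT su.
    case/andP: (fB _ u0) => f0 fb; case/andP: (gB _ u0) => g0 gb.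
    case/andP: (p01 _ _ _ x s0 tT su) => pp0 pp1.
    case/andP: (p01 _ _ _ (~~ x) s0 tT su) => pn0 pn1.
    by have : p s u x x * f u <= 1 * f u; [rewrite ler_wpM2r|]; nra.
(* A bootstrap: this crude bound, put back into the forward equation written as f - p (f + g), gives
   the quadratic remainder. *)
have up' s t : 0 <= s -> s <= t -> t <= T -> p s t x (~~ x) <= B * (t - s).
  move=> s0 st tT; apply: le_trans (up _ _ s0 st tT) _.
  rewrite -mup// -Rintegral_cst//; apply: le_Rintegral => //.
  - exact: fI.
  - by apply: (@bounded_integrable _ _ _ _ _ _ `|B|) => //; exact: mufin.
  - by move=> u /(inT _ _ _ s0 tT)[_ _ /fB /andP[]].
move=> s t s0 st tT.
have BB : 0 <= B by apply: (B0 s); rewrite s0 (le_trans st tT).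
rewrite ler_distl; apply/andP; split; last first.
  apply: le_trans (up _ _ s0 st tT) _.
  by rewrite lerDl mulr_ge0// sqr_ge0.
have -> : 2 * (B * (t - s)) ^+ 2 = 2 * B * (B * (t - s)) * (t - s) by ring.
rewrite -[X in _ * X](mup st) -Rintegral_cst// -RintegralB//; last 2 first.
- exact: fI.
- by apply: (@bounded_integrable _ _ _ _ _ _ `|2 * B * (B * (t - s))|) => //; exact: mufin.
rewrite [leRHS]pE//; apply: le_Rintegral => //.
- apply: (@bounded_integrable _ _ _ _ _ _ (B + 2 * B * (B * (t - s)))) => //.
    exact: mufin.
    by apply: measurable_funB => //; apply: mfg.
  move=> u su; have [su' uT u0] := inT _ _ _ s0 tT su.
  have Z : 0 <= 2 * B * (B * (t - s)) by rewrite !mulr_ge0// subr_ge0.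
  apply: le_trans (ler_normB _ _) _; rewrite (ger0_norm Z) lerD2r.
  by case/andP: (fB _ u0) => f0 fb; rewrite ger0_norm.
- exact: I1.
- move=> u su; have [su' uT u0] := inT _ _ _ s0 tT su.
  case/andP: (fB _ u0) => f0 fb; case/andP: (gB _ u0) => g0 gb.
  have pu : p s u x (~~ x) <= B * (t - s).
    apply: le_trans (up' _ _ s0 su' uT) _; rewrite ler_wpM2l// lerD2r.
    by move: su; rewrite /= in_itv/= => /andP[].
  case/andP: (p01 _ _ _ (~~ x) s0 tT su) => pn0 pn1.
  have -> : p s u x x = 1 - p s u x (~~ x).
    have := transition_sum1 tf x s0 su' uT; rewrite big_bool/=.
    by case: (x) => /= <-; ring.
  have : p s u x (~~ x) * (f u + g u) <= B * (t - s) * (2 * B).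
    by apply: ler_pM => //; [rewrite addr_ge0|lra].
  by set z := _ * (f u + g u) => zB; have := zB; rewrite /z; lra.
Qed.

(** The main term is the integral of the rate over the step, not a value of the rate: over a mesh
    these terms add up exactly to the integral, and only the quadratic remainders accumulate. *)
Lemma transition01 s t : 0 <= s -> s <= t -> t <= T ->
  `|p s t false true - \int[mu]_(u in `[s, t]) lp u| <= 2 * (B * (t - s)) ^+ 2.
Proof.
apply: (@transition_off false lp lm) => // {}s {}t s0 st tT.
rewrite (transition_forward tf)//= add0r; apply: eq_Rintegral => u _.
rewrite big_bool/= /generator/=; ring.
Qed.

Lemma transition10 s t : 0 <= s -> s <= t -> t <= T ->
  `|p s t true false - \int[mu]_(u in `[s, t]) lm u| <= 2 * (B * (t - s)) ^+ 2.
Proof.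
apply: (@transition_off true lm lp) => // {}s {}t s0 st tT.
rewrite (transition_forward tf)//= add0r; apply: eq_Rintegral => u _.
rewrite big_bool/= /generator/=; ring.
Qed.

Lemma transition_off_le s t x : 0 <= s -> s <= t -> t <= T ->
  p s t x (~~ x) <= B * (t - s) + 2 * (B * (t - s)) ^+ 2.
Proof.
move=> s0 st tT.
have I (f : R -> R) : measurable_fun `[0, T] f -> (forall u, 0 <= u <= T -> 0 <= f u <= B) ->
    \int[mu]_(u in `[s, t]) f u <= B * (t - s).
  move=> mf fB.
  have -> : B * (t - s) = \int[mu]_(u in `[s, t]) B.
    by rewrite Rintegral_cst// mup.
  apply: le_Rintegral => //; first exact: itv_integrable.
    by apply: (@bounded_integrable _ _ _ _ _ _ `|B|) => //; exact: mufin.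
  move=> u; rewrite /= in_itv/= => /andP[su ut].
  by have /andP[] : 0 <= f u <= B; [apply: fB; rewrite (le_trans s0 su) (le_trans ut tT)|].
have := transition01 s0 st tT; have := transition10 s0 st tT.
have := I _ mlp lpB; have := I _ mlm lmB.
move: (\int[mu]_(u in `[s, t]) lm u) (\int[mu]_(u in `[s, t]) lp u) => i j.
move: (B * (t - s)) => z.
by case: x => /=; rewrite !ler_distl => a1 a2 /andP[a3 a4] /andP[a5 a6]; lra.
Qed.

End two_state.

(** * Feynman-Kac recursions *)

Section exponential_step.
Context {R : realType}.
Implicit Types (A c e y K rho : R).

Lemma expR_sub1_le c : `|c| <= 2^-1 -> `|expR c - 1| <= 2 * `|c|.
Proof.
rewrite ler_norml => /andP[c1 c2].
have h1 := expR_ge1Dx c; have h2 := expR_ge1Dx (- c).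
have e0 := expR_gt0 c.
have eE : expR c * expR (- c) = 1 by rewrite -expRD subrr expR0.
have {h2 eE} h3 : expR c * (1 - c) <= 1 by rewrite -[leRHS]eE ler_pM2l.
set E := expR c in h1 h3 e0 *.
have [c0|c0] := lerP 0 c.
  rewrite [X in _ <= 2 * X]ger0_norm// ler_norml; apply/andP; split; nra.
by rewrite [X in _ <= 2 * X]ltr0_norm// ler_norml; apply/andP; split; nra.
Qed.

Lemma expR_le1D y : `|y| <= 2^-1 -> expR (y - 2 * y ^+ 2) <= 1 + y.
Proof.
rewrite ler_norml => /andP[y1 y2].
have := expR_ge1Dx (- (y - 2 * y ^+ 2)).
have e0 := expR_gt0 (y - 2 * y ^+ 2).
have eE : expR (y - 2 * y ^+ 2) * expR (- (y - 2 * y ^+ 2)) = 1 by rewrite -expRD subrr expR0.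
set E := expR (y - _) in e0 eE *; set F := expR _ in eE * => h.
have h1 : E * (1 - (y - 2 * y ^+ 2)) <= 1 by rewrite -[leRHS]eE ler_pM2l.
have h2 : 1 <= (1 + y) * (1 - (y - 2 * y ^+ 2)).
  have -> : (1 + y) * (1 - (y - 2 * y ^+ 2)) = 1 + y ^+ 2 * (1 + 2 * y) by ring.
  by rewrite lerDl mulr_ge0 ?sqr_ge0//; lra.
have D0 : 0 < 1 - (y - 2 * y ^+ 2) by have := sqr_ge0 y; nra.
by rewrite -(ler_pM2r D0); lra.
Qed.

(** Here p is a jump probability, A the integrated jump rate, c the tilt over the step and rho the
    ratio of the two weights. Put y = (rho exp c - 1) p. It differs from (rho - 1) A by at most 3 K
    e^2, and log(1 + y) from y by at most 2 y^2 <= 18 K^2 e^2, whence 21. The bound on e ensures |y|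
    <= 3 K e <= 1/2. *)
Lemma expR_step A p c e K rho : 1 <= K -> 0 < rho <= K ->
  0 <= p <= e -> `|p - A| <= e ^+ 2 -> `|c| <= e -> e <= (6 * K)^-1 ->
  expR ((rho - 1) * A - 21 * K ^+ 2 * e ^+ 2) <= 1 + (rho * expR c - 1) * p
    <= expR ((rho - 1) * A + 21 * K ^+ 2 * e ^+ 2).
Proof.
move=> K1 /andP[rho0 rhoK] /andP[p0 pe] pA ce eK.
have K0 : 0 < K by lra.
have e0 : 0 <= e by lra.
have eK' : e * (6 * K) <= 1 by rewrite -ler_pdivlMr ?mulr_gt0// div1r.
have e6 : e <= 6^-1.
  apply: (le_trans eK); rewrite lef_pV2 ?posrE//; lra.
have c2 : `|c| <= 2^-1 by lra.
have := expR_sub1_le c2.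
set E := expR c => Ec.
have r1 : `|rho - 1| <= K by rewrite ler_norml; apply/andP; split; lra.
set y := (rho * E - 1) * p.
have yE : y = (rho - 1) * A + ((rho - 1) * (p - A) + rho * (E - 1) * p) by rewrite /y; ring.
have d1 : `|(rho - 1) * (p - A)| <= K * e ^+ 2 by rewrite normrM ler_pM.
have d2 : `|rho * (E - 1)| <= K * (2 * e).
  by rewrite normrM; apply: ler_pM => //; [rewrite gtr0_norm|lra].
have d3 : `|rho * (E - 1) * p| <= K * (2 * e) * e.
  by rewrite normrM ler_pM// ger0_norm.
have yd : `|y - (rho - 1) * A| <= 3 * K * e ^+ 2.
  rewrite yE addrAC subrr add0r; apply: (le_trans (ler_normD _ _)).
  have -> : 3 * K * e ^+ 2 = K * e ^+ 2 + K * (2 * e) * e by ring.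
  exact: lerD.
have yb : `|y| <= 3 * K * e.
  rewrite /y (_ : rho * E - 1 = (rho - 1) + rho * (E - 1)); last by ring.
  rewrite normrM (ger0_norm p0).
  apply: le_trans (_ : (K + K * (2 * e)) * e <= _).
    by apply: ler_pM => //; apply: (le_trans (ler_normD _ _)); rewrite lerD.
  by rewrite ler_wpM2r//; nra.
have yh : `|y| <= 2^-1 by apply: (le_trans yb); lra.
have y2 : y ^+ 2 <= 9 * K ^+ 2 * e ^+ 2.
  rewrite -real_normK ?num_real//.
  have -> : 9 * K ^+ 2 * e ^+ 2 = (3 * K * e) ^+ 2 by ring.
  by rewrite lerXn2r ?nnegrE// !mulr_ge0// ltW.
have KK : K * e ^+ 2 <= K ^+ 2 * e ^+ 2.
  by rewrite ler_wpM2r ?sqr_ge0// expr2 ler_pMl.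
move: yd; rewrite ler_norml => /andP[yd1 yd2].
move: yd1 yd2 y2 KK; rewrite -!mulrA; set k := K * e ^+ 2; set k2 := K ^+ 2 * e ^+ 2 => yd1 yd2 y2 KK.
apply/andP; split.
  apply: (le_trans _ (expR_le1D yh)); rewrite ler_expR; lra.
apply: (le_trans (expR_ge1Dx _)); rewrite ler_expR; lra.
Qed.

End exponential_step.

Section backward.
Context {R : realType}.
Variable p : R -> R -> bool -> bool -> R.

(* For [l] a list of pairs (t, c), the expectation of the product of the
   [exp (c X_t)] for the chain started at [x] at time [s]. *)
Fixpoint bw (s : R) (l : seq (R * R)) (x : bool) : R :=
  if l is tc :: l' then
    p s tc.1 x false * bw tc.1 l' false +
    p s tc.1 x true * expR tc.2 * bw tc.1 l' true
  else 1.

Fixpoint steps (s dt c : R) (m : nat) (l : seq (R * R)) : seq (R * R) :=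
  if m is m'.+1 then (s + dt, c) :: steps (s + dt) dt c m' l else l.

Lemma stepsE s dt c m l :
  steps s dt c m l = [seq (s + i.+1%:R * dt, c) | i <- iota 0 m] ++ l.
Proof.
elim: m s => //= m IH s; rewrite IH mul1r -[in iota 1 m](add1n 0) iotaDl -map_comp.
by congr (_ :: _ ++ l); apply: eq_map => i /=; rewrite add1n -[in RHS]natr1 mulrDl mul1r addrA addrAC.
Qed.

End backward.

Section backward_bound.
Context {R : realType} (T B : R) (lp lm : R -> R) (p : R -> R -> bool -> bool -> R).
Hypothesis tf : transition_function T (generator lp lm) p.
Hypotheses (mlp : measurable_fun `[0, T] lp) (mlm : measurable_fun `[0, T] lm).
Hypotheses (lpB : forall t, 0 <= t <= T -> 0 <= lp t <= B).
Hypotheses (lmB : forall t, 0 <= t <= T -> 0 <= lm t <= B).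

Local Notation mu := (@lebesgue_measure R).

Definition wgt (r : R) (x : bool) : R := if x then r else 1.

(* The growth rates of the two coordinates of the vector [wgt r] under the
   generator perturbed by [h] on the state [true]. *)
Definition rate0 (r : R) (t : R) := lp t * (r - 1).
Definition rate1 (r h : R) (t : R) := lm t * (r^-1 - 1) + h.

(** With r frozen the two growth rates no longer agree. The vector still grows at most at their
    maximum and at least at their minimum, which makes it a super- and a subsolution. *)
Definition rate_max r h t := Num.max (rate0 r t) (rate1 r h t).
Definition rate_min r h t := Num.min (rate0 r t) (rate1 r h t).

Variables (K r h : R).
Hypotheses (K1 : 1 <= K) (r0 : 0 < r) (rK : r <= K) (rVK : r^-1 <= K).

Let rate01_bound t : 0 <= t <= T ->
  `|rate0 r t| <= B * K + `|h| /\ `|rate1 r h t| <= B * K + `|h|.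
Proof.
move=> t0; case/andP: (lpB t0) => lp0 lpb; case/andP: (lmB t0) => lm0 lmb.
have K0 : 0 < K by move: K1; lra.
have ri0 : 0 < r^-1 by rewrite invr_gt0.
have a1 : `|r - 1| <= K by rewrite ler_norml; apply/andP; split; move: r0 rK K1; lra.
have a2 : `|r^-1 - 1| <= K by rewrite ler_norml; apply/andP; split; move: ri0 rVK K1; lra.
split; rewrite /rate0 /rate1.
  apply: le_trans (_ : B * K <= _); last by rewrite lerDl.
  by rewrite normrM; apply: ler_pM => //; rewrite ger0_norm.
apply: (le_trans (ler_normD _ _)); rewrite lerD2r.
by rewrite normrM; apply: ler_pM => //; rewrite ger0_norm.
Qed.

Let mrate0 : measurable_fun `[0, T] (rate0 r).
Proof. exact: measurable_funM. Qed.

Let mrate1 : measurable_fun `[0, T] (rate1 r h).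
Proof. by apply: measurable_funD => //; exact: measurable_funM. Qed.

Let mup (s t : R) : s <= t -> fine (mu `[s, t]) = t - s.
Proof.
move=> st; rewrite /= lebesgue_measure_itv/= lte_fin; case: ltP => // ts.
by have -> : t = s by [apply/eqP; rewrite eq_le ts st]; rewrite subrr.
Qed.

Let mufin (s t : R) : (mu `[s, t] < +oo)%E.
Proof.
by rewrite /= lebesgue_measure_itv/=; case: ifP => // _; rewrite -EFinB ltry.
Qed.

Let integrable_rate (f : R -> R) M s t : 0 <= s -> t <= T ->
  measurable_fun `[0, T] f -> (forall u, 0 <= u <= T -> `|f u| <= M) ->
  mu.-integrable `[s, t] (EFin \o f).
Proof.
move=> s0 tT mf fM; apply: (@bounded_integrable _ _ _ _ _ _ M) => //.
- exact: mufin.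
- by apply: measurable_funS mf => //; apply: subset_itv; rewrite bnd_simp.
- move=> u; rewrite /= in_itv/= => /andP[su ut]; apply: fM.
  by rewrite (le_trans s0)//= (le_trans ut).
Qed.

Let ratemB u : 0 <= u <= T -> `|rate_max r h u| <= B * K + `|h| /\
  `|rate_min r h u| <= B * K + `|h|.
Proof.
move=> u0; have [h1 h2] := rate01_bound u0; rewrite /rate_max /rate_min.
by split; [case: (leP (rate0 r u))|case: (leP (rate0 r u))].
Qed.

Let mmax : measurable_fun `[0, T] (rate_max r h).
Proof. exact: measurable_maxr. Qed.

Let mmin : measurable_fun `[0, T] (rate_min r h).
Proof. exact: measurable_minr. Qed.

Lemma integrable_rate_max s t : 0 <= s -> t <= T ->
  mu.-integrable `[s, t] (EFin \o rate_max r h).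
Proof. by move=> s0 tT; apply: (integrable_rate s0 tT mmax (fun u u0 => (ratemB u0).1)). Qed.

Lemma integrable_rate_min s t : 0 <= s -> t <= T ->
  mu.-integrable `[s, t] (EFin \o rate_min r h).
Proof. by move=> s0 tT; apply: (integrable_rate s0 tT mmin (fun u u0 => (ratemB u0).2)). Qed.

(** [E * dt] dominates all small quantities of one step. The factor 2 leaves room for the quadratic
    term in p <= B dt + 2 (B dt)^2 and gives 2 (B dt)^2 <= (E dt)^2. *)
Let E := 2 * B + `|h|.
Let C := 21 * K ^+ 2.

Lemma one_step s dt x : 0 <= s -> 0 <= dt -> s + dt <= T -> E * dt <= (6 * K)^-1 ->
  wgt r x * expR (\int[mu]_(u in `[s, s + dt]) rate_min r h u - C * (E * dt) ^+ 2)
  <= p s (s + dt) x false + p s (s + dt) x true * expR (h * dt) * r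
  <= wgt r x * expR (\int[mu]_(u in `[s, s + dt]) rate_max r h u + C * (E * dt) ^+ 2).
Proof.
move=> s0 dt0 sT eK; set t := s + dt.
have st : s <= t by rewrite lerDl.
have s0T : 0 <= s <= T by rewrite s0 (le_trans st).
have B0 : 0 <= B by case/andP: (lpB s0T) => /le_trans; apply.
have dtE : t - s = dt by rewrite /t addrAC subrr add0r.
have K0 : 0 < K by move: K1; lra.
have E0 : 0 <= E by rewrite addr_ge0 ?mulr_ge0.
have Bdt : 0 <= B * dt by rewrite mulr_ge0.
have e0 : 0 <= E * dt by rewrite mulr_ge0.
have e6 : E * dt <= 6^-1.
  by apply: (le_trans eK); rewrite lef_pV2 ?posrE// ?mulr_gt0// ler_peMr.
have Be : 2 * (B * dt) <= E * dt.
  by rewrite mulrA ler_wpM2r// lerDl.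
have ce : `|h * dt| <= E * dt.
  by rewrite normrM (ger0_norm dt0) ler_wpM2r// lerDr mulr_ge0.
have ce' : `|- (h * dt)| <= E * dt by rewrite normrN.
have pe y : 0 <= p s t y (~~ y) <= E * dt.
  rewrite (transition_ge0 tf)//=.
  have := transition_off_le tf mlp mlm lpB lmB y s0 st sT.
  rewrite dtE => /le_trans; apply; apply: (le_trans _ Be).
  by set z := B * dt in Bdt Be *; have : z <= 2^-1 by [lra]; nra.
have d2 : 2 * (B * dt) ^+ 2 <= (E * dt) ^+ 2.
  by set z := B * dt in Bdt Be *; set w := E * dt in e0 Be *; nra.
have p01 := transition01 tf mlp mlm lpB lmB s0 st sT.
have p10 := transition10 tf mlp mlm lpB lmB s0 st sT.
rewrite dtE in p01 p10.
have {}p01 := le_trans p01 d2; have {}p10 := le_trans p10 d2.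
have i0 (f : R -> R) : measurable_fun `[0, T] f -> (forall t, 0 <= t <= T -> 0 <= f t <= B) ->
   mu.-integrable `[s, t] (EFin \o f).
  move=> mf fB; apply: (integrable_rate s0 sT mf (M := B)) => u u0.
  by case/andP: (fB _ u0) => f0 fb; rewrite ger0_norm.
have J0 : \int[mu]_(u in `[s, t]) rate0 r u = (r - 1) * \int[mu]_(u in `[s, t]) lp u.
  by rewrite RintegralZr//; [rewrite mulrC|exact: i0].
have J1 : \int[mu]_(u in `[s, t]) rate1 r h u =
    (r^-1 - 1) * \int[mu]_(u in `[s, t]) lm u + h * dt.
  rewrite RintegralD//; last 2 first.
  - apply: (integrable_rate s0 sT (M := B * K)); first exact: measurable_funM.
    move=> u u0; case/andP: (lmB u0) => l0 lb; rewrite normrM (ger0_norm l0).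
    apply: ler_pM => //; have ri0 : 0 < r^-1 by rewrite invr_gt0.
    by rewrite ler_norml; apply/andP; split; move: ri0 rVK K1; lra.
  - by apply: (@bounded_integrable _ _ _ _ _ _ `|h|) => //; exact: mufin.
  rewrite RintegralZr//; last exact: i0.
  by rewrite Rintegral_cst// mup// dtE mulrC.
have I0 := integrable_rate s0 sT mrate0 (fun u u0 => (rate01_bound u0).1).
have I1 := integrable_rate s0 sT mrate1 (fun u u0 => (rate01_bound u0).2).
have Im := integrable_rate_min s0 sT.
have IM := integrable_rate_max s0 sT.
have [m0 M0] : \int[mu]_(u in `[s, t]) rate_min r h u <= \int[mu]_(u in `[s, t]) rate0 r u /\
    \int[mu]_(u in `[s, t]) rate0 r u <= \int[mu]_(u in `[s, t]) rate_max r h u.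
  split; apply: le_Rintegral => // u _; first by rewrite /rate_min ge_min lexx.
  by rewrite /rate_max le_max lexx.
have [m1 M1] : \int[mu]_(u in `[s, t]) rate_min r h u <= \int[mu]_(u in `[s, t]) rate1 r h u /\
    \int[mu]_(u in `[s, t]) rate1 r h u <= \int[mu]_(u in `[s, t]) rate_max r h u.
  split; apply: le_Rintegral => // u _; first by rewrite /rate_min ge_min lexx orbT.
  by rewrite /rate_max le_max lexx orbT.
have ps y : p s t y y = 1 - p s t y (~~ y).
  have := transition_sum1 tf y s0 st sT; rewrite big_bool/=.
  by case: (y) => /= <-; ring.
case: x => /=.
  have r'0 : 0 < r^-1 by rewrite invr_gt0.
  have r'K : 0 < r^-1 <= K by rewrite r'0.
  have := expR_step K1 r'K (pe true) p10 ce' eK; rewrite -/C.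
  rewrite (ps true)/= => /andP[L U].
  (* From the state 1 the factor [r * expR (h * dt)] is taken out; what remains is [expR_step] with
     the ratio r^-1 and the opposite tilt. *)
  have EE : p s t true false + (1 - p s t true false) * expR (h * dt) * r =
     r * (expR (h * dt) * (1 + (r^-1 * expR (- (h * dt)) - 1) * p s t true false)).
    rewrite mulrDr mulr1 !mulrA mulrBr.
    have -> : expR (h * dt) * (r^-1 * expR (- (h * dt))) = r^-1.
      by rewrite mulrCA -expRD subrr expR0 mulr1.
    by field; rewrite gt_eqF.
  rewrite EE; apply/andP; split; rewrite ler_pM2l//.
    apply: le_trans (_ : expR (h * dt) * expR ((r^-1 - 1) *
      (\int[mu]_(u in `[s, t]) lm u) - C * (E * dt) ^+ 2) <= _); last first.
      by rewrite ler_pM2l ?expR_gt0.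
    by rewrite -expRD ler_expR addrA lerD2r addrC -J1.
  apply: le_trans (_ : expR (h * dt) * expR ((r^-1 - 1) *
      (\int[mu]_(u in `[s, t]) lm u) + C * (E * dt) ^+ 2) <= _).
    by rewrite ler_pM2l ?expR_gt0.
  by rewrite -expRD ler_expR addrA lerD2r addrC -J1.
have rK' : 0 < r <= K by rewrite r0.
have := expR_step K1 rK' (pe false) p01 ce eK; rewrite -/C.
rewrite (ps false)/= !mul1r => /andP[L U].
have EE : 1 - p s t false true + p s t false true * expR (h * dt) * r =
     1 + (r * expR (h * dt) - 1) * p s t false true by ring.
rewrite EE; apply/andP; split.
  by apply: le_trans L; rewrite ler_expR lerD2r -J0.
by apply: (le_trans U); rewrite ler_expR lerD2r -J0.
Qed.

Let Rintegral_split (f : R -> R) s u t : s <= u -> u <= t ->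
  mu.-integrable `[s, t] (EFin \o f) ->
  \int[mu]_(v in `[s, t]) f v = \int[mu]_(v in `[s, u]) f v + \int[mu]_(v in `[u, t]) f v.
Proof.
move=> su ut fi.
rewrite -(@Rintegral_itv_obnd_cbnd _ u (BRight t)); last first.
  by apply: integrableS fi => //; apply: subset_itv; rewrite bnd_simp.
by rewrite -(@Rintegral_itvB _ f (BLeft s) (BRight t) u)// addrC subrK.
Qed.

(** A discrete Gronwall argument, backwards in time: as long as r is the same, bounds proportional
    to [wgt r] are reproduced by every step, without any loss of constant. *)
Lemma bw_steps s dt m l (D1 D2 : R) : 0 <= s -> 0 <= dt -> s + m%:R * dt <= T ->
  E * dt <= (6 * K)^-1 -> 0 <= D1 -> 0 <= D2 ->
  (forall y, D1 * wgt r y <= bw p (s + m%:R * dt) l y <= D2 * wgt r y) ->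
  forall x,
  D1 * wgt r x * expR (\int[mu]_(u in `[s, s + m%:R * dt]) rate_min r h u
    - m%:R * (C * (E * dt) ^+ 2))
  <= bw p s (steps s dt (h * dt) m l) x
  <= D2 * wgt r x * expR (\int[mu]_(u in `[s, s + m%:R * dt]) rate_max r h u
    + m%:R * (C * (E * dt) ^+ 2)).
Proof.
move=> s0 dt0 + eK D10 D20; elim: m s s0 => [|m IH] s s0 sT H x /=.
  have := H x; rewrite !mul0r !addr0 subr0 set_itv1 !Rintegral_set1 expR0 !mulr1.
  by [].
have sdt : s + m.+1%:R * dt = s + dt + m%:R * dt.
  by rewrite -natr1 mulrDl mul1r addrA addrAC.
have mdt : 0 <= m%:R * dt by rewrite mulr_ge0.
have s1 : s + dt <= s + m.+1%:R * dt by rewrite sdt lerDl.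
have s2 : s <= s + dt by rewrite lerDl.
have sdT : s + dt <= T by exact: le_trans sT.
have := IH (s + dt) (addr_ge0 s0 dt0).
rewrite -sdt => /(_ sT H); rewrite {IH}.
set J1 := \int[mu]_(u in `[s + dt, _]) rate_min r h u.
set J2 := \int[mu]_(u in `[s + dt, _]) rate_max r h u => IH.
rewrite (Rintegral_split s2 s1); last exact: integrable_rate_min.
rewrite (Rintegral_split s2 s1); last exact: integrable_rate_max.
rewrite -/J1 -/J2.
have /andP[L U] := one_step x s0 dt0 sdT eK.
have pg0 y : 0 <= p s (s + dt) x y by apply: (transition_ge0 tf).
have e0 := expR_ge0 (h * dt).
set a := \int[mu]_(u in _) _ in L *; set b := \int[mu]_(u in _) _ in U *.
set err := C * _ in L U IH *.
have /andP[Lf Uf] := IH false; have /andP[Lt Ut] := IH true.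
rewrite /= ?mulr1 in Lf Uf Lt Ut.
rewrite -natr1 mulrDl mul1r; apply/andP; split.
  have -> : a + J1 - (m%:R * err + err) = (a - err) + (J1 - m%:R * err) by ring.
  rewrite expRD; set X := expR (J1 - _) in Lf Lt *.
  apply: le_trans (_ : D1 * X * (p s (s + dt) x false + p s (s + dt) x true * expR (h * dt) * r) <= _).
    rewrite [leLHS](_ : _ = D1 * X * (wgt r x * expR (a - err))); last by ring.
    by rewrite ler_wpM2l ?mulr_ge0 ?expR_ge0.
  have -> : D1 * X * (p s (s + dt) x false + p s (s + dt) x true * expR (h * dt) * r) =
    p s (s + dt) x false * (D1 * X) + p s (s + dt) x true * expR (h * dt) * (D1 * r * X) by ring.
  by rewrite lerD// ler_wpM2l// mulr_ge0.
have -> : b + J2 + (m%:R * err + err) = (b + err) + (J2 + m%:R * err) by ring.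
rewrite expRD; set X := expR (J2 + _) in Uf Ut *.
apply: le_trans (_ : D2 * X * (p s (s + dt) x false + p s (s + dt) x true * expR (h * dt) * r) <= _).
  have -> : D2 * X * (p s (s + dt) x false + p s (s + dt) x true * expR (h * dt) * r) =
    p s (s + dt) x false * (D2 * X) + p s (s + dt) x true * expR (h * dt) * (D2 * r * X) by ring.
  by rewrite lerD// ler_wpM2l// mulr_ge0.
rewrite [leRHS](_ : _ = D2 * X * (wgt r x * expR (b + err))); last by ring.
by rewrite ler_wpM2l ?mulr_ge0 ?expR_ge0.
Qed.

End backward_bound.

Section finite_sums.
Context d (T : measurableType d) (R : realType) (mu : {measure set T -> \bar R}).

Lemma Rintegral_sum (D : set T) (I : Type) (s : seq I) (f : I -> T -> R) :
  measurable D -> (forall i, mu.-integrable D (EFin \o f i)) ->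
  \int[mu]_(x in D) (\sum_(i <- s) f i x) = \sum_(i <- s) \int[mu]_(x in D) f i x.
Proof.
move=> mD fi; elim: s => [|i s IH].
  under eq_Rintegral do rewrite big_nil.
  by rewrite big_nil Rintegral_cst// mul0r.
under eq_Rintegral do rewrite big_cons.
rewrite big_cons RintegralD ?IH//.
rewrite (_ : _ \o _ = fun x => (\sum_(i <- s) (f i x)%:E)%E); last first.
  by apply/funext => x /=; rewrite -sumEFin.
by apply: integrable_sum => // j _; exact: fi.
Qed.

Lemma Rintegral_indic (D A : set T) : measurable D -> measurable A ->
  \int[mu]_(x in D) \1_A x = fine (mu (A `&` D)).
Proof. by move=> mD mA; rewrite /Rintegral integral_indic. Qed.

End finite_sums.

(** * Exponential functionals of a chain sampled at finitely many times *)

Section laplace_chain.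
Context {R : realType} d (Omega : measurableType d) (P : probability Omega R).
Variables (T : R) (X : R -> Omega -> bool) (p : R -> R -> bool -> bool -> R).
Hypothesis mX : forall t, 0 <= t <= T -> measurable_fun setT (X t).
Hypothesis markov : forall s t x y A, 0 <= s -> s <= t -> t <= T -> past X s A ->
  P (A `&` X s @^-1` [set x] `&` X t @^-1` [set y]) =
  (P (A `&` X s @^-1` [set x]) * (p s t x y)%:E)%E.

Lemma measurable_state t : 0 <= t <= T -> measurable_fun setT (fun w => (X t w)%:R : R).
Proof.
move=> t0; have -> : (fun w => (X t w)%:R) = \1_(X t @^-1` [set true]) :> (Omega -> R).
  apply/funext => w; rewrite indicE; congr (_%:R).
  by case: (boolP (X t w)) => xt; [rewrite mem_set|rewrite memNset//= (negbTE xt)].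
by apply: measurable_indic; rewrite -[_ @^-1` _]setTI; apply: mX.
Qed.

Definition exp_path (l : seq (R * R)) (w : Omega) : R :=
  expR (\sum_(tc <- l) tc.2 * (X tc.1 w)%:R).

Lemma measurable_exp_path l : all (fun tc => 0 <= tc.1 <= T) l ->
  measurable_fun setT (exp_path l).
Proof.
move=> lT; apply: measurableT_comp; first exact: measurable_expR.
elim: l lT => [_|tc l IH /= /andP[tcT lT]].
  rewrite (_ : (fun w => _) = cst 0); first exact: measurable_cst.
  by apply/funext => w; rewrite big_nil.
rewrite (_ : (fun w => _) =
    (fun w => tc.2 * (X tc.1 w)%:R) \+ (fun w => \sum_(tc <- l) tc.2 * (X tc.1 w)%:R)).
  2: by apply/funext => w; rewrite big_cons.
apply: measurable_funD; last exact: IH.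
by apply: measurable_funM => //; exact: measurable_state.
Qed.

Lemma exp_path_le l w : exp_path l w <= expR (\sum_(tc <- l) `|tc.2|).
Proof.
rewrite ler_expR; apply: ler_sum => tc _.
by case: (X _ _); rewrite ?mulr1 ?mulr0// ler_norm.
Qed.

Lemma integrable_exp_path l D : measurable D -> all (fun tc => 0 <= tc.1 <= T) l ->
  P.-integrable D (EFin \o exp_path l).
Proof.
move=> mD lT; apply: (@bounded_integrable _ _ _ _ _ _ (expR (\sum_(tc <- l) `|tc.2|))) => //.
- by rewrite ltey_eq fin_num_measure.
- by apply: measurable_funTS; exact: measurable_exp_path.
- by move=> w _; rewrite ger0_norm ?expR_ge0// exp_path_le.
Qed.

(** The event A of the past is what carries the induction: conditioning on the state at s becomes,
    at the next sample time, one more event of the past, to which the Markov property applies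
    again. *)
Lemma laplace_bw l s x A : 0 <= s ->
  path <=%R s (map fst l) -> all (fun tc => tc.1 <= T) l -> s <= T -> past X s A ->
  \int[P]_(w in A `&` X s @^-1` [set x]) exp_path l w =
  fine (P (A `&` X s @^-1` [set x])) * bw p s l x.
Proof.
move=> + + + sT; elim: l s x A sT => [|[t c] l IH] s x A sT s0 /= + + pA.
  move=> _ _; rewrite mulr1.
  under eq_Rintegral do rewrite /exp_path big_nil expR0.
  rewrite Rintegral_cst ?mul1r//; apply: (past_measurable mX sT).
  by apply: pastI => //; apply: past_state; rewrite s0 lexx.
move=> /andP[st sorted] /andP[tT allT].
have t0 := le_trans s0 st.
set D := A `&` _.
have pD : past X s D by apply: pastI => //; apply: past_state; rewrite s0 lexx.
have pDt : past X t D by exact: (past_mono st).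
have mD : measurable D by exact: (past_measurable mX sT).
have mxy (y : bool) : measurable (X t @^-1` [set y]).
  by apply: (past_measurable mX tT); apply: past_state; rewrite t0 lexx.
have all0 : all (fun tc => 0 <= tc.1 <= T) ((t, c) :: l).
  rewrite /= t0 tT/=; apply/allP => tc tcl; rewrite (allP allT _ tcl) andbT.
  have := order_path_min le_trans sorted.
  by move=> /allP/(_ _ (map_f fst tcl)); apply: le_trans.
have allt : all (fun tc => 0 <= tc.1 <= T) l by case/andP: all0.
have DE : D = (D `&` X t @^-1` [set false]) `|` (D `&` X t @^-1` [set true]).
  by rewrite -setIUr -preimage_setU; apply/seteqP; split => [w Dw|w []//]; split => //=; case: (X t w); [right|left].
have step (y : bool) : \int[P]_(w in D `&` X t @^-1` [set y]) exp_path ((t, c) :: l) w =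
   fine (P D) * (p s t x y * expR (c * y%:R) * bw p t l y).
  transitivity (\int[P]_(w in D `&` X t @^-1` [set y]) (expR (c * y%:R) * exp_path l w)).
    apply: eq_Rintegral => w /set_mem[_ /= Xy].
    by rewrite /exp_path big_cons expRD Xy.
  rewrite RintegralZl; last 2 first.
  - exact: measurableI.
  - by apply: integrable_exp_path => //; exact: measurableI.
  rewrite IH// markov// fineM ?fin_num_measure//=; ring.
rewrite [in LHS]DE Rintegral_setU; last 4 first.
- exact: measurableI.
- exact: measurableI.
- by rewrite -DE; exact: integrable_exp_path.
- rewrite disj_set2E; apply/eqP/seteqP; split => // w [[_ /= ->] [_ /=]]//.
by rewrite !step/= mulr0 expR0 !mulr1; ring.
Qed.

End laplace_chain.

Section pieces.
Context {R : realType}.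

(* Sample times [dlt (k + (i + 1) / m)], weighted by the step function of values
   [eta k], over [n] cells of length [dlt]. *)
Fixpoint psteps (dlt : R) (m : nat) (eta : nat -> R) (k n : nat) : seq (R * R) :=
  if n is n'.+1 then
    steps (k%:R * dlt) (dlt / m%:R) (eta k * (dlt / m%:R)) m (psteps dlt m eta k.+1 n')
  else [::].

Lemma big_psteps dlt m eta k n (F : R -> R) :
  \sum_(tc <- psteps dlt m eta k n) tc.2 * F tc.1 =
  \sum_(k <= j < k + n) eta j * \sum_(i < m) (dlt / m%:R) * F (j%:R * dlt + i.+1%:R * (dlt / m%:R)).
Proof.
elim: n k => [|n IH] k /=; first by rewrite big_nil addn0 big_geq.
rewrite stepsE big_cat/= IH big_map [in RHS]big_ltn ?addnS ?ltnS ?leq_addr// addSn; congr (_ + _).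
rewrite -[m in iota 0 m]subn0 -/(index_iota 0 m) big_mkord big_distrr/=.
by apply: eq_bigr => i _; rewrite -mulrA.
Qed.

Lemma psteps_sorted dlt m eta k n : 0 <= dlt ->
  path <=%R (k%:R * dlt) (map fst (psteps dlt m.+1 eta k n)).
Proof.
move=> d0.
have gen j s l : path <=%R (s + j%:R * (dlt / m.+1%:R)) (map fst l) ->
    forall c, path <=%R s (map fst (steps s (dlt / m.+1%:R) c j l)).
  elim: j s => [|j IH] s /=; first by rewrite mul0r addr0.
  move=> H c; rewrite lerDl divr_ge0//=; apply: IH.
  by move: H; rewrite -natr1 mulrDl mul1r addrA addrAC.
elim: n k => // n IH k; apply: gen.
have -> : k%:R * dlt + m.+1%:R * (dlt / m.+1%:R) = k.+1%:R * dlt.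
  by rewrite mulrCA mulfV ?pnatr_eq0// -natr1; ring.
exact: IH.
Qed.

Lemma psteps_le dlt m eta k n : 0 <= dlt ->
  all (fun tc => tc.1 <= (k + n)%:R * dlt) (psteps dlt m.+1 eta k n).
Proof.
move=> d0; elim: n k => // n IH k;
have -> : psteps dlt m.+1 eta k n.+1 = steps (k%:R * dlt) (dlt / m.+1%:R)
  (eta k * (dlt / m.+1%:R)) m.+1 (psteps dlt m.+1 eta k.+1 n) by [].
rewrite stepsE all_cat -[(k + n.+1)%N]addSnnS IH andbT.
apply/allP => _ /mapP[i + ->] /=; rewrite mem_iota add0n => /andP[_ im].
apply: le_trans (_ : k%:R * dlt + m.+1%:R * (dlt / m.+1%:R) <= _).
  by rewrite lerD2l ler_wpM2r ?divr_ge0// ler_nat.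
rewrite (mulrCA m.+1%:R) mulfV ?pnatr_eq0// mulr1 -[X in _ + X]mul1r -mulrDl natr1.
by rewrite ler_wpM2r// ler_nat leq_addr.
Qed.

End pieces.

Section pieces_bound.
Context {R : realType} (T B : R) (lp lm : R -> R) (p : R -> R -> bool -> bool -> R).
Hypothesis tf : transition_function T (generator lp lm) p.
Hypotheses (mlp : measurable_fun `[0, T] lp) (mlm : measurable_fun `[0, T] lm).
Hypotheses (lpB : forall t, 0 <= t <= T -> 0 <= lp t <= B).
Hypotheses (lmB : forall t, 0 <= t <= T -> 0 <= lm t <= B).
Local Notation mu := (@lebesgue_measure R).

Variables (K H : R) (r eta : nat -> R).
Hypotheses (K1 : 1 <= K) (B0 : 0 <= B) (rK : forall k, 0 < r k <= K) (rVK : forall k, (r k)^-1 <= K).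
Hypothesis etaH : forall k, `|eta k| <= H.

Let E := 2 * B + H.
Let C := 21 * K ^+ 2.

(** The weight changes from cell to cell. Passing from one weight to the next through the constant
    vector costs a factor K at each end of a cell, hence K^2 per cell. This loss does not depend on
    the mesh m, whereas the error of [bw_steps] is O(1/m). *)
Lemma bw_psteps dlt m k n : 0 <= dlt -> (k + n)%:R * dlt <= T ->
  E * (dlt / m.+1%:R) <= (6 * K)^-1 -> forall x,
  K ^- (2 * n) * expR (\sum_(k <= j < k + n)
     (\int[mu]_(u in `[j%:R * dlt, j.+1%:R * dlt]) rate_min lp lm (r j) (eta j) u)
      - n%:R * (C * (E * dlt) ^+ 2 / m.+1%:R))
  <= bw p (k%:R * dlt) (psteps dlt m.+1 eta k n) x
  <= K ^+ (2 * n) * expR (\sum_(k <= j < k + n)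
     (\int[mu]_(u in `[j%:R * dlt, j.+1%:R * dlt]) rate_max lp lm (r j) (eta j) u)
      + n%:R * (C * (E * dlt) ^+ 2 / m.+1%:R)).
Proof.
move=> d0 + eK; elim: n k => [|n IH] k knT x.
  by rewrite addn0 big_geq// big_geq// mul0r subrr addr0 muln0 expr0 invr1 expR0 mulr1 lexx.
have K0 : 0 < K by move: K1; lra.
have K0' := ltW K0.
have H0 : 0 <= H by apply: le_trans (etaH 0).
have kE : k%:R * dlt + m.+1%:R * (dlt / m.+1%:R) = k.+1%:R * dlt.
  by rewrite (mulrCA m.+1%:R) mulfV ?pnatr_eq0// mulr1 -natr1 mulrDl mul1r.
have kT : k%:R * dlt + m.+1%:R * (dlt / m.+1%:R) <= T.
  by rewrite kE; apply: le_trans knT; rewrite ler_wpM2r// ler_nat addnS ltnS leq_addr.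
have /andP[rk0 rkK] := rK k.
have dm0 : 0 <= dlt / m.+1%:R by rewrite divr_ge0.
have k0 : 0 <= k%:R * dlt by rewrite mulr_ge0.
set err := C * (E * dlt) ^+ 2 / m.+1%:R.
have ek : 2 * B + `|eta k| <= E by rewrite lerD2l.
have ek0 : 0 <= 2 * B + `|eta k| by rewrite addr_ge0// mulr_ge0.
have eK' : (2 * B + `|eta k|) * (dlt / m.+1%:R) <= (6 * K)^-1.
  by apply: le_trans eK; rewrite ler_wpM2r.
have errE : m.+1%:R * (C * ((2 * B + `|eta k|) * (dlt / m.+1%:R)) ^+ 2) <= err.
  apply: le_trans (_ : m.+1%:R * (C * (E * (dlt / m.+1%:R)) ^+ 2) <= _).
    rewrite ler_wpM2l// ler_wpM2l ?mulr_ge0 ?sqr_ge0//.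
    have a0 := mulr_ge0 ek0 dm0; have ab := ler_wpM2r dm0 ek.
    by rewrite !expr2; apply: ler_pM.
  rewrite /err le_eqVlt; apply/orP; left; apply/eqP; field.
  by rewrite addrC natr1 pnatr_eq0.
have knE : (k + n.+1 = k.+1 + n)%N by rewrite addSnnS.
rewrite knE in knT *.
have {}IH := IH k.+1 knT.
set S1 := \sum_(k.+1 <= j < _) _ in IH; set S2 := \sum_(k.+1 <= j < _) _ in IH.
rewrite !(big_ltn (ltn_addr _ (ltnSn k))) -/S1 -/S2 /=.
set D1 := K ^- (2 * n) * expR (S1 - n%:R * err) in IH.
set D2 := K ^+ (2 * n) * expR (S2 + n%:R * err) in IH.
have D10 : 0 <= D1 by rewrite mulr_ge0 ?expR_ge0// invr_ge0 exprn_ge0.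
have D20 : 0 <= D2 by rewrite mulr_ge0 ?expR_ge0// exprn_ge0.
have wK y : K^-1 <= wgt (r k) y <= K.
  case: y => /=; last by rewrite K1 andbT invf_le1.
  by rewrite rkK andbT -[leRHS]invrK lef_pV2 ?posrE ?invr_gt0// rVK.
have Hb y : D1 / K * wgt (r k) y <=
    bw p (k%:R * dlt + m.+1%:R * (dlt / m.+1%:R)) (psteps dlt m.+1 eta k.+1 n) y <=
    D2 * K * wgt (r k) y.
  rewrite kE; have /andP[a b] := IH y; case/andP: (wK y) => w1 w2.
  apply/andP; split.
    apply: (le_trans _ a); rewrite -mulrA ler_piMr// mulrC ler_pdivrMr//.
    by rewrite mul1r.
  apply: (le_trans b); rewrite -mulrA ler_peMr//.
  by rewrite mulrC -ler_pdivrMr// div1r.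
have /(_ x)/andP[L U] := bw_steps tf mlp mlm lpB lmB K1 rk0 rkK (rVK k)
  k0 dm0 kT eK' (divr_ge0 D10 K0') (mulr_ge0 D20 K0') Hb.
rewrite kE in L U.
have K2 j : K ^+ (2 * j.+1) = K * (K * K ^+ (2 * j)) by rewrite mulnS !exprS.
case/andP: (wK x) => w1 w2.
have w0 : 0 < wgt (r k) x by apply: (lt_le_trans _ w1); rewrite invr_gt0.
set J1 := \int[mu]_(u in _) _ in L *; set J2 := \int[mu]_(u in _) _ in U *.
apply/andP; split.
  apply: le_trans L.
  have -> : J1 + S1 - n.+1%:R * err = (S1 - n%:R * err) + (J1 - err).
    by rewrite -natr1; ring.
  rewrite expRD K2.
  have -> : (K * (K * K ^+ (2 * n)))^-1 * (expR (S1 - n%:R * err) * expR (J1 - err)) =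
    D1 / K * K^-1 * expR (J1 - err).
    by rewrite /D1; field; rewrite gt_eqF// expf_neq0// gt_eqF.
  apply: ler_pM; rewrite ?expR_ge0//.
  - by rewrite mulr_ge0 ?invr_ge0// divr_ge0.
  - by rewrite ler_wpM2l// divr_ge0.
  - by rewrite ler_expR lerD2l lerN2.
apply: (le_trans U).
have -> : J2 + S2 + n.+1%:R * err = (S2 + n%:R * err) + (J2 + err).
  by rewrite -natr1; ring.
rewrite (expRD (S2 + _)) K2.
have -> : (K * (K * K ^+ (2 * n))) * (expR (S2 + n%:R * err) * expR (J2 + err)) =
    D2 * K * K * expR (J2 + err) by rewrite /D2; ring.
apply: ler_pM; rewrite ?expR_ge0//.
- by rewrite mulr_ge0 ?(ltW w0)// mulr_ge0.
- by rewrite ler_wpM2l// mulr_ge0.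
- by rewrite ler_expR lerD2l.
Qed.

End pieces_bound.

Section independent_product.
Context {R : realType} d (Omega : measurableType d) (P : probability Omega R).

(** Independence is given on events only. For simple functions the product over i expands into a sum
    over all choices of one event per i, where it applies term by term. *)
Lemma independent_simple (I V : finType) (G : I -> set_system Omega)
    (E : I -> V -> set Omega) (F : I -> V -> R) :
  mutually_independent P G -> (forall i v, G i (E i v)) ->
  (forall i v, measurable (E i v)) ->
  \int[P]_w (\prod_i \sum_v F i v * \1_(E i v) w) =
  \prod_i \int[P]_w (\sum_v F i v * \1_(E i v) w).
Proof.
move=> ind GE mE.
have bi (A : set Omega) c : measurable A -> P.-integrable setT (EFin \o (fun w => c * \1_A w)).
  move=> mA; apply: (@bounded_integrable _ _ _ _ _ _ `|c|) => //.
  - by rewrite ltey_eq fin_num_measure.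
  - by apply: measurable_funM => //; exact: measurable_indic.
  - by move=> w _; rewrite normrM indicE; case: (_ \in _); rewrite ?normr1 ?normr0 ?mulr1 ?mulr0.
have i1 (A : set Omega) c : measurable A -> \int[P]_w (c * \1_A w) = c * fine (P A).
  move=> mA; rewrite RintegralZl//; last by have := bi A 1 mA; under eq_fun do rewrite mul1r.
  by rewrite Rintegral_indic// setIT.
have -> : (fun w => \prod_i \sum_v F i v * \1_(E i v) w) =
  (fun w => \sum_(f : {ffun I -> V}) (\prod_i F i (f i)) *
     \1_(\bigcap_(i in [set` [set: I]%SET]) E i (f i)) w).
  apply/funext => w; rewrite bigA_distr_bigA; apply: eq_bigr => f _.
  rewrite big_split/=; congr (_ * _).
  rewrite indicE; have [wE|wE] := boolP (w \in _).
    apply: big1 => i _; rewrite indicE mem_set//.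
    by move/set_mem : wE; apply; rewrite /= inE.
  have [i iE] : exists i, ~ E i (f i) w.
    apply: contrapT => /forallNP H; move: wE; rewrite notin_setE; apply => i _.
    exact: contrapT (H i).
  by apply/eqP; rewrite prodf_seq_eq0; apply/hasP; exists i; rewrite ?mem_index_enum//= indicE memNset.
have mcap (f : {ffun I -> V}) : measurable (\bigcap_(i in [set` [set: I]%SET]) E i (f i)).
  by apply: fin_bigcap_measurable => //; exact: finite_finset.
rewrite Rintegral_sum//; last by move=> f; exact: bi.
have -> : \prod_i \int[P]_w (\sum_v F i v * \1_(E i v) w) = \prod_i \sum_v F i v * fine (P (E i v)).
  apply: eq_bigr => i _; rewrite Rintegral_sum//; last by move=> v; exact: bi.
  by apply: eq_bigr => v _; exact: i1.
rewrite bigA_distr_bigA; apply: eq_bigr => f _; rewrite i1//.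
rewrite (ind [set: I]%SET)//= big_split/=; congr (_ * _).
by apply: eq_bigl => i; rewrite inE.
Qed.

End independent_product.

(** * Step functions and grids *)

Lemma bounded_dominated d (T : measurableType d) (R : realType)
    (mu : {measure set T -> \bar R}) (D : set T) (M : R)
    (f_ : nat -> T -> R) (f : T -> R) :
  measurable D -> (mu D < +oo)%E -> (forall n, measurable_fun D (f_ n)) ->
  (forall n x, D x -> `|f_ n x| <= M) ->
  (forall x, D x -> f_ n x @[n --> \oo] --> f x) ->
  measurable_fun D f /\
  \int[mu]_(x in D) f_ n x @[n --> \oo] --> \int[mu]_(x in D) f x.
Proof.
move=> mD Doo mf_ fM fcvg.
have mf : measurable_fun D f := measurable_fun_cvg mf_ fcvg.
split=> //.
have iM : mu.-integrable D (EFin \o cst M).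
  by apply: (@bounded_integrable _ _ _ _ _ _ `|M|).
have [|||| fi _ H] := @dominated_convergence _ _ _ mu D mD (fun n => EFin \o f_ n) (EFin \o f) (EFin \o cst M) _ _ _ iM.
- by move=> n; apply/measurable_EFinP.
- exact/measurable_EFinP.
- apply: aeW => x Dx; apply: cvg_EFin; last exact: fcvg.
  by near=> n.
- by apply: aeW => x n Dx; rewrite /= lee_fin fM.
apply: fine_cvg.
by rewrite fineK//; exact: integrable_fin_num.
Unshelve. all: end_near. Qed.

Lemma Rintegral_prodr (R : realType) (A : set (R2 R)) (B : set (mR R)) (f : R -> R) (M : R) :
  measurable A -> measurable B -> (leb2 A < +oo)%E -> (@lebesgue_measure R B < +oo)%E ->
  measurable_fun B f -> (forall t, B t -> `|f t| <= M) ->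
  \int[leb3]_(z in A `*` B) f z.2 = fine (leb2 A) * \int[@lebesgue_measure R]_(t in B) f t.
Proof.
move=> mA mB Aoo Boo mf fM.
have mAB : measurable (A `*` B) by exact: measurableX.
have ABoo : (leb3 (A `*` B) < +oo)%E.
  by rewrite /leb3/= product_measure1E// lte_mul_pinfty// ge0_fin_numE.
have mf2 : measurable_fun (A `*` B) (fun z : R3 R => f z.2).
  apply: (@measurable_comp _ _ _ _ _ _ B) => //.
    by move=> _ [z [_ Bz] <-].
  exact: measurable_funTS measurable_snd.
have fi : leb3.-integrable (A `*` B) (EFin \o (fun z : R3 R => f z.2)).
  by apply: (@bounded_integrable _ _ _ _ _ _ M) => // z [_ /fM].
have fB : (@lebesgue_measure R).-integrable B (EFin \o f).
  exact: (@bounded_integrable _ _ _ _ _ _ M).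
set c := \int[_]_(t in B) f t.
have cE : (\int[@lebesgue_measure R]_(y in B) (f y)%:E = c%:E)%E.
  by rewrite /c /Rintegral fineK//; exact: integrable_fin_num.
rewrite mulrC -Rintegral_cst//; congr fine.
rewrite integral_mkcond -integral12_prod_meas1; last by apply/integrable_restrict; rewrite ?setTI.
rewrite [RHS]integral_mkcond; apply: eq_integral => x _; rewrite /fubini_F.
rewrite patchE; have [xA|xA] := boolP (x \in A).
  rewrite -cE [RHS]integral_mkcond; apply: eq_integral => y _.
  by rewrite !patchE in_setX xA.
by apply: integral0_eq => y _; rewrite patchE in_setX (negbTE xA).
Qed.

Lemma near_lt_natS (R : realType) (x : R) : \forall m \near \oo, x < m.+1%:R.
Proof.
near=> m; apply: (@lt_trans _ _ m%:R); last by rewrite ltr_nat.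
by near: m; exact: nbhs_infty_gtr.
Unshelve. all: end_near. Qed.

Section riemann.
Context {R : realType}.
Local Notation mu := (@lebesgue_measure R).

Section step_functions.
Variables (g : R -> bool) (s dlt : R).
Hypothesis d0 : 0 < dlt.

Let J m i := `[s + i%:R * (dlt / m.+1%:R), (s + i.+1%:R * (dlt / m.+1%:R))[%classic : set R.

(* On each cell of the mesh, the value of [g] at the right end point. *)
Definition rstep m u : R :=
  \sum_(i < m.+1) (g (s + i.+1%:R * (dlt / m.+1%:R)))%:R * \1_(J m i) u.

Let dm0 m : 0 < dlt / m.+1%:R. Proof. by rewrite divr_gt0. Qed.

Let mJ m i : measurable (J m i). Proof. exact: measurable_itv. Qed.

(** The sample lies strictly to the right of u, at most one mesh size away, so convergence at u is a
    matter of right-continuity only. *)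
Lemma rstep_ex m u : s <= u < s + dlt -> exists2 t, u < t <= u + dlt / m.+1%:R &
  rstep m u = (g t)%:R.
Proof.
move=> /andP[su ud].
have x0 : 0 <= (u - s) / (dlt / m.+1%:R) by rewrite divr_ge0 ?subr_ge0// ltW.
have /andP[i1 i2] := truncn_itv x0.
set i := Num.trunc _ in i1 i2.
have im : (i < m.+1)%N.
  rewrite -(ltr_nat R); apply: (le_lt_trans i1).
  by rewrite ltr_pdivrMr// mulrCA mulfV ?pnatr_eq0// mulr1 ltrBlDl.
have /andP[a1 a2] : s + i%:R * (dlt / m.+1%:R) <= u < s + i.+1%:R * (dlt / m.+1%:R).
  apply/andP; split; first by rewrite -lerBrDl -ler_pdivlMr.
  by rewrite -ltrBlDl -ltr_pdivrMr.
exists (s + i.+1%:R * (dlt / m.+1%:R)).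
  by rewrite a2/= -natr1 mulrDl mul1r addrA lerD2r.
rewrite /rstep (bigD1 (Ordinal im))//= indicE mem_set ?mulr1; last by rewrite /J /= in_itv/= a1.
rewrite big1 ?addr0// => j /eqP ji; rewrite indicE memNset ?mulr0// /J /= in_itv/= => /andP[b1 b2].
apply: ji; apply/val_inj => /=.
have lt1 : i%:R < j.+1%:R :> R by rewrite -(ltr_pM2r (dm0 m)) -(ltrD2l s) (le_lt_trans a1).
have lt2 : j%:R < i.+1%:R :> R by rewrite -(ltr_pM2r (dm0 m)) -(ltrD2l s) (le_lt_trans b1).
by move: lt1 lt2; rewrite !ltr_nat !ltnS => ij ji; apply/eqP; rewrite eqn_leq ji.
Qed.

Lemma measurable_rstep m : measurable_fun setT (rstep m).
Proof.
by apply: measurable_sum => i; exact: measurable_funM.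
Qed.

Lemma rstep_cvg u : s <= u < s + dlt -> (\forall t \near u^'+, g t = g u) ->
  rstep m u @[m --> \oo] --> ((g u)%:R : R).
Proof.
move=> us /nbhs_right0P; rewrite near_withinE /= => /nbhs_ballP[e /= e0 He].
apply: cvg_near_cst; near=> m.
have [t /andP[t1 t2] ->] := rstep_ex m us.
suff -> : g t = g u by [].
have -> : t = u + (t - u) by rewrite addrC subrK.
apply: (He (t - u)); last by rewrite subr_gt0.
rewrite /ball/= sub0r normrN gtr0_norm ?subr_gt0//.
apply: le_lt_trans (_ : dlt / m.+1%:R < e); first by rewrite lerBlDl.
rewrite ltr_pdivrMr// -ltr_pdivrMl//.
by near: m; exact: near_lt_natS.
Unshelve. all: end_near. Qed.

(** Dominated convergence of the sampled step functions; it yields the measurability of the path in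
    time as well. For a boolean path, right-continuity means being constant just to the right of
    each time. *)
Lemma riemann_right :
  (forall t, s <= t < s + dlt -> \forall u \near t^'+, g u = g t) ->
  measurable_fun `[s, (s + dlt)[ (fun u => (g u)%:R : R) /\
  (\sum_(i < m.+1) (dlt / m.+1%:R) * (g (s + i.+1%:R * (dlt / m.+1%:R)))%:R : R)
     @[m --> \oo] --> \int[mu]_(u in `[s, (s + dlt)[) (g u)%:R.
Proof.
move=> gr.
have D_oo : (mu `[s, (s + dlt)%R[%classic < +oo)%E.
  by rewrite /= lebesgue_measure_itv/=; case: ifP => // _; rewrite -EFinB ltry.
have [||||mg cv] := @bounded_dominated _ _ _ mu `[s, (s + dlt)[%classic 1 rstep (fun u => (g u)%:R) _ D_oo.
- exact: measurable_itv.
- by move=> m; apply: measurable_funTS; exact: measurable_rstep.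
- move=> m u; rewrite /= in_itv/= => us; have [t _ ->] := rstep_ex m us.
  by case: (g _); rewrite ?normr1 ?normr0.
- by move=> u; rewrite /= in_itv/= => us; apply: rstep_cvg => //; exact: gr.
split=> //; apply: cvg_trans cv; apply: near_eq_cvg; near=> m.
rewrite Rintegral_sum//; last first.
  move=> i; apply: (@bounded_integrable _ _ _ _ _ _ 1) => //.
    by apply: measurable_funM => //; apply: measurable_indic; exact: mJ.
  move=> u _; rewrite indicE; case: (g _); case: (_ \in _);
  by rewrite ?mulr1 ?mulr0 ?mul0r ?normr0 ?normr1.
apply: eq_bigr => i _; rewrite RintegralZl//; last first.
  apply: (@bounded_integrable _ _ _ _ _ _ 1) => //.
    by apply: measurable_indic; exact: mJ.
  by move=> u _; rewrite indicE; case: (_ \in _); rewrite ?normr0 ?normr1.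
rewrite mulrC Rintegral_indic; [|exact: measurable_itv|exact: mJ].
congr (_ * _).
rewrite setIidl; last first.
  apply: subset_itv; rewrite bnd_simp.
    by rewrite lerDl mulr_ge0// ltW.
  rewrite lerD2l -[leRHS](@divfK _ m.+1%:R)// mulrC ler_wpM2l ?ler_nat// ltW//.
rewrite /J /= lebesgue_measure_itv/= lte_fin ltrD2l ltr_pM2r// ltr_nat ltnSn/= -natr1; ring.
Unshelve. all: end_near. Qed.

End step_functions.

End riemann.

Section grid_cells.
Context {R : realType}.
Implicit Types (dlt x : R) (k N : nat).
Local Notation mu := (@lebesgue_measure R).

(** A common form for spatial and time cells; for dlt = 1/n it is convertible to [cell]. *)
Definition gcell dlt (k : nat) : set (mR R) :=
  if k == 0%N then `[0, dlt]%classic else `]k%:R * dlt, k.+1%:R * dlt]%classic.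

Lemma cell_gcell n (i : 'I_n) : cell i = gcell n%:R^-1 i :> set R.
Proof. by []. Qed.

Lemma measurable_gcell dlt k : measurable (gcell dlt k).
Proof. by rewrite /gcell; case: ifP. Qed.

Lemma gcell_bounds dlt k x : 0 <= dlt -> gcell dlt k x -> k%:R * dlt <= x <= k.+1%:R * dlt.
Proof.
move=> d0; rewrite /gcell; case: ifP => [/eqP->|_]; rewrite /= in_itv/=.
  by rewrite mul0r mul1r.
by move=> /andP[/ltW -> ->].
Qed.

Lemma gcell_inj dlt k l x : 0 < dlt -> gcell dlt k x -> gcell dlt l x -> k = l.
Proof.
move=> d0 kx lx.
have H a b : gcell dlt a x -> gcell dlt b x -> (b <= a)%N.
  move=> ax /[dup] /(gcell_bounds (ltW d0))/andP[b1 b2]; rewrite /gcell.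
  case: b b1 b2 => // b b1 b2 /=; rewrite in_itv/= => /andP[bx _].
  have /andP[a1 a2] := gcell_bounds (ltW d0) ax.
  have : b.+1%:R * dlt < a.+1%:R * dlt by apply: lt_le_trans bx a2.
  by rewrite ltr_pM2r// ltr_nat ltnS.
by apply/eqP; rewrite eqn_leq !H.
Qed.

Lemma gcell_cover dlt N x : 0 < dlt -> (0 < N)%N -> 0 <= x <= N%:R * dlt ->
  exists2 k, (k < N)%N & gcell dlt k x.
Proof.
move=> d0 N0 /andP[x0 xN].
have exk : exists k, x <= k.+1%:R * dlt by exists N.-1; rewrite prednK.
case: (ex_minnP exk) => k xk kmin.
have kN : (k < N)%N by rewrite -(prednK N0) ltnS kmin// prednK.
exists k => //; rewrite /gcell; case: ifP => [/eqP k0|/negbT k0]; rewrite /= in_itv/=.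
  by rewrite x0/=; move: xk; rewrite k0 mul1r.
rewrite xk andbT ltNge; apply/negP => xk'; case: k k0 xk kmin kN xk' => // k _ _ kmin _ /kmin.
by rewrite ltnn.
Qed.

Lemma gcell_sub dlt N k : 0 <= dlt -> (k < N)%N -> gcell dlt k `<=` `[0, N%:R * dlt]%classic.
Proof.
move=> d0 kN x /(gcell_bounds d0) /andP[x1 x2]; rewrite /= in_itv/=; apply/andP; split.
  by apply: le_trans x1; rewrite mulr_ge0.
by apply: (le_trans x2); rewrite ler_wpM2r// ler_nat.
Qed.

Lemma lebesgue_gcell dlt k : 0 < dlt -> mu (gcell dlt k) = dlt%:E.
Proof.
move=> d0; rewrite /gcell; case: ifP => _; rewrite lebesgue_measure_itv/= lte_fin.
  by rewrite d0 -EFinD subr0.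
by rewrite ltr_pM2r// ltr_nat ltnSn -EFinD -natr1 mulrDl mul1r addrAC subrr add0r.
Qed.

Lemma lebesgue_gcell_oo dlt k : 0 < dlt -> (mu (gcell dlt k) < +oo)%E.
Proof. by move=> d0; rewrite lebesgue_gcell// ltry. Qed.

End grid_cells.

Lemma Rintegral_partition d (T : measurableType d) (R : realType)
    (mu : {measure set T -> \bar R}) (I : finType) (D : set T) (Di : I -> set T) (f : T -> R) :
  measurable D -> (forall i, measurable (Di i)) -> (forall i, Di i `<=` D) ->
  (forall x, D x -> exists i, Di i x) ->
  (forall i j x, Di i x -> Di j x -> i = j) ->
  mu.-integrable D (EFin \o f) ->
  \int[mu]_(x in D) f x = \sum_i \int[mu]_(x in Di i) f x.
Proof.
move=> mD mDi DiD cov uniq fi.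
transitivity (\int[mu]_(x in D) \sum_i (f \_ (Di i)) x).
  apply: eq_Rintegral => x /set_mem Dx; have [i ix] := cov x Dx.
  rewrite (bigD1 i)//= patchE mem_set// big1 ?addr0// => j /eqP ji.
  by rewrite patchE memNset// => jx; apply: ji; exact: uniq jx ix.
rewrite Rintegral_sum//; last first.
  move=> i; rewrite -restrict_EFin; apply/integrable_restrict => //.
  by apply: integrableS fi => //; exact: measurableI.
by apply: eq_bigr => i _; rewrite -Rintegral_mkcondr setIidr.
Qed.

Section laplace_independent.
Context {R : realType} d (Omega : measurableType d) (P : probability Omega R).

Lemma laplace_independent (T : R) (I : finType) (Y : I -> R -> Omega -> bool)
    (L : I -> seq (R * R)) : 0 <= T ->
  (forall i t, 0 <= t <= T -> measurable_fun setT (Y i t)) ->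
  mutually_independent P (fun i => past (Y i) T) ->
  (forall i, all (fun tc => 0 <= tc.1 <= T) (L i)) ->
  \int[P]_w (\prod_i exp_path (Y i) (L i) w) = \prod_i \int[P]_w exp_path (Y i) (L i) w.
Proof.
move=> T0 mY ind LT.
pose M := \max_i size (L i).
(* The lists are padded to a common length. The default pair (0, 0) is a legitimate sample time with
   weight 0, so it does not affect the exponential. *)
pose tc i k := nth (0, 0) (L i) k.
have tcT i k : 0 <= (tc i k).1 <= T.
  have [kL|kL] := ltnP k (size (L i)); first by apply: (allP (LT i)); rewrite mem_nth.
  by rewrite /tc nth_default//= lexx.
pose E i (v : {ffun 'I_M -> bool}) := \bigcap_(k in [set: 'I_M]) (Y i (tc i k).1 @^-1` [set v k]).
pose F i (v : {ffun 'I_M -> bool}) := expR (\sum_(k < M) (tc i k).2 * (v k)%:R).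
have FE i w : exp_path (Y i) (L i) w = \sum_v F i v * \1_(E i v) w.
  pose v0 := [ffun k : 'I_M => Y i (tc i k).1 w].
  rewrite (bigD1 v0)//= indicE mem_set; last by move=> k _ /=; rewrite ffunE.
  rewrite mulr1 big1 ?addr0; last first.
    move=> v /eqP vv0; rewrite indicE memNset ?mulr0// => Ev; apply: vv0.
    by apply/ffunP => k; rewrite ffunE -(Ev k).
  rewrite /exp_path /F; congr expR.
  rewrite (big_nth (0, 0)) (eq_bigr (fun k : 'I_M => (tc i k).2 * (Y i (tc i k).1 w)%:R)).
    2: by move=> k _; rewrite ffunE.
  rewrite -(big_mkord xpredT (fun k => (tc i k).2 * (Y i (tc i k).1 w)%:R)).
  rewrite [RHS](@big_cat_nat _ _ _ (size (L i)))//=; last by rewrite /M (leq_bigmax i).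
  rewrite [X in _ = _ + X]big_nat_cond [X in _ = _ + X]big1 ?addr0// => k.
  by rewrite andbT => /andP[kL _]; rewrite /tc nth_default//= mul0r.
under eq_Rintegral do under eq_bigr do rewrite FE.
have pE i v : past (Y i) T (E i v).
  by apply: past_bigI => k; exact: past_state.
rewrite (independent_simple F ind)//; last by move=> i v; exact: (past_measurable (mY i) (lexx T)).
by apply: eq_bigr => i _; apply: eq_Rintegral => w _; rewrite FE.
Qed.

End laplace_independent.

(** * Integrals of step kernels over the cube *)

Section cube_integrals.
Context {R : realType}.
Variable (T : R).
Hypothesis T0 : 0 < T.
Local Notation mu := (@lebesgue_measure R).
Local Notation C := (cube T).

Lemma leb2X (A B : set (mR R)) : measurable A -> measurable B ->
  leb2 (A `*` B) = (mu A * mu B)%E.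
Proof. by move=> mA mB; rewrite /leb2 product_measure1E. Qed.

Lemma leb3_cube : leb3 C = T%:E.
Proof.
have h x : 0 < x -> mu `[0, x] = x%:E.
  by move=> x0; rewrite lebesgue_measure_itv/= lte_fin x0 -EFinB subr0.
have mm (x : R) : measurable (`[0, x]%classic : set (mR R)) by exact: measurable_itv.
rewrite /leb3/= /cube product_measure1E//; last exact: measurableX.
transitivity (leb2 square * mu `[0%R, T]%classic)%E; first by [].
by rewrite /square leb2X// !h// !mul1e.
Qed.

Lemma leb3_cube_oo : (leb3 C < +oo)%E. Proof. by rewrite leb3_cube ltry. Qed.

Lemma Rintegral_cube_cst (c : R) : \int[leb3]_(z in C) c = c * T.
Proof. by rewrite Rintegral_cst ?leb3_cube//; exact: measurable_cube. Qed.

Section step.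
Variables (n : nat).
Hypothesis n0 : (0 < n)%N.

Let dn0 : 0 < n%:R^-1 :> R. Proof. by rewrite invr_gt0 ltr0n. Qed.

Lemma step_kernelE (b : 'I_n -> 'I_n -> R -> R) i j z : (cell i `*` cell j) z.1 ->
  step_kernel b z = b i j z.2.
Proof.
move=> [/= zi zj]; rewrite /step_kernel (bigD1 i)//= (bigD1 j)//= indicE mem_set// mulr1.
rewrite big1 ?addr0 => [|l /eqP lj]; last first.
  rewrite indicE memNset ?mulr0// => -[_ /= zl]; apply: lj; apply: val_inj.
  exact: (gcell_inj dn0 zl zj).
rewrite big1 ?addr0// => k /eqP ki; apply: big1 => l _.
rewrite indicE memNset ?mulr0// => -[/= zk _]; apply: ki; apply: val_inj.
exact: (gcell_inj dn0 zk zi).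
Qed.

Lemma cell_cover (x : R) : 0 <= x <= 1 -> exists i : 'I_n, cell i x.
Proof.
move=> x01; have [|k kn kx] := @gcell_cover _ n%:R^-1 n x dn0 n0.
  by rewrite mulfV ?pnatr_eq0 -?lt0n.
by exists (Ordinal kn).
Qed.

Lemma cell_sub (i : 'I_n) : cell i `<=` (`[0, 1]%classic : set R).
Proof.
rewrite cell_gcell; have := gcell_sub (ltW dn0) (ltn_ord i).
by rewrite mulfV// pnatr_eq0 -lt0n.
Qed.

Lemma cube_cell z : C z -> exists i j : 'I_n, (cell i `*` cell j) z.1.
Proof.
move=> [[/=]]; rewrite /= !in_itv/= => x01 y01 _.
by have [i xi] := cell_cover x01; have [j yj] := cell_cover y01; exists i, j.
Qed.

Lemma leb2_cell (i j : 'I_n) : leb2 (cell i `*` cell j : set (R2 R)) = (n%:R ^- 2)%:E.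
Proof.
rewrite leb2X; [|exact: measurable_gcell|exact: measurable_gcell].
rewrite !cell_gcell.
have h k := lebesgue_gcell k dn0.
by rewrite !h -EFinM expr2 invfM.
Qed.

Lemma measurable_cell2 (i j : 'I_n) : measurable (cell i `*` cell j : set (R2 R)).
Proof. by apply: measurableX; exact: measurable_gcell. Qed.

Lemma measurable_step_kernel (b : 'I_n -> 'I_n -> R -> R) :
  (forall i j, measurable_fun `[0, T] (b i j)) ->
  measurable_fun C (step_kernel b).
Proof.
move=> mb; apply: measurable_sum => i; apply: measurable_sum => j.
apply: measurable_funM.
  apply: (@measurable_comp _ _ _ _ _ _ `[0, T]%classic) => //.
    by move=> _ [z [_ /= zT] <-].
  exact: measurable_funTS measurable_snd.
apply: (@measurableT_comp _ _ _ _ _ _ (\1_(cell i `*` cell j) : R2 R -> R)).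
  by apply: measurable_indic; exact: measurable_cell2.
exact: measurable_funTS measurable_fst.
Qed.

Lemma step_kernel_bound (b : 'I_n -> 'I_n -> R -> R) M :
  (forall i j t, 0 <= t <= T -> `|b i j t| <= M) -> forall z, C z -> `|step_kernel b z| <= M.
Proof.
move=> bM z Cz; have [i [j zij]] := cube_cell Cz; rewrite (step_kernelE _ zij).
by case: Cz => _; rewrite /= in_itv/=; exact: bM.
Qed.

Lemma Rintegral_step_kernel (b : 'I_n -> 'I_n -> R -> R) M :
  (forall i j, measurable_fun `[0, T] (b i j)) ->
  (forall i j t, 0 <= t <= T -> `|b i j t| <= M) ->
  n%:R ^+ 2 * \int[leb3]_(z in C) step_kernel b z =
  \sum_(ij : 'I_n * 'I_n) \int[mu]_(t in `[0, T]) b ij.1 ij.2 t.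
Proof.
move=> mb bM.
have mC := measurable_cube T.
pose D (ij : 'I_n * 'I_n) := (cell ij.1 `*` cell ij.2) `*` `[0, T]%classic : set (R3 R).
rewrite (@Rintegral_partition _ _ _ _ _ C D) => //.
- rewrite big_distrr/=; apply: eq_bigr => -[i j] _ /=.
  transitivity (n%:R ^+ 2 * \int[leb3]_(z in D (i, j)) b i j z.2).
    congr (_ * _); apply: eq_Rintegral => z /set_mem[/= zij _].
    exact: step_kernelE.
  rewrite /D (@Rintegral_prodr _ _ _ _ M)//=.
  + rewrite mulrA.
    have -> : fine (leb2 (cell i `*` cell j : set (R2 R))) = n%:R ^- 2 by exact: (congr1 fine (leb2_cell i j)).
    by rewrite mulfV ?mul1r// expf_neq0// pnatr_eq0 -lt0n.
  + exact: measurable_cell2.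
  + have -> : leb2 (cell i `*` cell j : set (R2 R)) = (n%:R ^- 2)%:E by exact: leb2_cell.
    by rewrite ltry.
  + by rewrite /= lebesgue_measure_itv/=; case: ifP => // _; rewrite -EFinB ltry.
  + exact: mb.
  + by move=> t; rewrite /= in_itv/=; exact: bM.
- by move=> ij; apply: measurableX => //; exact: measurable_cell2.
- by move=> ij z [[/= zi zj] zT]; split => //; split; [exact: (cell_sub zi)|exact: (cell_sub zj)].
- by move=> z Cz; have [i [j zij]] := cube_cell Cz; exists (i, j); split => //; case: Cz.
- move=> [i j] [k l] z [[/= zi zj] _] [[/= zk zl] _]; congr pair; apply: val_inj.
    exact: (gcell_inj dn0 zi zk).
  exact: (gcell_inj dn0 zj zl).
- apply: (@bounded_integrable _ _ _ _ _ _ M) => //; first exact: leb3_cube_oo.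
    exact: measurable_step_kernel.
  exact: step_kernel_bound.
Qed.

End step.

Section time_steps.
Variable N : nat.
Hypothesis N0 : (0 < N)%N.
Let dlt := T / N%:R.
Let d0 : 0 < dlt. Proof. by rewrite divr_gt0// ltr0n. Qed.
Let NdT : N%:R * dlt = T.
Proof. by rewrite /dlt mulrCA mulfV ?mulr1// pnatr_eq0 -lt0n. Qed.

Definition tstep (G : nat -> R) (t : R) : R := \sum_(k < N) G k * \1_(gcell dlt k) t.

Lemma tstepE G k t : (k < N)%N -> gcell dlt k t -> tstep G t = G k.
Proof.
move=> kN kt; rewrite /tstep (bigD1 (Ordinal kN))//= indicE mem_set// mulr1.
rewrite big1 ?addr0// => l /eqP lk; rewrite indicE memNset ?mulr0// => lt.
by apply: lk; apply: val_inj; exact: gcell_inj lt kt.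
Qed.

Lemma time_cover t : 0 <= t <= T -> exists2 k, (k < N)%N & gcell dlt k t.
Proof. by move=> tT; apply: gcell_cover => //; rewrite NdT. Qed.

Lemma measurable_tstep G : measurable_fun setT (tstep G).
Proof.
apply: measurable_sum => k; apply: measurable_funM => //.
by apply: measurable_indic; exact: measurable_gcell.
Qed.

Lemma Rintegral_time_steps (f : R -> R) M : measurable_fun `[0, T] f ->
  (forall t, 0 <= t <= T -> `|f t| <= M) ->
  \int[mu]_(t in `[0, T]) f t = \sum_(k < N) \int[mu]_(t in gcell dlt k) f t.
Proof.
move=> mf fM; rewrite (@Rintegral_partition _ _ _ _ _ _ (fun k : 'I_N => gcell dlt k))//.
- by move=> k; exact: measurable_gcell.
- by move=> k; have := gcell_sub (ltW d0) (ltn_ord k); rewrite NdT.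
- move=> t; rewrite /= in_itv/= => tT; have [k kN kt] := time_cover tT.
  by exists (Ordinal kN).
- by move=> k l t kt lt; apply: val_inj; exact: gcell_inj kt lt.
- apply: (@bounded_integrable _ _ _ _ _ _ M) => //.
    by rewrite /= lebesgue_measure_itv/=; case: ifP => // _; rewrite -EFinB ltry.
Qed.

(** Three conventions meet: the cells of the partition, the closed intervals of the one-chain bounds
    and the right-open intervals of the Riemann sums. They differ by end points only. *)
Lemma Rintegral_gcell (f : R -> R) M k : (k < N)%N -> measurable_fun `[0, T] f ->
  (forall t, 0 <= t <= T -> `|f t| <= M) ->
  \int[mu]_(t in gcell dlt k) f t = \int[mu]_(t in `[k%:R * dlt, k.+1%:R * dlt]) f t /\
  \int[mu]_(t in gcell dlt k) f t = \int[mu]_(t in `[k%:R * dlt, k.+1%:R * dlt[) f t.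
Proof.
move=> kN mf fM.
have sub : `[k%:R * dlt, k.+1%:R * dlt]%classic `<=` (`[0, T]%classic : set R).
  apply: subset_itv; rewrite bnd_simp; first by rewrite mulr_ge0// ltW.
  by rewrite -NdT ler_wpM2r ?(ltW d0)// ler_nat.
have fi : mu.-integrable `[k%:R * dlt, k.+1%:R * dlt] (EFin \o f).
  apply: (@bounded_integrable _ _ _ _ _ _ M) => //.
  - by rewrite /= lebesgue_measure_itv/=; case: ifP => // _; rewrite -EFinB ltry.
  - exact: measurable_funS mf.
  - by move=> t /sub; rewrite /= in_itv/=; exact: fM.
have E1 : \int[mu]_(t in gcell dlt k) f t = \int[mu]_(t in `[k%:R * dlt, k.+1%:R * dlt]) f t.
  rewrite /gcell; case: ifP => [/eqP->|_]; first by rewrite mul0r mul1r.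
  apply: Rintegral_itv_obnd_cbnd.
  by apply: integrableS fi => //; apply: subset_itv; rewrite bnd_simp.
split => //; rewrite E1 Rintegral_itv_bndo_bndc//.
by apply: integrableS fi => //; apply: subset_itv; rewrite bnd_simp.
Qed.

End time_steps.

End cube_integrals.

(** * Exponential moments of the graph process for fixed n *)

Section pressure_bounds.
Context {R : realType} d (Omega : measurableType d) (P : probability Omega R).
Variables (T : R) (n : nat) (X : 'I_n -> 'I_n -> R -> Omega -> bool)
  (x0 : 'I_n -> 'I_n -> bool) (lp lm : 'I_n -> 'I_n -> R -> R) (a B : R).
Hypotheses (T0 : 0 < T) (n0 : (0 < n)%N) (a0 : 0 < a) (B0 : 0 <= B).
Hypothesis hX : forall i j : 'I_n, markov_chain P T (X i j) (x0 i j)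
  (fun t => a * lp i j t) (fun t => a * lm i j t).
Hypothesis hind : mutually_independent P
  (fun ij : 'I_n * 'I_n => past (X ij.1 ij.2) T).
Hypotheses (mlp : forall i j, measurable_fun `[0, T] (lp i j))
  (mlm : forall i j, measurable_fun `[0, T] (lm i j)).
Hypotheses (lpB : forall i j t, 0 <= t <= T -> 0 <= lp i j t <= B)
  (lmB : forall i j t, 0 <= t <= T -> 0 <= lm i j t <= B).
Local Notation mu := (@lebesgue_measure R).
Local Notation C := (cube T).

Lemma near_right_state i j w t : 0 <= t < T -> \forall u \near t^'+, X i j u w = X i j t w.
Proof.
move=> tT; have [+ _] := chain_cadlag (hX i j) w.
move=> /(_ t tT) /(_ [set X i j t w]); apply.
by apply: open_nbhs_nbhs; split => //; exact: discrete_open.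
Qed.

Lemma measurable_trajectory i j w : measurable_fun `[0, T] (fun t => (X i j t w)%:R : R).
Proof.
have [|+ _] := @riemann_right _ (fun t => X i j t w) 0 T T0.
  by move=> t; rewrite add0r; exact: near_right_state.
by rewrite add0r; exact: measurable_fun_itv_cc.
Qed.

(** The spatial mesh is that of the chains, so each chain is tilted by a function of time alone; the
    number N of time cells is independent of n. *)
Definition gridf N (G : 'I_n -> 'I_n -> nat -> R) : R3 R -> R :=
  step_kernel (fun i j => tstep T N (G i j)).

Definition sample_kernel w : R3 R -> R := step_kernel (fun i j t => (X i j t w)%:R).

Variables (N : nat) (N0 : (0 < N)%N) (cc r : 'I_n -> 'I_n -> nat -> R) (K H : R).
Hypotheses (K1 : 1 <= K) (rK : forall i j k, 0 < r i j k <= K)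
  (rVK : forall i j k, (r i j k)^-1 <= K) (ccH : forall i j k, `|cc i j k| <= H).

(** [rate0] and [rate1] of all the chains, gathered into kernels on the cube and divided by the
    common factor a. *)
Definition grate0 z : R := step_kernel lp z * (gridf N r z - 1).
Definition grate1 z : R := step_kernel lm z * ((gridf N r z)^-1 - 1) + gridf N cc z.

Let dlt := T / N%:R.
Let d0 : 0 < dlt. Proof. by rewrite divr_gt0// ltr0n. Qed.
Let NdT : N%:R * dlt = T.
Proof. by rewrite /dlt mulrCA mulfV ?mulr1// pnatr_eq0 -lt0n. Qed.

Let H0 : 0 <= H.
Proof. exact: le_trans (normr_ge0 _) (ccH (Ordinal n0) (Ordinal n0) 0%N). Qed.

Let tstep_bound (G : nat -> R) M t : (forall k, `|G k| <= M) -> 0 <= t <= T -> `|tstep T N G t| <= M.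
Proof. by move=> GM tT; have [k kN kt] := time_cover T0 N0 tT; rewrite (tstepE T0 N0 _ kN kt). Qed.

(* Riemann sums of [a n^2 <gridf N cc, H^n>] on the mesh [T / (N (m + 1))]. *)
Let L m (ij : 'I_n * 'I_n) := psteps dlt m.+1 (fun k => a * cc ij.1 ij.2 k) 0 N.

Let LT m ij : all (fun tc => 0 <= tc.1 <= T) (L m ij).
Proof.
apply/allP => tc tcL.
have := allP (psteps_le m (fun k => a * cc ij.1 ij.2 k) 0 N (ltW d0)) _ tcL.
rewrite add0n NdT => ->; rewrite andbT.
have := psteps_sorted m (fun k => a * cc ij.1 ij.2 k) 0 N (ltW d0).
rewrite mul0r => /(order_path_min le_trans)/allP; apply; exact: map_f.
Qed.

Let S m w := \sum_ij \sum_(tc <- L m ij) tc.2 * (X ij.1 ij.2 tc.1 w)%:R.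

Let SE m w : S m w = \sum_ij \sum_(k < N) a * cc ij.1 ij.2 k *
  \sum_(i < m.+1) (dlt / m.+1%:R) * (X ij.1 ij.2 (k%:R * dlt + i.+1%:R * (dlt / m.+1%:R)) w)%:R.
Proof.
apply: eq_bigr => ij _; rewrite /L.
by rewrite (big_psteps _ _ _ _ _ (fun t => (X ij.1 ij.2 t w)%:R)) add0n big_mkord.
Qed.

Let S_bound m w : `|S m w| <= \sum_(ij : 'I_n * 'I_n) \sum_(k < N) a * H * dlt.
Proof.
rewrite SE; apply: (le_trans (ler_norm_sum _ _ _)); apply: ler_sum => ij _.
apply: (le_trans (ler_norm_sum _ _ _)); apply: ler_sum => k _.
rewrite !normrM (gtr0_norm a0); apply: ler_pM => //.
  by rewrite mulr_ge0// ltW.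
  by rewrite ler_wpM2l ?(ltW a0).
apply: (le_trans (ler_norm_sum _ _ _)).
apply: le_trans (_ : \sum_(i < m.+1) dlt / m.+1%:R <= _).
  apply: ler_sum => i _; rewrite normrM gtr0_norm ?(divr_gt0 d0)//.
  by case: (X _ _ _ _); rewrite ?normr1 ?normr0 ?mulr1 ?mulr0// divr_ge0// (ltW d0).
by rewrite sumr_const card_ord -[X in X <= _]mulr_natr divfK.
Qed.

Let hXT i j t : 0 <= t <= T -> measurable_fun setT (X i j t).
Proof. exact: (chain_measurable (hX i j)). Qed.

Let mS m : measurable_fun setT (S m).
Proof.
apply: measurable_sum => ij.
have := LT m ij; move: (L m ij) => l.
elim: l => [|tc l IH] => [_|/= /andP[tcT lT]].
  by rewrite (_ : (fun w => _) = cst 0)//; apply/funext => w; rewrite big_nil.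
rewrite (_ : (fun w => _) = (fun w => tc.2 * (X ij.1 ij.2 tc.1 w)%:R) \+
    (fun w => \sum_(tc <- l) tc.2 * (X ij.1 ij.2 tc.1 w)%:R)); last first.
  by apply/funext => w; rewrite big_cons.
apply: measurable_funD; last exact: IH.
by apply: measurable_funM => //; exact: (measurable_state (@hXT ij.1 ij.2)).
Qed.

Definition gpair w : R := a * n%:R ^+ 2 * \int[leb3]_(z in C) (gridf N cc z * sample_kernel w z).

Let gpairE w : gpair w = \sum_ij \sum_(k < N) a * cc ij.1 ij.2 k *
  \int[mu]_(t in `[k%:R * dlt, (k%:R * dlt + dlt)[) (X ij.1 ij.2 t w)%:R.
Proof.
have mX i j := measurable_trajectory i j w.
have mb i j : measurable_fun `[0, T] (fun t => tstep T N (cc i j) t * (X i j t w)%:R).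
  by apply: measurable_funM => //; apply: measurable_funTS; exact: measurable_tstep.
have bb i j t : 0 <= t <= T -> `|tstep T N (cc i j) t * (X i j t w)%:R| <= H.
  move=> tT; rewrite normrM -[leRHS]mulr1 ler_pM//; first exact: tstep_bound.
  by case: (X _ _ _ _); rewrite ?normr1 ?normr0.
rewrite /gpair -mulrA.
have -> : \int[leb3]_(z in C) (gridf N cc z * sample_kernel w z) =
    \int[leb3]_(z in C) step_kernel (fun i j t => tstep T N (cc i j) t * (X i j t w)%:R) z.
  apply: eq_Rintegral => z /set_mem Cz; have [i [j zij]] := cube_cell n0 Cz.
  by rewrite /gridf /sample_kernel !(step_kernelE n0 _ zij).
rewrite (Rintegral_step_kernel T0 n0 mb bb) big_distrr/=.
apply: eq_bigr => -[i j] _ /=.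
rewrite (Rintegral_time_steps T0 N0 (mb i j) (bb i j)) big_distrr/=.
apply: eq_bigr => k _; rewrite -mulrA; congr (_ * _).
have x1 t : 0 <= t <= T -> `|(X i j t w)%:R : R| <= 1.
  by case: (X _ _ _ _); rewrite ?normr1 ?normr0.
have -> : k%:R * dlt + dlt = k.+1%:R * dlt by rewrite -natr1 mulrDl mul1r.
rewrite -(Rintegral_gcell T0 N0 (ltn_ord k) (mX i j) x1).2 -RintegralZl//.
- apply: eq_Rintegral => t /set_mem kt.
  by rewrite (tstepE T0 N0 _ (ltn_ord k) kt).
- exact: measurable_gcell.
- apply: (@bounded_integrable _ _ _ _ _ _ 1) => //.
  + exact: measurable_gcell.
  + exact: lebesgue_gcell_oo.
  + by apply: measurable_funS (mX i j) => //; have := gcell_sub (ltW d0) (ltn_ord k); rewrite NdT.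
  + by move=> t; case: (X _ _ _ _); rewrite ?normr1 ?normr0.
Qed.

(** For every path the Riemann sums [S m] converge to [gpair], under a bound uniform in m and in the
    path; the moments follow by dominated convergence. *)
Lemma gpair_limit : measurable_fun setT gpair /\
  \int[P]_w expR (S m w) @[m --> \oo] --> \int[P]_w expR (gpair w).
Proof.
have cvS w : S m w @[m --> \oo] --> gpair w.
  under eq_fun do rewrite SE; rewrite gpairE.
  apply: cvg_big; first exact: add_continuous.
  move=> ij _; apply: cvg_big; first exact: add_continuous.
  move=> k _; apply: cvgM; first exact: cvg_cst.
  have [|_ +] := @riemann_right _ (fun t => X ij.1 ij.2 t w) (k%:R * dlt) dlt d0; last by [].
  move=> t /andP[t1 t2]; apply: near_right_state.
  rewrite (le_trans _ t1)/= ?(mulr_ge0 _ (ltW d0))//.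
  apply: (lt_le_trans t2); rewrite -[X in _ + X]mul1r -mulrDl natr1 -NdT.
  by rewrite ler_wpM2r ?(ltW d0)// ler_nat.
have mE m : measurable_fun setT (fun w => expR (S m w)).
  by apply: measurableT_comp; [exact: measurable_expR|exact: mS].
have cvE w : setT w -> expR (S m w) @[m --> \oo] --> expR (gpair w).
  by move=> _; apply: (@cvg_comp _ _ _ (fun m => S m w) expR _ _ _ (cvS w)); exact: continuous_expR.
split; first exact: measurable_fun_cvg (fun m => mS m) (fun w _ => cvS w).
apply: (@bounded_dominated _ _ _ P setT (expR (\sum_(ij : 'I_n * 'I_n) \sum_(k < N) a * H * dlt)) _ _ _ _ mE _ cvE).2 => //.
  by rewrite ltey_eq fin_num_measure.
move=> m w _; rewrite ger0_norm ?expR_ge0// ler_expR.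
exact: le_trans (ler_norm _) (S_bound m w).
Qed.

Let rmin i j := rate_min (fun t => a * lp i j t) (fun t => a * lm i j t).
Let rmax i j := rate_max (fun t => a * lp i j t) (fun t => a * lm i j t).

(** Stated for an abstract operation in order to serve both the minimum and the maximum of the two
    growth rates. *)
Let Iop (op : R -> R -> R) : (forall x y, a * op x y = op (a * x) (a * y)) ->
  (forall D (f g : R -> R), measurable_fun D f -> measurable_fun D g ->
     measurable_fun D (fun t => op (f t) (g t))) ->
  (forall x y M, `|x| <= M -> `|y| <= M -> `|op x y| <= M) ->
  \sum_(ij : 'I_n * 'I_n) \sum_(0 <= k < N) \int[mu]_(u in `[k%:R * dlt, k.+1%:R * dlt])
    op (rate0 (fun t => a * lp ij.1 ij.2 t) (r ij.1 ij.2 k) u)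
       (rate1 (fun t => a * lm ij.1 ij.2 t) (r ij.1 ij.2 k) (a * cc ij.1 ij.2 k) u) =
  a * n%:R ^+ 2 * \int[leb3]_(z in C) op (grate0 z) (grate1 z).
Proof.
move=> opa mop opM.
have K0 : 0 < K by move: K1; lra.
pose b i j t := op (lp i j t * (tstep T N (r i j) t - 1))
  (lm i j t * ((tstep T N (r i j) t)^-1 - 1) + tstep T N (cc i j) t).
have mts (G : nat -> R) : measurable_fun `[0, T] (tstep T N G).
  by apply: measurable_funTS; exact: measurable_tstep.
have rE t i j : 0 <= t <= T -> 0 < tstep T N (r i j) t <= K /\ (tstep T N (r i j) t)^-1 <= K.
  by move=> tT; have [k kN kt] := time_cover T0 N0 tT; rewrite (tstepE T0 N0 _ kN kt).
have mtsV i j : measurable_fun `[0, T] (fun t => (tstep T N (r i j) t)^-1).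
  apply: eq_measurable_fun (mts (fun k => (r i j k)^-1)) => t.
  rewrite inE/= in_itv/= => tT; have [k kN kt] := time_cover T0 N0 tT.
  by rewrite !(tstepE T0 N0 _ kN kt).
have bnd (x y : R) : 0 < x <= K -> x^-1 <= K -> 0 <= y <= B -> `|y * (x - 1)| <= B * K + H.
  move=> /andP[x1 xK] xV /andP[y1 yB]; apply: le_trans (_ : B * K <= _); last by rewrite lerDl.
  by rewrite normrM; apply: ler_pM => //; [rewrite ger0_norm|rewrite ler_norml; apply/andP; split; move: K1; lra].
have bndV (x y h : R) : 0 < x <= K -> x^-1 <= K -> 0 <= y <= B -> `|h| <= H ->
    `|y * (x^-1 - 1) + h| <= B * K + H.
  move=> /andP[x1 xK] xV /andP[y1 yB] hH; apply: (le_trans (ler_normD _ _)); apply: lerD => //.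
  have xV0 : 0 < x^-1 by rewrite invr_gt0.
  by rewrite normrM; apply: ler_pM => //; [rewrite ger0_norm|rewrite ler_norml; apply/andP; split; move: K1; lra].
have mb i j : measurable_fun `[0, T] (b i j).
  apply: mop; first by apply: measurable_funM => //; exact: measurable_funB.
  by apply: measurable_funD => //; apply: measurable_funM => //; exact: measurable_funB.
have bb i j t : 0 <= t <= T -> `|b i j t| <= B * K + H.
  move=> tT; have [r1 r2] := rE t i j tT.
  by apply: opM; [apply: bnd => //; exact: lpB|apply: bndV => //; [exact: lmB|exact: tstep_bound]].
have -> : \int[leb3]_(z in C) op (grate0 z) (grate1 z) = \int[leb3]_(z in C) step_kernel b z.
  apply: eq_Rintegral => z /set_mem Cz; have [i [j zij]] := cube_cell n0 Cz.
  by rewrite /grate0 /grate1 /gridf !(step_kernelE n0 _ zij).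
rewrite -mulrA (Rintegral_step_kernel T0 n0 mb bb) big_distrr/=.
apply: eq_bigr => -[i j] _ /=.
rewrite (Rintegral_time_steps T0 N0 (mb i j) (bb i j)) big_distrr/= big_mkord.
apply: eq_bigr => k _.
pose g t := op (lp i j t * (r i j k - 1)) (lm i j t * ((r i j k)^-1 - 1) + cc i j k).
have mg : measurable_fun `[0, T] g.
  apply: mop; first exact: measurable_funM.
  by apply: measurable_funD => //; exact: measurable_funM.
have gb t : 0 <= t <= T -> `|g t| <= B * K + H.
  by move=> tT; apply: opM; [apply: bnd => //; exact: lpB|apply: bndV => //; exact: lmB].
have mag : measurable_fun `[0, T] (fun t => a * g t) by exact: measurable_funM.
have agb t : 0 <= t <= T -> `|a * g t| <= a * (B * K + H).
  by move=> tT; rewrite normrM (gtr0_norm a0) ler_pM2l// gb.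
transitivity (\int[mu]_(u in `[k%:R * dlt, k.+1%:R * dlt]) (a * g u)).
  apply: eq_Rintegral => u _; rewrite /g opa; congr op; rewrite /rate0 /rate1; ring.
rewrite -(Rintegral_gcell T0 N0 (ltn_ord k) mag agb).1 RintegralZl//.
- congr (_ * _); apply: eq_Rintegral => t /set_mem kt.
  by rewrite /b /g !(tstepE T0 N0 _ (ltn_ord k) kt).
- exact: measurable_gcell.
- have sub := gcell_sub (ltW d0) (ltn_ord k); rewrite NdT in sub.
  apply: (@bounded_integrable _ _ _ _ _ _ (B * K + H)).
  + exact: measurable_gcell.
  + exact: lebesgue_gcell_oo.
  + exact: measurable_funS mg.
  + by move=> t /sub; rewrite /= in_itv/=; exact: gb.
Qed.

Let Imin : \sum_(ij : 'I_n * 'I_n) \sum_(0 <= k < N) \int[mu]_(u in `[k%:R * dlt, k.+1%:R * dlt])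
  rmin ij.1 ij.2 (r ij.1 ij.2 k) (a * cc ij.1 ij.2 k) u =
  a * n%:R ^+ 2 * \int[leb3]_(z in C) Num.min (grate0 z) (grate1 z).
Proof.
apply: Iop => [x y|D f g mf mg|x y M xM yM].
- by rewrite minr_pMr// ltW.
- exact: measurable_minr.
- by case: (leP x y).
Qed.

Let Imax : \sum_(ij : 'I_n * 'I_n) \sum_(0 <= k < N) \int[mu]_(u in `[k%:R * dlt, k.+1%:R * dlt])
  rmax ij.1 ij.2 (r ij.1 ij.2 k) (a * cc ij.1 ij.2 k) u =
  a * n%:R ^+ 2 * \int[leb3]_(z in C) Num.max (grate0 z) (grate1 z).
Proof.
apply: Iop => [x y|D f g mf mg|x y M xM yM].
- by rewrite maxr_pMr// ltW.
- exact: measurable_maxr.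
- by case: (leP x y).
Qed.

(** Independence turns the moment into a product over the n^2 chains, each bounded by [bw_psteps].
    Here n and N are fixed and the sampling mesh m goes to infinity, which removes the error n^2 err
    / (m + 1). *)
Lemma pressure_bounds :
  K ^- (2 * N * n ^ 2) * expR (a * n%:R ^+ 2 * \int[leb3]_(z in C) Num.min (grate0 z) (grate1 z))
  <= \int[P]_w expR (gpair w)
  <= K ^+ (2 * N * n ^ 2) * expR (a * n%:R ^+ 2 * \int[leb3]_(z in C) Num.max (grate0 z) (grate1 z)).
Proof.
have [_ cvE] := gpair_limit.
rewrite -Imin -Imax.
set I1 := \sum_ij _; set I2 := \sum_ij _.
set E := 2 * (a * B) + a * H; set err := N%:R * (21 * K ^+ 2 * (E * dlt) ^+ 2).
have aB0 : 0 <= a * B by rewrite mulr_ge0// ltW.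
have lapE m : \int[P]_w expR (S m w) = \prod_ij \int[P]_w exp_path (X ij.1 ij.2) (L m ij) w.
  rewrite -(laplace_independent (ltW T0) _ hind)//; last by move=> ij t; exact: hXT.
  by apply: eq_Rintegral => w _; rewrite expR_sum.
have bnd : \forall m \near \oo, forall ij,
   K ^- (2 * N) * expR (\sum_(0 <= k < N) (\int[mu]_(u in `[k%:R * dlt, k.+1%:R * dlt])
     rmin ij.1 ij.2 (r ij.1 ij.2 k) (a * cc ij.1 ij.2 k) u) - err / m.+1%:R)
   <= \int[P]_w exp_path (X ij.1 ij.2) (L m ij) w <=
   K ^+ (2 * N) * expR (\sum_(0 <= k < N) (\int[mu]_(u in `[k%:R * dlt, k.+1%:R * dlt])
     rmax ij.1 ij.2 (r ij.1 ij.2 k) (a * cc ij.1 ij.2 k) u) + err / m.+1%:R).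
  near=> m => -[i j] /=.
  have [p tf mark] := chain_markov (hX i j).
  have laE : \int[P]_w exp_path (X i j) (L m (i, j)) w = bw p 0 (L m (i, j)) (x0 i j).
    have DE : setT `&` X i j 0 @^-1` [set x0 i j] = setT.
      by apply/seteqP; split => // w _; split => //=; exact: (chain_init (hX i j)).
    have := @laplace_bw _ _ _ P _ _ _ (@hXT i j) mark (L m (i, j)) 0 (x0 i j) setT (lexx 0).
    rewrite DE probability_setT mul1r; apply.
    - by have := psteps_sorted m (fun k => a * cc i j k) 0 N (ltW d0); rewrite mul0r.
    - by apply: sub_all (LT m (i, j)) => tc /andP[].
    - exact: ltW.
    - set G := [set X i j u @^-1` B | u in `[0, 0] & B in [set: set bool]].
      exact: (@measurableT _ (g_sigma_algebraType G)).
  rewrite laE.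
  have m2 (f : 'I_n -> 'I_n -> R -> R) : (forall i j, measurable_fun `[0, T] (f i j)) ->
     measurable_fun `[0, T] (fun t => a * f i j t).
    by move=> mf; exact: measurable_funM.
  have b2 (f : 'I_n -> 'I_n -> R -> R) : (forall i j t, 0 <= t <= T -> 0 <= f i j t <= B) ->
     forall t, 0 <= t <= T -> 0 <= a * f i j t <= a * B.
    by move=> fB t /(fB i j)/andP[f0 fb]; rewrite mulr_ge0 ?(ltW a0)// ler_pM2l.
  have eH k : `|a * cc i j k| <= a * H by rewrite normrM (gtr0_norm a0) ler_pM2l.
  have eK : E * (dlt / m.+1%:R) <= (6 * K)^-1.
    have K0 : 0 < K by move: K1; lra.
    rewrite mulrA ler_pdivrMr// -ler_pdivrMl ?invr_gt0 ?mulr_gt0//.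
    by apply: ltW; near: m; exact: near_lt_natS.
  have := bw_psteps tf (m2 _ mlp) (m2 _ mlm) (b2 _ lpB) (b2 _ lmB) K1 aB0 (rK i j) (rVK i j) eH
    (dlt := dlt) (m := m) (k := 0) (n := N) (ltW d0) _ eK (x0 i j).
  rewrite add0n NdT mul0r => /(_ (lexx _)).
  by rewrite /err mulrA.
have n2 : #|{: 'I_n * 'I_n}| = (n ^ 2)%N by rewrite card_prod !card_ord mulnn.
have prodE (x : R) (f : 'I_n * 'I_n -> R) e :
   \prod_ij (x * expR (f ij + e)) = x ^+ (n ^ 2) * expR (\sum_ij f ij + (n ^ 2)%:R * e).
  rewrite big_split/= prodr_const n2 -expR_sum big_split/= sumr_const n2.
  by rewrite mulr_natl.
have cv0 c : c * (err / m.+1%:R) @[m --> \oo] --> 0.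
  rewrite -(mulr0 c); apply: cvgM; first exact: cvg_cst.
  rewrite -(mulr0 err); apply: cvgM; first exact: cvg_cst.
  exact: cvg_harmonic.
have cvE2 (x I c : R) : x * expR (I + c * (err / m.+1%:R)) @[m --> \oo] --> x * expR I.
  apply: cvgM; first exact: cvg_cst.
  rewrite -[I in X in _ --> X]addr0.
  apply: (@cvg_comp _ _ _ (fun m => I + c * (err / m.+1%:R)) expR); last exact: continuous_expR.
  by apply: cvgD; [exact: cvg_cst|exact: cv0].
have K0 : 0 < K by move: K1; lra.
apply/andP; split.
- have := cvE2 (K ^- (2 * N * n ^ 2)) I1 (- (n ^ 2)%:R).
  move=> /ler_cvg_to => /(_ _ _ cvE); apply; apply: filterS bnd => m mb.
  rewrite lapE exprM -exprVn mulNr -mulrN -prodE.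
  apply: ler_prod => ij _; rewrite mulr_ge0 ?expR_ge0 ?invr_ge0 ?exprn_ge0 ?(ltW K0)//=.
  by have /andP[] := mb ij.
- have := cvE2 (K ^+ (2 * N * n ^ 2)) I2 ((n ^ 2)%:R).
  move=> /(ler_cvg_to cvE); apply; apply: filterS bnd => m mb.
  rewrite lapE exprM -prodE.
  apply: ler_prod => ij _; have /andP[h1 h2] := mb ij.
  by rewrite h2 andbT; apply: le_trans h1; rewrite mulr_ge0 ?expR_ge0 ?invr_ge0 ?exprn_ge0 ?(ltW K0).
Unshelve. all: end_near. Qed.

End pressure_bounds.

(** * Approximation in L^1 by kernels constant on boxes *)

Lemma dist_maxr (R : realType) (a b g f : R) :
  `|Num.max a b - Num.max g f| <= `|a - g| + `|b - f|.
Proof.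
have := ler_norm (a - g); have := ler_norm (g - a).
have := ler_norm (b - f); have := ler_norm (f - b).
rewrite (distrC g) (distrC f); move: `|a - g| `|b - f| => x y h1 h2 h3 h4.
rewrite ler_norml; case: (leP a b) => ?; case: (leP g f) => ?; apply/andP; split; lra.
Qed.

Section grid_approximation.
Context {R : realType}.
Variable T : R.
Hypothesis T0 : 0 < T.
Local Notation mu := (@lebesgue_measure R).
Local Notation C := (cube T).
Local Notation intC f := (\int[leb3]_(z in C) f z).

Lemma cube_integrable (f : R3 R -> R) M : measurable_fun C f ->
  (forall z, C z -> `|f z| <= M) -> leb3.-integrable C (EFin \o f).
Proof.
by move=> mf fM; apply: (@bounded_integrable _ _ _ _ _ _ M) => //;
  [exact: measurable_cube|exact: leb3_cube_oo].
Qed.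

Section gridf_theory.
Variables (n N : nat).
Hypotheses (n0 : (0 < n)%N) (N0 : (0 < N)%N).
Implicit Type G : 'I_n -> 'I_n -> nat -> R.

Lemma measurable_gridf G : measurable_fun C (gridf T N G).
Proof.
by apply: measurable_step_kernel => i j; apply: measurable_funTS; exact: measurable_tstep.
Qed.

Lemma gridf_ex z : C z -> exists i j, exists2 k, (k < N)%N &
  [/\ (cell i `*` cell j) z.1, gcell (T / N%:R) k z.2 & forall G, gridf T N G z = G i j k].
Proof.
move=> Cz; have [i [j zij]] := cube_cell n0 Cz.
have [|k kN kt] := @time_cover R T T0 N N0 z.2; first by case: Cz => _; rewrite /= in_itv.
exists i, j, k => //; split => // G.
by rewrite /gridf (step_kernelE n0 _ zij) (tstepE T0 N0 _ kN kt).
Qed.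

Lemma gridf_itv G lo hi z : (forall i j k, lo <= G i j k <= hi) -> C z ->
  lo <= gridf T N G z <= hi.
Proof. by move=> Gb Cz; have [i [j [k kN [_ _ ->]]]] := gridf_ex Cz. Qed.

End gridf_theory.

(** Since n is the index of the sequence, one threshold must serve all finer grids, nested or not.
    The range [lo, hi] is kept because the eigenvector ratios have to stay in [1/K, K] after
    approximation. *)
Definition approximable lo hi (f : R3 R -> R) := forall e, 0 < e -> exists N0, forall n N,
  (N0 < n)%N -> (N0 < N)%N -> exists2 G : 'I_n -> 'I_n -> nat -> R,
    (forall i j k, lo <= G i j k <= hi) & intC (fun z => `|f z - gridf T N G z|) < e.

Let ind01 (A : set (R3 R)) z : 0 <= (\1_A z : R) <= 1.
Proof. by rewrite indicE; case: (_ \in _); rewrite ?lexx ?ler01. Qed.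

Lemma cube_integrable_dist (f g : R3 R -> R) M M' : measurable_fun C f -> measurable_fun C g ->
  (forall z, C z -> `|f z| <= M) -> (forall z, C z -> `|g z| <= M') ->
  leb3.-integrable C (EFin \o (fun z => `|f z - g z|)).
Proof.
move=> mf mg fM gM; apply: (@cube_integrable _ (M + M')).
  by apply: measurableT_comp => //; exact: measurable_funB.
move=> z Cz; rewrite normr_id; apply: (le_trans (ler_normB _ _)).
by rewrite lerD ?fM ?gM.
Qed.

Lemma measurable_indic_cube (A : set (R3 R)) : measurable A -> measurable_fun C (\1_A : R3 R -> R).
Proof. by move=> mA; exact: measurable_indic. Qed.

Lemma norm_le1 (x : R) : 0 <= x <= 1 -> `|x| <= 1.
Proof. by move=> /andP[x0 x1]; rewrite ger0_norm. Qed.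

Lemma indic_norm_le1 (A : set (R3 R)) z : C z -> `|\1_A z : R| <= 1.
Proof. by move=> _; apply: norm_le1; exact: ind01. Qed.

Lemma gridf_norm_le1 n N G : (0 < n)%N -> (0 < N)%N -> (forall i j k, 0 <= G i j k <= 1) ->
  forall z, C z -> `|gridf (n := n) T N G z| <= 1.
Proof. by move=> n0 N0 G01 z Cz; apply: norm_le1; exact: gridf_itv. Qed.

Let leq_ltn_pos N0 n : (N0 < n)%N -> (0 < n)%N. Proof. exact: leq_ltn_trans. Qed.

Definition approximable_sets : set (set (R3 R)) :=
  [set A | measurable A /\ approximable 0 1 (\1_A)].

Lemma approximable_setsC A : approximable_sets A -> approximable_sets (~` A).
Proof.
move=> [mA aA]; split; first exact: measurableC.
move=> e e0; have [N0 H] := aA e e0; exists N0 => n N nn NN.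
have [G G01 Ge] := H n N nn NN.
exists (fun i j k => 1 - G i j k).
  by move=> i j k; case/andP: (G01 i j k) => ? ?; apply/andP; split; lra.
apply: le_lt_trans Ge; rewrite le_eqVlt; apply/orP; left; apply/eqP.
apply: eq_Rintegral => z /set_mem Cz.
have [i [j [k kN [_ _ gE]]]] := gridf_ex (leq_ltn_pos nn) (leq_ltn_pos NN) Cz.
rewrite !gE !indicE in_setC; case: (z \in A) => /=.
  by rewrite sub0r normrN.
by rewrite subKr sub0r normrN.
Qed.

Lemma approximable_setsU A B : approximable_sets A -> approximable_sets B ->
  approximable_sets (A `|` B).
Proof.
move=> [mA aA] [mB aB]; split; first exact: measurableU.
move=> e e0; have e2 : 0 < e / 2 by rewrite divr_gt0.
have [N1 H1] := aA _ e2; have [N2 H2] := aB _ e2; exists (maxn N1 N2) => n N.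
rewrite !gtn_max => /andP[n1 n2] /andP[N1' N2'].
have [G G01 Ge] := H1 n N n1 N1'; have [F F01 Fe] := H2 n N n2 N2'.
have n0 := leq_ltn_pos n1; have N0 := leq_ltn_pos N1'.
exists (fun i j k => Num.max (G i j k) (F i j k)).
  move=> i j k; case/andP: (G01 i j k) => ? ?; case/andP: (F01 i j k) => ? ?.
  by apply/andP; split; case: (leP (G i j k)).
have iA := cube_integrable_dist (measurable_indic_cube mA) (measurable_gridf N G) (@indic_norm_le1 A) (gridf_norm_le1 n0 N0 G01).
have iB := cube_integrable_dist (measurable_indic_cube mB) (measurable_gridf N F) (@indic_norm_le1 B) (gridf_norm_le1 n0 N0 F01).
apply: le_lt_trans (_ : intC (fun z => `|\1_A z - gridf T N G z| + `|\1_B z - gridf T N F z|) < _).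
  apply: le_Rintegral; first exact: measurable_cube.
  - apply: (cube_integrable_dist (M := 1) (M' := 1)); first by apply: measurable_indic_cube; exact: measurableU.
    + exact: measurable_gridf.
    + exact: indic_norm_le1.
    + apply: gridf_norm_le1 => // i j k; case/andP: (G01 i j k) => ? ?; case/andP: (F01 i j k) => ? ?.
      by apply/andP; split; case: (leP (G i j k)).
  - rewrite (_ : _ \o _ = fun z => ((`|\1_A z - gridf T N G z|)%:E + (`|\1_B z - gridf T N F z|)%:E)%E)//.
    by apply: integrableD => //; exact: measurable_cube.
  move=> z Cz; have [i [j [k kN [_ _ gE]]]] := gridf_ex n0 N0 Cz; rewrite !gE.
  have -> : \1_(A `|` B) z = Num.max (\1_A z) (\1_B z) :> R.
    by rewrite !indicE in_setU; case: (_ \in A); case: (_ \in B) => /=;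
      rewrite ?maxxx//; [rewrite max_l|rewrite max_r].
  exact: dist_maxr.
rewrite RintegralD//; last exact: measurable_cube.
by rewrite [e]splitr ltrD.
Qed.

Lemma approximable_sets0 : approximable_sets set0.
Proof.
split => // e e0; exists 0%N => n N n0 N0; exists (fun _ _ _ => 0) => //.
  by move=> *; rewrite lexx ler01.
suff -> : intC (fun z => `|\1_set0 z - gridf (n := n) T N (fun _ _ _ => 0) z|) = 0 by [].
transitivity (intC (fun _ => 0)); last by rewrite Rintegral_cube_cst// mul0r.
apply: eq_Rintegral => z /set_mem Cz; have [i [j [k kN [_ _ ->]]]] := gridf_ex n0 N0 Cz.
by rewrite indic0 subrr normr0.
Qed.

(** Complements and finite unions are copied on the grid values as 1 - G and max(G, F). For a
    countable union, the finite unions converge in L^1 of the cube by dominated convergence. *)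
Lemma approximable_sets_sigma : sigma_algebra setT approximable_sets.
Proof.
split; first exact: approximable_sets0.
  by move=> A aA; rewrite setTD; exact: approximable_setsC.
move=> A aA.
pose B m := \big[setU/set0]_(i < m) A i.
have aB m : approximable_sets (B m).
  rewrite /B; elim: m => [|m IH]; first by rewrite big_ord0; exact: approximable_sets0.
  by rewrite big_ord_recr; exact: approximable_setsU.
have mU : measurable (\bigcup_k A k) by apply: bigcupT_measurable => k; case: (aA k).
split => // e e0; have e2 : 0 < e / 2 by rewrite divr_gt0.
have [||||| _ cv] := @bounded_dominated _ _ _ leb3 C 1
   (fun m z => `|\1_(\bigcup_k A k) z - \1_(B m) z|) (cst 0).
- exact: measurable_cube.
- exact: leb3_cube_oo.
- move=> m; apply: measurableT_comp => //; apply: measurable_funB; apply: measurable_indic_cube => //.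
  by case: (aB m).
- move=> m z _; rewrite normr_id !indicE; case: (_ \in _); case: (_ \in _);
  by rewrite ?subrr ?subr0 ?sub0r ?normrN ?normr0 ?normr1 ?ler01.
- move=> z _; apply: cvg_near_cst.
  have [[k _ Ak]|nA] := pselect ((\bigcup_k A k) z).
    near=> m; have km : (k < m)%N by near: m; exact: nbhs_infty_gt.
    have zA : z \in \bigcup_k A k by apply/mem_set; exists k.
    have zB : z \in B m by apply/mem_set; rewrite /B -bigcup_mkord; exists k.
    by rewrite !indicE zA zB subrr normr0.
  near=> m; rewrite !indicE !memNset ?subrr ?normr0// /B -bigcup_mkord => -[k _ Ak].
  by apply: nA; exists k.
rewrite Rintegral_cube_cst// mul0r in cv.
have [m Bm] : exists m, intC (fun z => `|\1_(\bigcup_k A k) z - \1_(B m) z|) < e / 2.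
  move/cvgrPdist_lt: cv => /(_ _ e2)[m _ /(_ m (leqnn m))].
  by rewrite sub0r normrN => /(le_lt_trans (ler_norm _)) Bm; exists m.
have [mB /(_ _ e2)[N0 H]] := aB m; exists N0 => n N nn NN.
have [G G01 Ge] := H n N nn NN; exists G => //.
have n0 := leq_ltn_pos nn; have N0' := leq_ltn_pos NN.
have i1 := cube_integrable_dist (measurable_indic_cube mU) (measurable_indic_cube mB) (@indic_norm_le1 _) (@indic_norm_le1 _).
have i2 := cube_integrable_dist (measurable_indic_cube mB) (measurable_gridf N G) (@indic_norm_le1 _) (gridf_norm_le1 n0 N0' G01).
apply: le_lt_trans (_ : intC (fun z => `|\1_(\bigcup_k A k) z - \1_(B m) z| + `|\1_(B m) z - gridf T N G z|) < _).
  apply: le_Rintegral; first exact: measurable_cube.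
  - exact: (cube_integrable_dist (measurable_indic_cube mU) (measurable_gridf N G) (@indic_norm_le1 _) (gridf_norm_le1 n0 N0' G01)).
  - rewrite (_ : _ \o _ = fun z => ((`|\1_(\bigcup_k A k) z - \1_(B m) z|)%:E + (`|\1_(B m) z - gridf T N G z|)%:E)%E)//.
    by apply: integrableD => //; exact: measurable_cube.
  by move=> z Cz; exact: ler_distD.
rewrite RintegralD//; last exact: measurable_cube.
by rewrite [e]splitr ltrD.
Unshelve. all: end_near. Qed.

(* [pr] is one of the three coordinates, cut into cells of length [l / n]. *)
Let approximable_coord (pr : R3 R -> R) (l : R) (idx : forall n, 'I_n -> 'I_n -> nat -> nat) (M : R) :
  0 < l -> measurable_fun setT pr ->
  (forall n N, (0 < n)%N -> (0 < N)%N -> exists2 m, m = n \/ m = N &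
   forall z i j k, C z -> (cell i `*` cell j) z.1 -> gcell (T / N%:R) k z.2 ->
    (idx n i j k)%:R * (l / m%:R) <= pr z <= (idx n i j k).+1%:R * (l / m%:R)) ->
  (forall x e, 0 < e -> (leb3 (C `&` [set z | x - e <= pr z <= x]%R) <= (M * e)%:E)%E) ->
  forall B : set R, measurable B -> approximable_sets (pr @^-1` B).
Proof.
move=> l0 mpr pridx slab.
move=> B mB; have : (RGenOInfty.G (R:=R)).-sigma.-measurable B.
  by rewrite -RGenOInfty.measurableE.
move: B {mB}; apply: smallest_sub.
  split; first by rewrite preimage_set0; exact: approximable_sets0.
  - move=> A aA; rewrite setTD preimage_setC; exact: approximable_setsC.
  - move=> A aA; rewrite preimage_bigcup.
    by have [_ _] := approximable_sets_sigma; apply.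
move=> _ [x ->]; split.
  by rewrite -[_ @^-1` _]setTI; apply: mpr => //; exact: measurable_itv.
move=> e e0.
have M1 : 0 < `|M| + 1 by rewrite ltr_pwDr.
pose c := e / ((`|M| + 1) * l).
have c0 : 0 < c by rewrite divr_gt0// mulr_gt0.
exists (Num.trunc c^-1).+1 => n N nn NN.
have n0 := leq_ltn_pos nn; have N0 := leq_ltn_pos NN.
have [m mnN Hm] := pridx n N n0 N0.
have m0 : (0 < m)%N by case: mnN => ->.
have mc : m%:R^-1 < c.
  rewrite -[ltRHS]invrK ltf_pV2 ?posrE ?invr_gt0 ?ltr0n//.
  have /andP[_ c1] := truncn_itv (ltW (ltac:(by rewrite invr_gt0) : 0 < c^-1)).
  by apply: (lt_trans c1); rewrite ltr_nat; case: mnN => ->.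
set dl := l / m%:R in Hm.
have dl0 : 0 < dl by rewrite divr_gt0// ltr0n.
(* The indicator of pr > x read at the right end of the cell: it can be wrong only if x - dl <= pr z
   <= x, a slab one cell thick. *)
pose G := fun (i j : 'I_n) k => ((x < (idx n i j k).+1%:R * dl)%R)%:R : R.
exists G; first by move=> i j k; rewrite /G; case: (_ < _); rewrite ?lexx ?ler01.
pose S := [set z | x - dl <= pr z <= x].
have mS : measurable S.
  have -> : S = pr @^-1` `[x - dl, x]%classic by apply/seteqP; split => z; rewrite /S /= in_itv.
  by rewrite -[_ @^-1` _]setTI; apply: mpr => //; exact: measurable_itv.
apply: le_lt_trans (_ : intC (\1_S) < _).
  apply: le_Rintegral; first exact: measurable_cube.
  - apply: (cube_integrable_dist (M := 1) (M' := 1)).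
    + apply: measurable_indic_cube; rewrite -[_ @^-1` _]setTI; apply: mpr => //; exact: measurable_itv.
    + exact: measurable_gridf.
    + exact: indic_norm_le1.
    + by apply: gridf_norm_le1 => // i j k; rewrite /G; case: (_ < _); rewrite ?lexx ?ler01.
  - by apply: (@cube_integrable (\1_S) 1); [exact: measurable_indic_cube|exact: indic_norm_le1].
  move=> z Cz; have [i [j [k kN [zc zt gE]]]] := gridf_ex n0 N0 Cz.
  have /andP[z1 z2] := Hm z i j k Cz zc zt.
  rewrite gE /G !indicE.
  have -> : (z \in pr @^-1` `]x, +oo[%classic) = (x < pr z).
    by apply/idP/idP; rewrite inE/= in_itv/= andbT.
  have [xp|xp] := ltP x (pr z); first by rewrite (lt_le_trans xp z2) subrr normr0 ler0n.
  have [xi|xi] := ltP x _; last by rewrite subrr normr0 ler0n.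
  rewrite mem_set ?sub0r ?normrN ?normr1//; rewrite /S/= xp andbT lerBlDr.
  by apply: (le_trans (ltW xi)); rewrite -natr1 mulrDl mul1r lerD2r.
rewrite Rintegral_indic//; last exact: measurable_cube.
rewrite setIC.
have dlc : dl < e / (`|M| + 1).
  rewrite /dl; have -> : e / (`|M| + 1) = l * c by rewrite /c; field; rewrite !gt_eqF.
  by rewrite ltr_pM2l.
have sl := slab x dl dl0.
have f1 : leb3 (C `&` S) \is a fin_num.
  by rewrite ge0_fin_numE//; apply: le_lt_trans sl _; rewrite ltry.
apply: le_lt_trans (_ : M * dl < e).
  by rewrite -lee_fin fineK.
apply: le_lt_trans (_ : (`|M| + 1) * dl < e).
  by rewrite ler_wpM2r ?(ltW dl0)//; have := ler_norm M; lra.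
by rewrite mulrC -ltr_pdivlMr.
Qed.

Let leb3_box (A1 A2 A3 : set (mR R)) : measurable A1 -> measurable A2 -> measurable A3 ->
  leb3 ((A1 `*` A2) `*` A3) = (mu A1 * mu A2 * mu A3)%E.
Proof.
move=> m1 m2 m3; rewrite /leb3/= product_measure1E//; last exact: measurableX.
transitivity (leb2 (A1 `*` A2) * mu A3)%E; first by [].
by rewrite leb2X.
Qed.

Let mu_itv (x y : R) : x <= y -> mu `[x, y]%classic = (y - x)%:E.
Proof.
move=> xy; rewrite /= lebesgue_measure_itv/= lte_fin; case: ltP => // yx.
by have -> : y = x by [apply/eqP; rewrite eq_le yx xy]; rewrite subrr.
Qed.

Let slab_le (pr : R3 R -> R) (A1 A2 A3 : set (mR R)) x e M : 0 < e -> measurable_fun setT pr ->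
  measurable A1 -> measurable A2 -> measurable A3 ->
  C `&` [set z | x - e <= pr z <= x] `<=` (A1 `*` A2) `*` A3 ->
  (mu A1 * mu A2 * mu A3 = (M * e)%:E)%E ->
  (leb3 (C `&` [set z | x - e <= pr z <= x]%R) <= (M * e)%:E)%E.
Proof.
move=> e0 mpr m1 m2 m3 sub <-; rewrite -leb3_box//; apply: le_measure => //; rewrite inE.
  apply: measurableI; first exact: measurable_cube.
  have -> : [set z | x - e <= pr z <= x] = pr @^-1` `[x - e, x]%classic.
    by apply/seteqP; split => z; rewrite /= in_itv.
  by rewrite -[_ @^-1` _]setTI; apply: mpr => //; exact: measurable_itv.
by apply: measurableX => //; exact: measurableX.
Qed.

(** The approximable sets form a sigma-algebra, so it suffices to treat half-spaces in each of the
    three coordinates, where the error is the volume of a thin slab. *)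
Lemma measurable_approximable (A : set (R3 R)) : measurable A -> approximable_sets A.
Proof.
have xe (x e : R) : 0 < e -> mu `[x - e, x]%classic = e%:E.
  by move=> e0; rewrite mu_itv ?lerBlDr ?lerDl ?(ltW e0)//; congr (_%:E); ring.
have m01 : mu `[0%R, 1%R]%classic = 1%:E by rewrite mu_itv// subr0.
have m0T : mu `[0%R, T]%classic = T%:E by rewrite mu_itv ?(ltW T0)// subr0.
have mi (x y : R) : measurable (`[x, y]%classic : set (mR R)) by exact: measurable_itv.
have p11 : measurable_fun setT (fun z : R3 R => z.1.1).
  exact: (measurableT_comp measurable_fst measurable_fst).
have p12 : measurable_fun setT (fun z : R3 R => z.1.2).
  exact: (measurableT_comp measurable_snd measurable_fst).
have p2 : measurable_fun setT (fun z : R3 R => z.2) by exact: measurable_snd.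
have a11 (B : set (mR R)) : measurable B -> approximable_sets ((fun z : R3 R => z.1.1) @^-1` B).
  apply: (@approximable_coord _ 1 (fun n i j k => i) T) => //.
    move=> n N n0 N0; exists n; first by left.
    move=> z i j k Cz [zi _] _; rewrite div1r; exact: gcell_bounds.
  move=> x e e0; apply: (@slab_le _ `[x - e, x]%classic `[0, 1]%classic `[0, T]%classic) => //.
    by move=> z [[[/= _ z2] z3] zx]; split => //; split => //; rewrite /= in_itv.
  by rewrite xe// m01 m0T -!EFinM mulr1 mulrC.
have a12 (B : set (mR R)) : measurable B -> approximable_sets ((fun z : R3 R => z.1.2) @^-1` B).
  apply: (@approximable_coord _ 1 (fun n i j k => j) T) => //.
    move=> n N n0 N0; exists n; first by left.
    move=> z i j k Cz [_ zj] _; rewrite div1r; exact: gcell_bounds.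
  move=> x e e0; apply: (@slab_le _ `[0, 1]%classic `[x - e, x]%classic `[0, T]%classic) => //.
    by move=> z [[[/= z1 _] z3] zx]; split => //; split => //; rewrite /= in_itv.
  by rewrite xe// m01 m0T -!EFinM mul1r mulrC.
have a2 (B : set (mR R)) : measurable B -> approximable_sets ((fun z : R3 R => z.2) @^-1` B).
  apply: (@approximable_coord _ T (fun n i j k => k) 1) => //.
    move=> n N n0 N0; exists N; first by right.
    move=> z i j k Cz _ zk; apply: gcell_bounds => //.
    by rewrite divr_ge0// ltW.
  move=> x e e0; apply: (@slab_le _ `[0, 1]%classic `[0, 1]%classic `[x - e, x]%classic) => //.
    by move=> z [[[/= z1 z2] z3] zx]; split => //; rewrite /= in_itv.
  by rewrite xe// m01 -!EFinM !mul1r.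
have aI X Y : approximable_sets X -> approximable_sets Y -> approximable_sets (X `&` Y).
  move=> aX aY; rewrite -[_ `&` _]setCK setCI; apply: approximable_setsC.
  by apply: approximable_setsU; exact: approximable_setsC.
have sigma_pre (pr : R3 R -> R2 R) : sigma_algebra setT [set A | approximable_sets (pr @^-1` A)].
  split; first by rewrite /= preimage_set0; exact: approximable_sets0.
  - by move=> B aB; rewrite /= setTD preimage_setC; exact: approximable_setsC.
  - move=> F aF; rewrite /= preimage_bigcup.
    by have [_ _] := approximable_sets_sigma; apply.
have a1 : (measurable : set (set (R2 R))) `<=`
    [set B | approximable_sets ((fun z : R3 R => z.1) @^-1` B)].
  rewrite measurable_prod_measurableType; apply: smallest_sub; first exact: sigma_pre.
  move=> _ [X mX [Y mY <-]] /=.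
  have -> : (fun z : R3 R => z.1) @^-1` (X `*` Y) =
     ((fun z : R3 R => z.1.1) @^-1` X) `&` ((fun z : R3 R => z.1.2) @^-1` Y) by [].
  by apply: aI; [exact: a11|exact: a12].
move: A; rewrite measurable_prod_measurableType; apply: smallest_sub.
  exact: approximable_sets_sigma.
move=> _ [X mX [Y mY <-]].
have -> : X `*` Y = ((fun z : R3 R => z.1) @^-1` X) `&` ((fun z : R3 R => z.2) @^-1` Y) by [].
by apply: aI; [exact: a1|exact: a2].
Qed.

End grid_approximation.

Section approximable_functions.
Context {R : realType}.
Variable T : R.
Hypothesis T0 : 0 < T.
Local Notation C := (cube T).
Local Notation intC f := (\int[leb3]_(z in C) f z).

Lemma intC_le (f g : R3 R -> R) : leb3.-integrable C (EFin \o f) ->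
  leb3.-integrable C (EFin \o g) -> (forall z, C z -> f z <= g z) -> intC f <= intC g.
Proof. by move=> fi gi fg; apply: le_Rintegral => //; exact: measurable_cube. Qed.

Lemma intCD (f g : R3 R -> R) : leb3.-integrable C (EFin \o f) ->
  leb3.-integrable C (EFin \o g) -> intC (fun z => f z + g z) = intC f + intC g.
Proof. by move=> fi gi; rewrite RintegralD//; exact: measurable_cube. Qed.

Lemma integrableCD (f g : R3 R -> R) : leb3.-integrable C (EFin \o f) ->
  leb3.-integrable C (EFin \o g) -> leb3.-integrable C (EFin \o (fun z => f z + g z)).
Proof.
move=> fi gi; rewrite (_ : _ \o _ = fun z => ((f z)%:E + (g z)%:E)%E)//.
by apply: integrableD => //; exact: measurable_cube.
Qed.

Lemma intCZ (f : R3 R -> R) k : leb3.-integrable C (EFin \o f) ->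
  intC (fun z => k * f z) = k * intC f.
Proof. by move=> fi; rewrite RintegralZl//; exact: measurable_cube. Qed.

Lemma integrableCZ (f : R3 R -> R) k : leb3.-integrable C (EFin \o f) ->
  leb3.-integrable C (EFin \o (fun z => k * f z)).
Proof.
move=> fi; rewrite (_ : _ \o _ = fun z => (k%:E * (f z)%:E)%E)//.
by apply: integrableZl => //; exact: measurable_cube.
Qed.

Lemma integrableC_measurable (f : R3 R -> R) : leb3.-integrable C (EFin \o f) -> measurable_fun C f.
Proof. by move/integrableP => [/measurable_EFinP]. Qed.

Lemma integrableC_le (f g : R3 R -> R) : measurable_fun C f ->
  (forall z, C z -> `|f z| <= g z) ->
  leb3.-integrable C (EFin \o g) -> leb3.-integrable C (EFin \o f).
Proof.
move=> mf fg; apply: le_integrable; first exact: measurable_cube.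
  exact/measurable_EFinP.
move=> z Cz /=; rewrite lee_fin.
by apply: (le_trans (fg z Cz)); exact: ler_norm.
Qed.

(* Halving: a [0,1]-valued f is the mean of the indicator of [f >= 1/2] and of
   another [0,1]-valued function. *)
Lemma approximable_dyadic m (f : R3 R -> R) e : measurable_fun C f ->
  (forall z, C z -> 0 <= f z <= 1) -> 2 ^- m * T < e ->
  exists N0, forall n N, (N0 < n)%N -> (N0 < N)%N ->
  exists2 G : 'I_n -> 'I_n -> nat -> R,
    (forall i j k, 0 <= G i j k <= 1) & intC (fun z => `|f z - gridf T N G z|) < e.
Proof.
elim: m f e => [|m IH] f e mf f01 Te.
  rewrite expr0 invr1 mul1r in Te.
  exists 0%N => n N n0 N0; exists (fun _ _ _ => 0) => [i j k|]; first by rewrite lexx ler01.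
  apply: le_lt_trans Te; rewrite -[leRHS]mul1r -(Rintegral_cube_cst T0).
  have g01 := gridf_norm_le1 T0 n0 N0 (G := fun _ _ _ => 0) (fun _ _ _ => ltac:(by rewrite lexx ler01)).
  apply: intC_le.
  - apply: (cube_integrable_dist T0 mf (measurable_gridf _ _) _ g01 (M := 1)) => z /f01.
    exact: norm_le1.
  - by apply: (cube_integrable T0 (M := 1)) => // z _; rewrite normr1.
  move=> z Cz; have [i [j [k kN [_ _ ->]]]] := gridf_ex T0 n0 N0 Cz.
  by rewrite subr0; exact/norm_le1/f01.
pose A := C `&` [set z | 2^-1 <= f z].
have mA : measurable A.
  have -> : A = C `&` f @^-1` `[2^-1, +oo[%classic.
    by apply/seteqP; split => z; rewrite /A /= in_itv/= andbT.
  by apply: mf => //; exact: measurable_cube.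
pose f' z : R := 2 * f z - \1_A z.
have mf' : measurable_fun C f'.
  by apply: measurable_funB; [exact: measurable_funM|exact: measurable_indic_cube].
have f'01 z : C z -> 0 <= f' z <= 1.
  move=> Cz; have /andP[f0 f1] := f01 z Cz; rewrite /f' indicE.
  have [/set_mem[_ /= fz]|] := boolP (z \in A); first by apply/andP; split; lra.
  rewrite notin_setE /A /= => /not_andP[//|/negP].
  by rewrite -ltNge => fz; apply/andP; split; lra.
(* Half of the slack, so that e1 + (2^-m T + e1) = 2 e; the halving then returns e. *)
pose e1 := (2 * e - 2 ^- m * T) / 2.
have Te' : 2 ^- m * T < 2 * e.
  by rewrite -ltr_pdivrMl// mulrA -invfM -exprS.
have e10 : 0 < e1 by rewrite divr_gt0// subr_gt0.
have [mAa /(_ _ e10)[N1 H1]] := measurable_approximable T0 mA.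
have [|N2 H2] := IH f' (2 ^- m * T + e1) mf' f'01; first by rewrite ltrDl.
exists (maxn N1 N2) => n N; rewrite !gtn_max => /andP[n1 n2] /andP[N1' N2'].
have [G G01 Ge] := H1 n N n1 N1'; have [F F01 Fe] := H2 n N n2 N2'.
have n0 : (0 < n)%N by apply: leq_ltn_trans n1.
have N0 : (0 < N)%N by apply: leq_ltn_trans N1'.
pose GF := fun (i j : 'I_n) k => (G i j k + F i j k) / 2.
have GF01 i j k : 0 <= GF i j k <= 1.
  by case/andP: (G01 i j k) => ? ?; case/andP: (F01 i j k) => ? ?; apply/andP; split; rewrite /GF; lra.
exists GF => //.
have iA := cube_integrable_dist T0 (measurable_indic_cube mA) (measurable_gridf N G) (indic_norm_le1 A (T := T)) (gridf_norm_le1 T0 n0 N0 G01).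
have f'1 z : C z -> `|f' z| <= 1 by move=> /f'01; exact: norm_le1.
have f1 z : C z -> `|f z| <= 1 by move=> /f01; exact: norm_le1.
have iF := cube_integrable_dist T0 mf' (measurable_gridf N F) f'1 (gridf_norm_le1 T0 n0 N0 F01).
apply: le_lt_trans (_ : intC (fun z => 2^-1 * (`|\1_A z - gridf T N G z| + `|f' z - gridf T N F z|)) < _).
  apply: intC_le.
  - exact: (cube_integrable_dist T0 mf (measurable_gridf N GF) f1 (gridf_norm_le1 T0 n0 N0 GF01)).
  - by apply: integrableCZ; exact: integrableCD.
  move=> z Cz; have [i [j [k kN [_ _ gE]]]] := gridf_ex T0 n0 N0 Cz.
  rewrite !gE /GF.
  have -> : f z - (G i j k + F i j k) / 2 = 2^-1 * ((\1_A z - G i j k) + (f' z - F i j k)).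
    by rewrite /f'; field.
  by rewrite normrM gtr0_norm// ler_pM2l// ler_normD.
rewrite intCZ; last exact: integrableCD.
rewrite intCD// ltr_pdivrMl//.
have : 2 * e = e1 + (2 ^- m * T + e1) by rewrite /e1; field; rewrite expf_neq0.
by move=> ->; apply: ltrD.
Qed.

Lemma approximable_bounded (f : R3 R -> R) (lo hi : R) : lo < hi -> measurable_fun C f ->
  (forall z, C z -> lo <= f z <= hi) -> approximable T lo hi f.
Proof.
move=> lohi mf fb e e0.
have D0 : 0 < hi - lo by rewrite subr_gt0.
pose f' z := (f z - lo) / (hi - lo).
have mf' : measurable_fun C f' by apply: measurable_funM => //; exact: measurable_funB.
have f'01 z : C z -> 0 <= f' z <= 1.
  move=> /fb/andP[f0 f1]; rewrite /f' divr_ge0 ?subr_ge0 ?(ltW lohi)//=.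
  by rewrite ler_pdivrMr// mul1r lerD2r.
have e'0 : 0 < e / (hi - lo) by rewrite divr_gt0.
have [m mT] : exists m, 2 ^- m * T < e / (hi - lo).
  have [m Hm] : exists m, T / (e / (hi - lo)) < m.+1%:R.
    by exists (Num.trunc (T / (e / (hi - lo)))); have /andP[] := truncn_itv (ltW (divr_gt0 T0 e'0)).
  exists m.+1; rewrite ltr_pdivrMl ?exprn_gt0// mulrC -ltr_pdivrMl//.
  rewrite mulrC; apply: (lt_trans Hm); rewrite -natrX ltr_nat; exact: ltn_expl.
have [N0 H] := approximable_dyadic mf' f'01 mT.
exists N0 => n N nn NN; have [G G01 Ge] := H n N nn NN.
have n0 : (0 < n)%N by apply: leq_ltn_trans nn.
have N0' : (0 < N)%N by apply: leq_ltn_trans NN.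
exists (fun i j k => lo + (hi - lo) * G i j k).
  move=> i j k; case/andP: (G01 i j k) => g0 g1; rewrite lerDl mulr_ge0 ?(ltW D0)//=.
  by rewrite -lerBrDl ler_piMr// ltW.
have f'1 z : C z -> `|f' z| <= 1 by move=> /f'01; exact: norm_le1.
suff -> : intC (fun z => `|f z - gridf T N (fun i j k => lo + (hi - lo) * G i j k) z|) =
    (hi - lo) * intC (fun z => `|f' z - gridf T N G z|) by rewrite -ltr_pdivlMl// mulrC.
rewrite -intCZ; last first.
  exact: (cube_integrable_dist T0 mf' (measurable_gridf N G) f'1 (gridf_norm_le1 T0 n0 N0' G01)).
apply: eq_Rintegral => z /set_mem Cz.
have [i [j [k kN [_ _ gE]]]] := gridf_ex T0 n0 N0' Cz.
rewrite !gE -[in RHS](gtr0_norm D0) -normrM; congr (`|_|).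
by rewrite /f'; field; rewrite gt_eqF.
Qed.

End approximable_functions.

(** * From L^1 norms on the restricted measure to integrals over the cube *)

Section leb_cube_integrals.
Context {R : realType}.
Variable T : R.
Hypothesis T0 : 0 < T.
Local Notation C := (cube T).
Local Notation intC f := (\int[leb3]_(z in C) f z).

Lemma integral_leb_cube (f : R3 R -> \bar R) :
  (\int[leb_cube T]_z (f \_ C) z = \int[leb3]_(z in C) f z)%E.
Proof.
rewrite -integral_mkcond; apply: eq_measure_integral => A mA AC.
by rewrite /leb_cube/= /mrestr setIidl.
Qed.

Lemma integrable_leb_cube (f : R3 R -> R) :
  (leb_cube T).-integrable setT (EFin \o (f \_ C)) -> leb3.-integrable C (EFin \o f).
Proof.
move=> /integrableP[mf fi]; apply/integrableP; split.
  apply/(measurable_restrictT _ (measurable_cube T)).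
  by rewrite restrict_EFin.
rewrite -integral_leb_cube.
move: fi; congr (_ < _)%E; apply: eq_integral => z _.
by rewrite /= !patchE; case: ifPn => //; rewrite normr0.
Qed.

Lemma inLp1_integrable (f : R3 R -> R) : inLp T 1 f -> leb3.-integrable C (EFin \o f).
Proof. by move=> /Lfun1_integrable; exact: integrable_leb_cube. Qed.

Lemma Lnorm1_leb_cube (g : R3 R -> R) :
  fine ('N[leb_cube T]_(1%:E) [EFin \o g \_ C])%E = intC (fun z => `|g z|).
Proof.
rewrite Lnorm1 /Rintegral -(integral_leb_cube (fun z => (`|g z|)%:E)).
have -> : (fun z => `|(EFin \o g \_ C) z|%E) = (fun z => (`|g z|)%:E) \_ C; last by [].
by apply/funext => z; rewrite /= !patchE; case: ifPn => //; rewrite normr0.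
Qed.

Lemma cvgLp1 (f_ : nat -> R3 R -> R) (f : R3 R -> R) : cvgLp T 1 f_ f ->
  intC (fun z => `|f_ n z - f z|) @[n --> \oo] --> 0.
Proof.
rewrite /cvgLp => /fine_cvg fc.
suff -> : (fun n => intC (fun z => `|f_ n z - f z|)) =
  fine \o (fun n => 'N[leb_cube T]_(1%:E) [EFin \o (f_ n \- f)%R \_ C])%E by [].
by apply/funext => n; rewrite -(Lnorm1_leb_cube (f_ n \- f)).
Qed.

Lemma ae_leb_cube (Q : set (R3 R)) :
  {ae leb_cube T, forall z, Q z} -> {ae leb3, forall z, C z -> Q z}.
Proof.
move=> [A [mA A0 QA]]; exists (A `&` C); split.
- by apply: measurableI => //; exact: measurable_cube.
- exact: A0.
- by move=> z /= /not_implyP[Cz nQ]; split => //; exact: QA.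
Qed.

End leb_cube_integrals.

Section rate_distance.
Context {R : realType}.

(** The delicate term is p |r - gr|, a product of an unbounded rate and an L^1-small error. Up to
    the level M the rate is replaced by M, and beyond it |r - gr| <= K is used, which leaves the
    excess of p + q over M. The factor K^2 comes from 1/gr - 1/r = (r - gr) / (r gr). *)
Definition rate_err (K M p q pn qn r gr h gh : R) : R :=
  K * (`|pn - p| + `|qn - q|) + K ^+ 2 * M * `|r - gr| +
    K ^+ 3 * Num.max (p + q - M) 0 + `|h - gh|.

Lemma rate_dist (K M p q pn qn r gr h gh L : R) : 1 <= K -> 0 <= M -> 0 <= p -> 0 <= q ->
  0 < r <= K -> r^-1 <= K -> 0 < gr <= K -> gr^-1 <= K ->
  p * (r - 1) = L -> q * (r^-1 - 1) + h = L ->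
  `|pn * (gr - 1) - L| <= rate_err K M p q pn qn r gr h gh /\
  `|qn * (gr^-1 - 1) + gh - L| <= rate_err K M p q pn qn r gr h gh.
Proof.
move=> K1 M0 p0 q0 /andP[r0 rK] rVK /andP[gr0 grK] grVK L0 L1; rewrite /rate_err.
have K0 : 0 <= K by lra.
set t := Num.max (p + q - M) 0.
have t0 : 0 <= t by rewrite le_max lexx orbT.
have pqt : p + q <= M + t by rewrite -lerBlDl le_max lexx.
set d := `|r - gr|.
have d0 : 0 <= d by exact: normr_ge0.
have dK : d <= K by rewrite /d ler_norml; apply/andP; split; lra.
have K2 : 1 <= K ^+ 2 by rewrite expr2; nra.
have rV0 : 0 < r^-1 by rewrite invr_gt0.
have grV0 : 0 < gr^-1 by rewrite invr_gt0.
have gK : `|gr - 1| <= K by rewrite ler_norml; apply/andP; split; lra.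
have gVK : `|gr^-1 - 1| <= K by rewrite ler_norml; apply/andP; split; lra.
have key x : 0 <= x -> x <= p + q -> x * (K ^+ 2 * d) <= K ^+ 2 * M * d + K ^+ 3 * t.
  move=> x0 xpq; have -> : K ^+ 3 = K ^+ 2 * K by rewrite -exprSr.
  have h1 : x * d <= (M + t) * d by rewrite ler_wpM2r// (le_trans xpq).
  have h2 : t * d <= t * K by rewrite ler_wpM2l.
  have h3 : x * d <= M * d + t * K by lra.
  have -> : x * (K ^+ 2 * d) = K ^+ 2 * (x * d) by ring.
  have -> : K ^+ 2 * M * d + K ^+ 2 * K * t = K ^+ 2 * (M * d + t * K) by ring.
  by rewrite ler_wpM2l// exprn_ge0.
split.
- rewrite -L0 (_ : _ - _ = (pn - p) * (gr - 1) - p * (r - gr)); last by ring.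
  apply: (le_trans (ler_normB _ _)); rewrite !normrM (ger0_norm p0) -/d.
  have h1 : `|pn - p| * `|gr - 1| <= `|pn - p| * K by rewrite ler_wpM2l.
  have h2 := key p p0 (ltac:(lra)).
  have h3 : p * d <= p * (K ^+ 2 * d) by rewrite ler_wpM2l// ler_peMl.
  have h4 : 0 <= K * `|qn - q| by rewrite mulr_ge0.
  by have := normr_ge0 (h - gh); lra.
- rewrite -L1 (_ : _ - _ = (qn - q) * (gr^-1 - 1) + q * (gr^-1 - r^-1) - (h - gh)); last by ring.
  have dV : `|gr^-1 - r^-1| <= K ^+ 2 * d.
    have -> : gr^-1 - r^-1 = (r - gr) * (gr^-1 * r^-1) by field; rewrite !gt_eqF.
    rewrite normrM mulrC ler_wpM2r// ger0_norm ?mulr_ge0 ?(ltW rV0) ?(ltW grV0)//.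
    by rewrite expr2; apply: ler_pM => //; exact: ltW.
  apply: (le_trans (ler_normB _ _)).
  apply: le_trans (_ : `|(qn - q) * (gr^-1 - 1)| + `|q * (gr^-1 - r^-1)| + `|h - gh| <= _).
    by rewrite lerD2r ler_normD.
  rewrite !normrM (ger0_norm q0).
  have h1 : `|qn - q| * `|gr^-1 - 1| <= `|qn - q| * K by rewrite ler_wpM2l.
  have h2 := key q q0 (ltac:(lra)).
  have h3 : q * `|gr^-1 - r^-1| <= q * (K ^+ 2 * d) by rewrite ler_wpM2l.
  have h4 : 0 <= K * `|pn - p| by rewrite mulr_ge0.
  by lra.
Qed.

Lemma dist_min_max (x y L E : R) : `|x - L| <= E -> `|y - L| <= E ->
  L - E <= Num.min x y /\ Num.max x y <= L + E.
Proof.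
rewrite !ler_distl => /andP[x1 x2] /andP[y1 y2]; split.
  by rewrite le_min x1 y1.
by rewrite ge_max x2 y2.
Qed.

End rate_distance.

(** * The pressure *)

Lemma measurable_fun_sqrt d (U : measurableType d) (R : realType) (D : set U) (f : U -> R) :
  measurable_fun D f -> measurable_fun D (fun x => Num.sqrt (f x)).
Proof.
move=> mf.
have -> : (fun x => Num.sqrt (f x)) = (fun x => (@powR R ^~ 2^-1) (Num.max (f x) 0)).
  apply/funext => x; rewrite powR12_sqrt ?le_max ?lexx ?orbT//.
  by case: (leP (f x) 0) => // fx; rewrite sqrtr0 ler0_sqrtr.
apply: (@measurableT_comp _ _ _ _ _ _ (@powR R ^~ 2^-1)); first exact: measurable_powR.
exact: measurable_maxr.
Qed.

Lemma measurable_fun_inv d (U : measurableType d) (R : realType) (D : set U) (f : U -> R) :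
  (forall x, D x -> 0 < f x) -> measurable_fun D f -> measurable_fun D (fun x => (f x)^-1).
Proof.
move=> f0 mf; apply: (@eq_measurable_fun _ _ _ _ _ (fun x => (@powR R ^~ (-1)) (f x))).
  by move=> x /set_mem Dx; rewrite powR_inv1// ltW// f0.
by apply: (@measurableT_comp _ _ _ _ _ _ (@powR R ^~ (-1))) => //; exact: measurable_powR.
Qed.

Lemma Rintegral_expR_close d (Omega : measurableType d) (R : realType) (P : probability Omega R)
  (F G : Omega -> R) D r : measurable_fun setT F -> measurable_fun setT G ->
  (forall w, `|F w| <= D) -> (forall w, `|F w - G w| <= r) ->
  expR (- r) * \int[P]_w expR (G w) <= \int[P]_w expR (F w) <= expR r * \int[P]_w expR (G w).
Proof.
move=> mF mG FD FG.
have expI (f : Omega -> R) M : measurable_fun setT f -> (forall w, f w <= M) ->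
    P.-integrable setT (EFin \o (fun w => expR (f w))).
  move=> mf fM; apply: (@bounded_integrable _ _ _ _ _ _ (expR M)) => //.
  - by rewrite ltey_eq fin_num_measure.
  - by apply: measurableT_comp => //; exact: measurable_expR.
  - by move=> w _; rewrite ger0_norm ?expR_ge0// ler_expR.
have FI : P.-integrable setT (EFin \o (fun w => expR (F w))).
  by apply: (expI _ D) => // w; exact: le_trans (ler_norm _) (FD w).
have GI : P.-integrable setT (EFin \o (fun w => expR (G w))).
  apply: (expI _ (D + r)) => // w.
  by have := FD w; have := FG w; rewrite !ler_norml => /andP[u1 u2] /andP[v1 v2]; lra.
have cI k : P.-integrable setT (EFin \o (fun w => expR k * expR (G w))).
  rewrite (_ : _ \o _ = fun w => ((expR k)%:E * (expR (G w))%:E)%E)//.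
  exact: integrableZl.
rewrite -!(RintegralZl _ measurableT GI); apply/andP; split.
  apply: (le_Rintegral measurableT (cI _) FI) => w _; rewrite -expRD ler_expR.
  by have := FG w; rewrite ler_norml => /andP[u1 u2]; lra.
apply: (le_Rintegral measurableT FI (cI _)) => w _; rewrite -expRD ler_expR.
by have := FG w; rewrite ler_norml => /andP[u1 u2]; lra.
Qed.

Section excess.
Context {R : realType}.
Variables (T : R) (f : R3 R -> R).
Hypothesis T0 : 0 < T.
Local Notation C := (cube T).
Local Notation intC f := (\int[leb3]_(z in C) f z).
Hypotheses (fI : leb3.-integrable C (EFin \o f)) (f0 : forall z, C z -> 0 <= f z).

Let excess_le M z : 0 <= M -> C z -> `|Num.max (f z - M) 0| <= f z.
Proof.
by move=> M0 Cz; rewrite ger0_norm ?le_max ?lexx ?orbT// ge_max lerBlDr lerDl M0 f0.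
Qed.

Let measurable_excess M : measurable_fun C (fun z => Num.max (f z - M) 0).
Proof.
by apply: measurable_maxr => //; apply: measurable_funB => //; exact: integrableC_measurable.
Qed.

Lemma excess_integrable M : 0 <= M -> leb3.-integrable C (EFin \o (fun z => Num.max (f z - M) 0)).
Proof. by move=> M0; apply: (integrableC_le (g := f)) => // z Cz; exact: excess_le. Qed.

Lemma excess_small e : 0 < e -> exists2 M, 0 <= M & intC (fun z => Num.max (f z - M) 0) < e.
Proof.
move=> e0; pose F n z : R := Num.max (f z - n%:R) 0.
have [|||||_ _ cv] := @dominated_convergence _ _ _ leb3 C (measurable_cube T)
   (fun n => EFin \o F n) (EFin \o cst 0) (EFin \o f).
- by move=> n; apply/measurable_EFinP; exact: measurable_excess.
- exact/measurable_EFinP.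
- apply: aeW => z Cz; apply: cvg_EFin; first by near=> n.
  apply: cvg_near_cst; near=> n; rewrite /= /F max_r// subr_le0.
  by near: n; apply: nbhs_infty_ger.
- exact: fI.
- by apply: aeW => z n Cz; rewrite /= lee_fin excess_le.
have cv' : intC (F n) @[n --> \oo] --> intC (cst 0 : R3 R -> R).
  apply: fine_cvg; rewrite fineK//; apply: integrable_fin_num; first exact: measurable_cube.
  by apply: (cube_integrable T0 (M := 0)) => // z _; rewrite normr0.
rewrite Rintegral_cube_cst// mul0r in cv'.
move/cvgrPdist_lt: cv' => /(_ e e0)[n _ /(_ n (leqnn n))].
rewrite /= sub0r normrN => /(le_lt_trans (ler_norm _)) H.
by exists n%:R.
Unshelve. all: end_near. Qed.

End excess.

Section pressure_limit.
Context {R : realType} d (Omega : measurableType d) (P : probability Omega R).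
Variables (T c : R) (p q : R3 R -> R) (pn qn : forall n, 'I_n -> 'I_n -> R -> R) (a : nat -> R).
Variables (x0 : forall n, 'I_n -> 'I_n -> bool) (X : forall n, 'I_n -> 'I_n -> R -> Omega -> bool).
Hypotheses (T0 : 0 < T) (c0 : 0 < c).
Local Notation C := (cube T).
Local Notation intC f := (\int[leb3]_(z in C) f z).
Hypotheses (pI : leb3.-integrable C (EFin \o p)) (qI : leb3.-integrable C (EFin \o q)).
Hypotheses (pc : forall z, C z -> c <= p z) (qc : forall z, C z -> c <= q z).
Hypotheses (pcv : intC (fun z => `|step_kernel (@pn n) z - p z|) @[n --> \oo] --> 0)
  (qcv : intC (fun z => `|step_kernel (@qn n) z - q z|) @[n --> \oo] --> 0).
Hypotheses (mpn : forall n i j, measurable_fun `[0, T] (@pn n i j))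
  (mqn : forall n i j, measurable_fun `[0, T] (@qn n i j)).
Hypotheses (pn0 : forall n i j t, 0 <= t <= T -> 0 <= @pn n i j t)
  (qn0 : forall n i j t, 0 <= t <= T -> 0 <= @qn n i j t).
Hypotheses (pnB : \forall n \near \oo, forall i j, [bounded @pn n i j t | t in `[0, T]])
  (qnB : \forall n \near \oo, forall i j, [bounded @qn n i j t | t in `[0, T]]).
Hypotheses (a0 : forall n, (0 < n)%N -> 0 < a n) (aoo : a n @[n --> \oo] --> +oo).
Hypothesis hX : forall n (i j : 'I_n), markov_chain P T (@X n i j) (@x0 n i j)
  (fun t => a n * @pn n i j t) (fun t => a n * @qn n i j t).
Hypothesis hind : forall n, mutually_independent P
  (fun ij : 'I_n * 'I_n => past (@X n ij.1 ij.2) T).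

Definition Lam_int (h : R3 R -> R) : R := intC (fun z => Lam (h z) (p z) (q z)).

Lemma Lam_integrable (h : R3 R -> R) H : measurable_fun C h -> (forall z, C z -> `|h z| <= H) ->
  leb3.-integrable C (EFin \o (fun z => Lam (h z) (p z) (q z))).
Proof.
move=> mh hH.
have mp := integrableC_measurable pI; have mq := integrableC_measurable qI.
apply: (cube_integrable T0 (M := H)).
  apply: measurable_funM => //; apply: measurable_funD.
    by apply: measurable_funB => //; exact: measurable_funB.
  apply: measurable_fun_sqrt.
  apply: measurable_funD; last by apply: measurable_funM => //; exact: measurable_funM.
  by apply: measurable_funX; apply: measurable_funB => //; exact: measurable_funD.
move=> z Cz; apply: le_trans (hH z Cz); apply: Lam_le.
  exact: lt_le_trans (pc Cz).
exact: lt_le_trans (qc Cz).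
Qed.

Lemma common_bound n (b : 'I_n -> 'I_n -> R -> R) :
  (forall i j, [bounded b i j t | t in `[0, T]]) ->
  exists2 B, 0 <= B & forall i j t, 0 <= t <= T -> `|b i j t| <= B.
Proof.
move=> bb.
have H i j : exists B, forall t, 0 <= t <= T -> `|b i j t| <= B.
  have [M [_ HM]] := bb i j; exists (M + 1) => t tT; apply: HM; first by rewrite ltrDl.
  by rewrite /= in_itv.
exists (\sum_i \sum_j `|xget 0 [set B | forall t, 0 <= t <= T -> `|b i j t| <= B]|).
  by apply: sumr_ge0 => i _; apply: sumr_ge0.
move=> i j t tT; rewrite (bigD1 i)//= (bigD1 j)//=.
have := xgetPex 0 (H i j) => /(_ t tT) /le_trans; apply.
rewrite -addrA; apply: (le_trans (ler_norm _)); rewrite lerDl addr_ge0//.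
  by apply: sumr_ge0.
by apply: sumr_ge0 => k _; apply: sumr_ge0.
Qed.

Let rho n w : R3 R -> R := sample_kernel (@X n) w.

Lemma sample_kernel01 n w z : (0 < n)%N -> C z -> 0 <= rho n w z <= 1.
Proof.
move=> n0 Cz; have [i [j zij]] := cube_cell n0 Cz.
by rewrite /rho /sample_kernel (step_kernelE n0 _ zij); case: (X _ _ _ _); rewrite ?lexx ?ler01.
Qed.

Lemma measurable_sample_kernel n w : (0 < n)%N -> measurable_fun C (rho n w).
Proof.
by move=> n0; apply: measurable_step_kernel => i j; exact: (measurable_trajectory T0 (@hX n)).
Qed.

(* Measurability in [w] through the finitely many values of the path on a mesh. *)
Lemma measurable_pairing n (h : R3 R -> R) H : (0 < n)%N -> measurable_fun C h ->
  (forall z, C z -> `|h z| <= H) ->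
  measurable_fun setT (fun w => intC (fun z => h z * rho n w z)).
Proof.
move=> n0 mh hH.
pose tm (m l : nat) : R := 0 + l.+1%:R * (T / m.+1%:R).
pose J (m l : nat) := `[0 + l%:R * (T / m.+1%:R), (0 + l.+1%:R * (T / m.+1%:R))[%classic : set R.
(* The right-open cells of the mesh miss the time T; the last sample, which is taken at T, supplies
   the value there. *)
pose psi m (v : {ffun 'I_n * 'I_n * 'I_m.+1 -> bool}) : R3 R -> R :=
  step_kernel (fun i j t => \sum_(l < m.+1) (v (i, j, l))%:R * \1_(J m l) t +
    (v (i, j, ord_max))%:R * \1_[set T] t).
pose val (m : nat) (w : Omega) :=
  [ffun ijl : 'I_n * 'I_n * 'I_m.+1 => @X n ijl.1.1 ijl.1.2 (tm m (ijl.2 : nat)) w].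
have dm0 m : 0 < T / m.+1%:R by rewrite divr_gt0.
have tmT m l : (l < m.+1)%N -> 0 <= tm m l <= T.
  move=> lm; rewrite /tm add0r mulr_ge0 ?(ltW (dm0 m))//=.
  by rewrite mulrCA ler_piMr ?(ltW T0)// ler_pdivrMr// mul1r ler_nat.
have tmax m : tm m m = T by rewrite /tm add0r mulrCA mulfV ?mulr1.
have mtr i j w : measurable_fun `[0, T] (fun t => (@X n i j t w)%:R : R).
  exact: (measurable_trajectory T0 (@hX n)).
have valE m i j t w : 0 <= t <= T ->
    \sum_(l < m.+1) (val m w (i, j, l))%:R * \1_(J m l) t + (val m w (i, j, ord_max))%:R * \1_[set T] t =
    if t == T then (@X n i j T w)%:R else rstep (fun t => @X n i j t w) 0 T m t.
  move=> /andP[t0 tT].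
  have -> : \sum_(l < m.+1) (val m w (i, j, l))%:R * \1_(J m l) t =
      rstep (fun t => @X n i j t w) 0 T m t.
    by apply: eq_bigr => l _; rewrite ffunE.
  case: eqP => [->|tneT]; last by rewrite indicE memNset ?mulr0 ?addr0.
  rewrite indicE mem_set// mulr1 ffunE/= tmax.
  rewrite /rstep big1 ?add0r// => l _; rewrite indicE memNset ?mulr0// /= in_itv/= => /andP[_].
  by rewrite ltNge; have /andP[_ ->] := tmT m l (ltn_ord l).
have val01 m i j t w : 0 <= t <= T ->
   `|\sum_(l < m.+1) (val m w (i, j, l))%:R * \1_(J m l) t + (val m w (i, j, ord_max))%:R * \1_[set T] t| <= 1 :> R.
  move=> /[dup] tT /andP[t0 t1]; rewrite valE//; case: eqP => [_|/eqP tneT].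
    by case: (X _ _ _ _); rewrite ?normr1 ?normr0.
  have tt : 0 <= t < 0 + T by rewrite t0 add0r lt_neqAle tneT.
  have [u _ ->] := rstep_ex (fun t => @X n i j t w) T0 m tt.
  by case: (X _ _ _ _); rewrite ?normr1 ?normr0.
have mpsi m v : measurable_fun C (psi m v).
  apply: measurable_step_kernel => i j; apply: measurable_funD.
    apply: measurable_sum => l; apply: measurable_funM => //.
    by apply: measurable_indic; exact: measurable_itv.
  by apply: measurable_funM => //; exact: measurable_indic.
have psi1 m w z : C z -> `|psi m (val m w) z| <= 1.
  move=> Cz; have [i [j zij]] := cube_cell n0 Cz; rewrite /psi (step_kernelE n0 _ zij).
  by apply: val01; case: Cz => _; rewrite /= in_itv.
apply: (@measurable_fun_cvg _ _ _ _ (fun m w => intC (fun z => h z * psi m (val m w) z))).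
  move=> m.
  pose E (v : {ffun 'I_n * 'I_n * 'I_m.+1 -> bool}) := [set w | val m w = v].
  have mE v : measurable (E v).
    have -> : E v = \bigcap_(ijl in [set: 'I_n * 'I_n * 'I_m.+1])
        (@X n ijl.1.1 ijl.1.2 (tm m ijl.2) @^-1` [set v ijl]).
      apply/seteqP; split => [w /= <- ijl _ /=|w wE /=]; first by rewrite ffunE.
      by apply/ffunP => ijl; rewrite ffunE; exact: wE.
    apply: fin_bigcap_measurable; first exact: finite_finset.
    move=> ijl _; rewrite -[_ @^-1` _]setTI.
    by apply: (chain_measurable (hX ijl.1.1 ijl.1.2)) => //; exact: tmT.
  have -> : (fun w => intC (fun z => h z * psi m (val m w) z)) =
     fun w => \sum_v intC (fun z => h z * psi m v z) * \1_(E v) w.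
    apply/funext => w; rewrite (bigD1 (val m w))//= indicE mem_set// mulr1 big1 ?addr0// => v /eqP vn.
    by rewrite indicE memNset ?mulr0// => Ev; apply: vn.
  by apply: measurable_sum => v; apply: measurable_funM => //; exact: measurable_indic.
move=> w _.
apply: (@bounded_dominated _ _ _ leb3 C H (fun m z => h z * psi m (val m w) z)
  (fun z => h z * rho n w z) (measurable_cube T) (leb3_cube_oo T0) _ _ _).2.
- by move=> m; exact: measurable_funM.
- by move=> m z Cz; rewrite normrM -[leRHS]mulr1; apply: ler_pM => //; [exact: hH|exact: psi1].
- move=> z Cz; apply: cvgM; first exact: cvg_cst.
  have [i [j zij]] := cube_cell n0 Cz.
  have /andP[t0 t1] : 0 <= z.2 <= T by case: Cz => _; rewrite /= in_itv.
  rewrite /rho /sample_kernel (step_kernelE n0 _ zij).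
  under eq_fun do rewrite /psi (step_kernelE n0 _ zij) valE ?t0//.
  case: eqP => [->|/eqP tneT]; first exact: cvg_cst.
  have tt : 0 <= z.2 < 0 + T by rewrite t0 add0r lt_neqAle tneT.
  apply: (rstep_cvg T0 tt); apply: (near_right_state (@hX n)).
  by move: tt; rewrite add0r.
Qed.

Theorem pressure_limit (h : R3 R -> R) H e : measurable_fun C h ->
  (forall z, C z -> `|h z| <= H) -> 0 < e -> \forall n \near \oo,
  expR (a n * n%:R ^+ 2 * (Lam_int h - e)) <=
  \int[P]_w expR (a n * n%:R ^+ 2 * intC (fun z => h z * rho n w z)) <=
  expR (a n * n%:R ^+ 2 * (Lam_int h + e)).
Proof.
have sum5 (y x1 x2 x3 x4 x5 : R) : x1 <= y / 2 -> x2 <= y / 2 -> x3 <= y -> x4 <= y -> x5 <= y ->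
    x1 + x2 + x3 + x4 + x5 <= 4 * y by lra.
move=> mh hH' e0.
wlog H0 : H hH' / 0 < H.
  move=> W; apply: (W (`|H| + 1)); last by rewrite ltr_pwDr.
  by move=> z /hH' /le_trans; apply; apply: (le_trans (ler_norm _)); rewrite lerDl.
have hH z : C z -> - H <= h z <= H by move=> /hH'; rewrite ler_norml.
pose K := 1 + 2 * H / c.
have K1 : 1 < K by rewrite ltrDl divr_gt0 ?mulr_gt0.
have K0 : 0 < K by lra.
have p0 z : C z -> 0 < p z by move=> /pc; apply: lt_le_trans.
have q0 z : C z -> 0 < q z by move=> /qc; apply: lt_le_trans.
pose r z := eigr (h z) (p z) (q z).
have rb z : C z -> K^-1 <= r z <= K by move=> Cz; apply: eigr_bounds => //; [exact: pc|exact: qc|exact: hH'].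
have mp := integrableC_measurable pI; have mq := integrableC_measurable qI.
have Li := Lam_integrable mh hH'.
have mr : measurable_fun C r.
  apply: measurable_funD => //; apply: measurable_funM; first exact: integrableC_measurable.
  exact: measurable_fun_inv.
(* Four parts for the L^1 error of the growth rates, one for replacing h by its grid version and one
   for the factor K^(2 N n^2). *)
pose e6 := e / 6.
have e60 : 0 < e6 by rewrite divr_gt0.
have pqI := integrableCD pI qI.
have pq0 z : C z -> 0 <= p z + q z by move=> Cz; rewrite addr_ge0// ltW// ?p0 ?q0.
have [M M0 tailM] := excess_small T0 pqI pq0 (divr_gt0 e60 (exprn_gt0 3 K0)).
have VK : K^-1 < K.
  by apply: (lt_trans _ K1); rewrite invf_lt1.
have HH : - H < H by move: H0; lra.
(* M + 1 instead of M, since M may be 0. *)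
have er0 : 0 < e6 / (K ^+ 2 * (M + 1)) by rewrite divr_gt0// mulr_gt0 ?exprn_gt0// ltr_pwDr.
have [N1 approx_r] := approximable_bounded T0 VK mr rb er0.
have [N2 approx_h] := approximable_bounded T0 HH mh hH e60.
pose N := (maxn N1 N2).+1.
have lnK_ge0 : 0 <= ln K by rewrite ln_ge0// ltW.
(* N and K no longer change: this threshold is exactly K^(2 N n^2) <= exp(a n^2 e6) after taking
   logarithms and dividing by n^2. *)
have aN : \forall n \near \oo, 2 * N%:R * ln K / e6 < a n.
  by move/cvgryPgt : aoo; apply.
near=> n.
have nN : (maxn N1 N2 < n)%N by near: n; exact: nbhs_infty_gt.
have n0 : (0 < n)%N by apply: leq_ltn_trans nN.
move: (nN); rewrite gtn_max => /andP[nN1 nN2].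
have [gr grb gre] := approx_r n N nN1 (ltac:(by rewrite ltnS leq_maxl)).
have [gh ghb ghe] := approx_h n N nN2 (ltac:(by rewrite ltnS leq_maxr)).
have an0 := a0 n0.
pose b := a n * n%:R ^+ 2.
have b0 : 0 < b by rewrite mulr_gt0// exprn_gt0// ltr0n.
have pb : forall i j, [bounded @pn n i j t | t in `[0, T]] by near: n; exact: pnB.
have qb : forall i j, [bounded @qn n i j t | t in `[0, T]] by near: n; exact: qnB.
have [B1 B10 pB1] := common_bound pb.
have [B2 B20 qB2] := common_bound qb.
pose B := B1 + B2.
have B0 : 0 <= B by rewrite addr_ge0.
have lpB i j t : 0 <= t <= T -> 0 <= @pn n i j t <= B.
  move=> tT; rewrite pn0//= (le_trans (ler_norm _))// (le_trans (pB1 i j t tT))// lerDl//.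
have lmB i j t : 0 <= t <= T -> 0 <= @qn n i j t <= B.
  move=> tT; rewrite qn0//= (le_trans (ler_norm _))// (le_trans (qB2 i j t tT))// lerDr//.
have grK i j k : 0 < gr i j k <= K.
  by case/andP: (grb i j k) => g1 ->; rewrite andbT (lt_le_trans _ g1)// invr_gt0.
have grVK i j k : (gr i j k)^-1 <= K.
  case/andP: (grb i j k) => g1 _; rewrite -[leRHS]invrK lef_pV2 ?posrE ?invr_gt0//.
  by case/andP: (grK i j k).
have ghH i j k : `|gh i j k| <= H by rewrite ler_norml.
have N0 : (0 < N)%N by [].
have := pressure_bounds T0 n0 an0 B0 (@hX n) (@hind n) (@mpn n) (@mqn n) lpB lmB N0
  (ltW K1) grK grVK ghH.
set g0 := grate0 _ _ _ _; set g1 := grate1 _ _ _ _ _; set gp := gpair _ _ _ _ _.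
rewrite -/b.
pose E z := rate_err K M (p z) (q z) (step_kernel (@pn n) z) (step_kernel (@qn n) z)
  (r z) (gridf T N gr z) (h z) (gridf T N gh z).
have gE z : C z -> `|g0 z - Lam (h z) (p z) (q z)| <= E z /\ `|g1 z - Lam (h z) (p z) (q z)| <= E z.
  move=> Cz; have [i [j [k kN [_ _ gE]]]] := gridf_ex T0 n0 N0 Cz.
  have /andP[r1 r2] := rb z Cz.
  have rz0 : 0 < r z by apply: lt_le_trans r1; rewrite invr_gt0.
  rewrite /g0 /g1 /grate0 /grate1 /E !gE; apply: rate_dist => //.
  - exact: ltW.
  - exact/ltW/p0.
  - exact/ltW/q0.
  - by rewrite rz0.
  - by rewrite -[leRHS]invrK lef_pV2 ?posrE ?invr_gt0.
  - by rewrite eigr0// p0.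
  - by rewrite eigr1// ?p0 ?q0.
have pnI : leb3.-integrable C (EFin \o step_kernel (@pn n)).
  apply: (cube_integrable T0 (M := B)); first exact: measurable_step_kernel.
  by apply: step_kernel_bound => // i j t tT; case/andP: (lpB i j t tT) => l0 lb; rewrite ger0_norm.
have qnI : leb3.-integrable C (EFin \o step_kernel (@qn n)).
  apply: (cube_integrable T0 (M := B)); first exact: measurable_step_kernel.
  by apply: step_kernel_bound => // i j t tT; case/andP: (lmB i j t tT) => l0 lb; rewrite ger0_norm.
have distI (f g : R3 R -> R) : leb3.-integrable C (EFin \o f) -> leb3.-integrable C (EFin \o g) ->
    leb3.-integrable C (EFin \o (fun z => `|f z - g z|)).
  move=> fi gi; have mf := integrableC_measurable fi; have mg := integrableC_measurable gi.
  apply: (integrableC_le (g := fun z => `|f z| + `|g z|)).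
  - by apply: measurableT_comp => //; exact: measurable_funB.
  - by move=> z _; rewrite normr_id ler_normB.
  - have := integrable_norm fi; have := integrable_norm gi.
    by move=> gi' fi'; exact: integrableCD.
have hI : leb3.-integrable C (EFin \o h) by exact: (cube_integrable T0 mh hH').
have rI : leb3.-integrable C (EFin \o r).
  apply: (cube_integrable T0 mr (M := K)) => z Cz; case/andP: (rb z Cz) => r1 r2.
  by rewrite ger0_norm// (le_trans _ r1)// invr_ge0 ltW.
have grI : leb3.-integrable C (EFin \o gridf T N gr).
  apply: (cube_integrable T0 (measurable_gridf N gr) (M := K)) => z Cz.
  have /andP[r1 r2] := gridf_itv T0 n0 N0 grb Cz.
  by rewrite ger0_norm// (le_trans _ r1)// invr_ge0 ltW.
have ghI : leb3.-integrable C (EFin \o gridf T N gh).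
  apply: (cube_integrable T0 (measurable_gridf N gh) (M := H)) => z Cz.
  by have := gridf_itv T0 n0 N0 ghb Cz; rewrite ler_norml.
have tI : leb3.-integrable C (EFin \o (fun z => Num.max (p z + q z - M) 0)).
  exact: (excess_integrable pqI pq0 M0).
have I1 := integrableCZ K (integrableCD (distI _ _ pnI pI) (distI _ _ qnI qI)).
have I2 := integrableCZ (K ^+ 2 * M) (distI _ _ rI grI).
have I3 := integrableCZ (K ^+ 3) tI.
have I4 := distI _ _ hI ghI.
have I12 := integrableCD I1 I2.
have I123 := integrableCD I12 I3.
have EI : leb3.-integrable C (EFin \o E) by exact: (integrableCD I123 I4).
have EE : intC E = K * (intC (fun z => `|step_kernel (@pn n) z - p z|) + intC (fun z => `|step_kernel (@qn n) z - q z|))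
    + K ^+ 2 * M * intC (fun z => `|r z - gridf T N gr z|) + K ^+ 3 * intC (fun z => Num.max (p z + q z - M) 0)
    + intC (fun z => `|h z - gridf T N gh z|).
  transitivity (intC (fun z => K * (`|step_kernel (@pn n) z - p z| + `|step_kernel (@qn n) z - q z|)
    + K ^+ 2 * M * `|r z - gridf T N gr z| + K ^+ 3 * Num.max (p z + q z - M) 0 + `|h z - gridf T N gh z|)).
    by [].
  rewrite (intCD I123 I4) (intCD I12 I3) (intCD I1 I2) !intCZ ?intCD//; try exact: distI.
  by apply: integrableCD; exact: distI.
have E4 : intC E <= 4 * e6.
  have s1 : K * intC (fun z => `|step_kernel (@pn n) z - p z|) <= e6 / 2.
    rewrite -ler_pdivlMl//; apply: ltW; apply: (le_lt_trans (ler_norm _)).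
    rewrite -normrN -sub0r; near: n.
    by move/cvgrPdist_lt : (pcv); apply; rewrite mulr_gt0 ?invr_gt0// divr_gt0.
  have s2 : K * intC (fun z => `|step_kernel (@qn n) z - q z|) <= e6 / 2.
    rewrite -ler_pdivlMl//; apply: ltW; apply: (le_lt_trans (ler_norm _)).
    rewrite -normrN -sub0r; near: n.
    by move/cvgrPdist_lt : (qcv); apply; rewrite mulr_gt0 ?invr_gt0// divr_gt0.
  have s3 : K ^+ 2 * M * intC (fun z => `|r z - gridf T N gr z|) <= e6.
    apply: le_trans (_ : K ^+ 2 * (M + 1) * intC (fun z => `|r z - gridf T N gr z|) <= _).
      by rewrite ler_wpM2r ?Rintegral_ge0// ler_wpM2l ?exprn_ge0 ?(ltW K0)// lerDl.
    have KM0 : 0 < K ^+ 2 * (M + 1) by rewrite mulr_gt0 ?exprn_gt0// ltr_pwDr.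
    by rewrite mulrC -ler_pdivlMr// ltW.
  have s4 : K ^+ 3 * intC (fun z => Num.max (p z + q z - M) 0) <= e6.
    by rewrite mulrC -ler_pdivlMr ?exprn_gt0// ltW.
  by rewrite EE mulrDr; apply: sum5 s1 s2 s3 s4 (ltW ghe).
have mg0 : measurable_fun C g0.
  apply: measurable_funM; first exact: integrableC_measurable.
  by apply: measurable_funB => //; exact: measurable_gridf.
have mg1 : measurable_fun C g1.
  apply: measurable_funD; last exact: measurable_gridf.
  apply: measurable_funM; first exact: integrableC_measurable.
  apply: measurable_funB => //; apply: measurable_fun_inv; last exact: measurable_gridf.
  by move=> z Cz; have [i [j [k kN [_ _ ->]]]] := gridf_ex T0 n0 N0 Cz; case/andP: (grK i j k).
have LEI := integrableCD Li EI.
have opI (op : R -> R -> R) : measurable_fun C (fun z => op (g0 z) (g1 z)) ->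
   (forall x y L D, `|x - L| <= D -> `|y - L| <= D -> `|op x y - L| <= D) ->
   leb3.-integrable C (EFin \o (fun z => op (g0 z) (g1 z))).
  move=> mop opd; apply: (integrableC_le (g := fun z => `|Lam (h z) (p z) (q z)| + E z)) => //.
    move=> z Cz; have [d0 d1] := gE z Cz.
    rewrite -[op _ _](subrK (Lam (h z) (p z) (q z))) addrC.
    by apply: (le_trans (ler_normD _ _)); rewrite lerD2l; exact: opd.
  by apply: integrableCD => //; exact: integrable_norm Li.
have minI : leb3.-integrable C (EFin \o (fun z => Num.min (g0 z) (g1 z))).
  apply: opI; first exact: measurable_minr.
  by move=> x y L D; case: (leP x y).
have maxI : leb3.-integrable C (EFin \o (fun z => Num.max (g0 z) (g1 z))).
  apply: opI; first exact: measurable_maxr.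
  by move=> x y L D; case: (leP x y).
have maxle : intC (fun z => Num.max (g0 z) (g1 z)) <= Lam_int h + 4 * e6.
  apply: le_trans (_ : Lam_int h + intC E <= _); last by rewrite lerD2l.
  rewrite /Lam_int -intCD//; apply: intC_le => // z Cz.
  by have [d0 d1] := gE z Cz; have [] := dist_min_max d0 d1.
have minge : Lam_int h - 4 * e6 <= intC (fun z => Num.min (g0 z) (g1 z)).
  rewrite lerBlDr; apply: le_trans (_ : intC (fun z => Num.min (g0 z) (g1 z)) + intC E <= _).
    rewrite /Lam_int -intCD//; apply: intC_le => //; first exact: integrableCD.
    by move=> z Cz; have [d0 d1] := gE z Cz; have [+ _] := dist_min_max d0 d1; rewrite lerBlDr.
  by rewrite lerD2l.
pose F w := b * intC (fun z => h z * rho n w z).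
have mF : measurable_fun setT F.
  by apply: measurable_funM => //; exact: (measurable_pairing n0 mh hH').
have [mgp _] := gpair_limit T0 n0 an0 (@hX n) N0 ghH.
have Fgp w : `|F w - gp w| <= b * e6.
  rewrite /F /gp /gpair -/b -mulrBr normrM (gtr0_norm b0) ler_pM2l//.
  have mrho := measurable_sample_kernel w n0.
  have prodI (f : R3 R -> R) D : measurable_fun C f -> (forall z, C z -> `|f z| <= D) ->
      leb3.-integrable C (EFin \o (fun z => f z * rho n w z)).
    move=> mf fD; apply: (cube_integrable T0 (M := D)); first exact: measurable_funM.
    move=> z Cz; case/andP: (sample_kernel01 w n0 Cz) => s0 s1.
    rewrite normrM (ger0_norm s0) -[leRHS]mulr1; apply: ler_pM => //; exact: fD.
  have ghH' z : C z -> `|gridf T N gh z| <= H.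
    by move=> Cz; have := gridf_itv T0 n0 N0 ghb Cz; rewrite ler_norml.
  rewrite -RintegralB; last 3 first.
  - exact: measurable_cube.
  - exact: (prodI _ H mh hH').
  - by apply: (prodI _ H _ ghH'); exact: measurable_gridf.
  have dI : leb3.-integrable C (EFin \o (fun z => h z * rho n w z - gridf T N gh z * rho n w z)).
    rewrite (_ : _ \o _ = fun z => ((h z * rho n w z)%:E - (gridf T N gh z * rho n w z)%:E)%E)//.
    apply: integrableB; [exact: measurable_cube|exact: (prodI _ H mh hH')|].
    by apply: (prodI _ H _ ghH'); exact: measurable_gridf.
  apply: (le_trans (le_normr_Rintegral (measurable_cube T) dI)).
  apply: le_trans (ltW ghe); apply: intC_le => //.
    exact: integrable_norm dI.
  move=> z Cz; rewrite -mulrBl normrM; case/andP: (sample_kernel01 w n0 Cz) => s0 s1.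
  by rewrite (ger0_norm s0) ler_piMr.
have KE : K ^+ (2 * N * n ^ 2) <= expR (b * e6).
  rewrite -[K in K ^+ _](lnK (K0 : K \is Num.pos)) -expRM_natl ler_expR /b.
  have -> : (2 * N * n ^ 2)%:R * ln K = (2 * N%:R * ln K) * n%:R ^+ 2 by rewrite !natrM; ring.
  have -> : a n * n%:R ^+ 2 * e6 = (a n * e6) * n%:R ^+ 2 by ring.
  rewrite ler_wpM2r ?exprn_ge0// -ler_pdivrMr//.
  by apply: ltW; near: n; exact: aN.
have KX0 : 0 < K ^+ (2 * N * n ^ 2) by rewrite exprn_gt0.
move=> /andP[lowgp upgp].
have Fb w : `|F w| <= b * (H * T).
  rewrite /F normrM (gtr0_norm b0) ler_pM2l//.
  have hI' : leb3.-integrable C (EFin \o (fun z => h z * rho n w z)).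
    apply: (cube_integrable T0 (M := H)).
      by apply: measurable_funM => //; exact: measurable_sample_kernel.
    move=> z Cz; case/andP: (sample_kernel01 w n0 Cz) => s0 s1.
    by rewrite normrM (ger0_norm s0) -[leRHS]mulr1; apply: ler_pM => //; exact: hH'.
  apply: (le_trans (le_normr_Rintegral (measurable_cube T) hI')).
  rewrite -(Rintegral_cube_cst T0); apply: intC_le.
  - exact: integrable_norm hI'.
  - by apply: (cube_integrable T0 (M := H)) => // z _; rewrite gtr0_norm.
  - move=> z Cz; case/andP: (sample_kernel01 w n0 Cz) => s0 s1.
    by rewrite normrM (ger0_norm s0) -[leRHS]mulr1; apply: ler_pM => //; exact: hH'.
have /andP[FG1 FG2] := Rintegral_expR_close P mF mgp Fb Fgp.
apply/andP; split.
- apply: le_trans FG1.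
  apply: le_trans (_ : expR (- (b * e6)) * (expR (- (b * e6)) * expR (b * (Lam_int h - 4 * e6))) <= _).
    rewrite -!expRD ler_expR -/b; have -> : e = 6 * e6 by rewrite /e6; field.
    rewrite le_eqVlt; apply/orP; left; apply/eqP; ring.
  rewrite ler_pM2l ?expR_gt0//; apply: le_trans lowgp.
  apply: ler_pM; rewrite ?expR_ge0//.
    by rewrite expRN lef_pV2 ?posrE ?expR_gt0.
  by rewrite ler_expR ler_pM2l.
- apply: (le_trans FG2).
  apply: le_trans (_ : expR (b * e6) * (expR (b * e6) * expR (b * (Lam_int h + 4 * e6))) <= _).
    rewrite ler_pM2l ?expR_gt0//; apply: (le_trans upgp).
    apply: ler_pM; rewrite ?expR_ge0 ?(ltW KX0)//.
    by rewrite ler_expR ler_pM2l.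
  rewrite -!expRD ler_expR -/b; have -> : e = 6 * e6 by rewrite /e6; field.
  rewrite le_eqVlt; apply/orP; left; apply/eqP; ring.
Unshelve. all: end_near. Qed.

End pressure_limit.

(** * The weak topology of W0 *)

Lemma cvg_initial (S : choiceType) (V : topologicalType) (f : S -> V) (F : set_system S) (s : S) :
  Filter F -> f @ F --> f s -> F --> (s : initial_topology f).
Proof.
move=> FF cF A; rewrite nbhsE => -[_ [[B oB <-] Bs] BA].
by apply: (filterS BA); apply: cF; exact: open_nbhs_nbhs.
Qed.

Section weak_topology.
Context {R : realType}.
Variable T : R.
Hypothesis T0 : 0 < T.
Local Notation C := (cube T).
Local Notation intC f := (\int[leb3]_(z in C) f z).

(** A representative with values in [0, 1] at every point, so that pointwise inequalities can be
    integrated without exceptional sets. *)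
Definition W0_clip (phi : W0 T) (z : R3 R) : R := Num.min 1 (Num.max 0 (phi z)).

Lemma W0_clip01 (phi : W0 T) z : 0 <= W0_clip phi z <= 1.
Proof. by rewrite /W0_clip le_min ler01 le_max lexx ge_min lexx. Qed.

Lemma measurable_W0_fun (phi : W0 T) : measurable_fun setT (phi : R3 R -> R).
Proof. exact: (@measurable_funPT _ _ _ _ (repr (val phi))). Qed.

Lemma measurable_W0_clip (phi : W0 T) : measurable_fun C (W0_clip phi).
Proof.
apply: measurable_funTS; apply: measurable_minr => //; apply: measurable_maxr => //.
exact: measurable_W0_fun.
Qed.

Lemma W0_clipE (phi : W0 T) : {ae leb3, forall z, C z -> phi z = W0_clip phi z}.
Proof.
apply: ae_leb_cube; have /asboolP := valP phi.
by apply: filterS => z /andP[p0 p1]; rewrite /W0_clip max_r// min_r.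
Qed.

Definition W0_pair (h : R3 R -> R) (phi : W0 T) : R := intC (fun z => h z * W0_clip phi z).

Lemma eq_ae_intC (f g : R3 R -> R) : measurable_fun C f -> measurable_fun C g ->
  {ae leb3, forall z, C z -> f z = g z} -> intC f = intC g.
Proof.
move=> mf mg fg; congr fine; apply: ae_eq_integral.
- exact: measurable_cube.
- exact/measurable_EFinP.
- exact/measurable_EFinP.
- by apply: filterS fg => z fg /fg ->.
Qed.

Lemma W0_pairingE (phi : W0 T) (g : LfunType (leb_cube T) (lee1n 2)) :
  W0_pairing phi g = W0_pair g phi.
Proof.
have mg : measurable_fun C (g : R3 R -> R) by apply: measurable_funTS; exact: measurable_funPT.
apply: eq_ae_intC.
- by apply: measurable_funM => //; apply: measurable_funTS; exact: measurable_W0_fun.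
- by apply: measurable_funM => //; exact: measurable_W0_clip.
- by apply: filterS (W0_clipE phi) => z H /H ->; rewrite mulrC.
Qed.

Definition bounded_kernel (h : R3 R -> R) :=
  measurable_fun C h /\ exists H, forall z, C z -> `|h z| <= H.

Lemma leb_cube_oo : (leb_cube T setT < +oo)%E.
Proof. by rewrite /leb_cube/= /mrestr setTI; exact: leb3_cube_oo. Qed.

Lemma bounded_kernel_Lfun h : bounded_kernel h -> h \_ C \in Lfun (leb_cube T) 2%:E.
Proof.
move=> [mh [H hH]].
have mhC : measurable_fun setT (h \_ C) by apply/(measurable_restrictT _ (measurable_cube T)).
rewrite inE; apply/andP; split; rewrite inE//=.
rewrite /finite_norm unlock poweR_lty//.
apply: le_lt_trans (_ : \int[leb_cube T]_z (`|H| `^ 2)%:E < _)%E.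
  apply: ge0_le_integral => //.
  - by move=> z _; rewrite lee_fin powR_ge0.
  - rewrite (_ : (fun z => _) = EFin \o (fun z => `|(h \_ C) z| `^ 2))//.
    apply/measurable_EFinP.
    have mn : measurable_fun setT (fun z => `|(h \_ C) z|) by exact: measurableT_comp.
    exact: (measurableT_comp (measurable_powR _) mn).
  - move=> z _; rewrite lee_fin ge0_ler_powR ?nnegrE//.
    rewrite patchE; case: ifPn => [/set_mem Cz|_]; last by rewrite normr0.
    exact: le_trans (hH z Cz) (ler_norm _).
by rewrite integral_cst// lte_mul_pinfty ?lee_fin ?powR_ge0// leb_cube_oo.
Qed.

Lemma W0_pairing_continuous g : continuous (fun phi : W0 T => W0_pairing phi g).
Proof.
move=> phi; apply: (@continuous_comp _ _ _ (@W0_pairing R T) (fun f => f g)).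
  exact: (@initial_continuous (W0 T) _ (@W0_pairing R T)).
have /cvg_sup/(_ g) cv := @cvg_id _ (nbhs (W0_pairing phi)).
move=> A /(@initial_continuous _ R (fun f : LfunType (leb_cube T) (lee1n 2) -> R => f g)) /cv.
by [].
Qed.

Lemma W0_pair_continuous h : bounded_kernel h -> continuous (W0_pair h).
Proof.
move=> /[dup] -[mh _] /bounded_kernel_Lfun hL.
suff -> : W0_pair h = fun phi => W0_pairing phi (Lfun_Sub (lee1n 2) hL).
  exact: W0_pairing_continuous.
apply/funext => phi; rewrite W0_pairingE.
apply: eq_Rintegral => z Cz.
by rewrite /= patchE Cz.
Qed.

Lemma W0_pair_integrable (g : R3 R -> R) (psi : W0 T) : leb3.-integrable C (EFin \o g) ->
  leb3.-integrable C (EFin \o (fun z => g z * W0_clip psi z)).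
Proof.
move=> gI; have mg := integrableC_measurable gI.
apply: (integrableC_le (g := fun z => `|g z|)).
- by apply: measurable_funM => //; exact: measurable_W0_clip.
- move=> z _; have /andP[c0 c1] := W0_clip01 psi z.
  by rewrite normrM (ger0_norm c0) ler_piMr.
- exact: integrable_norm gI.
Qed.

Lemma intC_norm_le (f g : R3 R -> R) : measurable_fun C f -> leb3.-integrable C (EFin \o g) ->
  (forall z, C z -> `|f z| <= g z) -> `|intC f| <= intC g.
Proof.
move=> mf gI fg.
have fI : leb3.-integrable C (EFin \o f) by exact: integrableC_le gI.
apply: (le_trans (le_normr_Rintegral (measurable_cube T) fI)).
by apply: intC_le => //; exact: integrable_norm fI.
Qed.

Lemma intCB (f g : R3 R -> R) : leb3.-integrable C (EFin \o f) -> leb3.-integrable C (EFin \o g) ->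
  intC (fun z => f z - g z) = intC f - intC g.
Proof. by move=> fI gI; rewrite RintegralB//; exact: measurable_cube. Qed.

Lemma integrableCB (f g : R3 R -> R) : leb3.-integrable C (EFin \o f) ->
  leb3.-integrable C (EFin \o g) -> leb3.-integrable C (EFin \o (fun z => f z - g z)).
Proof.
move=> fI gI; rewrite (_ : _ \o _ = fun z => ((f z)%:E - (g z)%:E)%E)//.
by apply: integrableB => //; exact: measurable_cube.
Qed.

Lemma W0_pair_dist (g g' : R3 R -> R) (psi : W0 T) : leb3.-integrable C (EFin \o g) ->
  leb3.-integrable C (EFin \o g') ->
  `|W0_pair g psi - W0_pair g' psi| <= intC (fun z => `|g z - g' z|).
Proof.
move=> gI g'I; rewrite /W0_pair -intCB; [|exact: W0_pair_integrable..].
apply: intC_norm_le.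
- by apply: integrableC_measurable; apply: integrableCB; exact: W0_pair_integrable.
- exact: integrable_norm (integrableCB gI g'I).
- move=> z _; have /andP[c0 c1] := W0_clip01 psi z.
  by rewrite -mulrBl normrM (ger0_norm c0) ler_piMr.
Qed.

Lemma bounded_kernel_integrable h : bounded_kernel h -> leb3.-integrable C (EFin \o h).
Proof. by move=> [mh [H hH]]; exact: (cube_integrable T0 mh hH). Qed.

Lemma bounded_kernel_approx (g : R3 R -> R) e : leb3.-integrable C (EFin \o g) -> 0 < e ->
  exists2 h, bounded_kernel h & intC (fun z => `|g z - h z|) < e.
Proof.
move=> gI e0; have mg := integrableC_measurable gI.
have gI' : leb3.-integrable C (EFin \o (fun z => `|g z|)) by exact: integrable_norm gI.
have g0 z : C z -> 0 <= `|g z| by [].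
have [M M0 tM] := excess_small T0 gI' g0 e0.
exists (fun z => Num.max (- M) (Num.min M (g z))).
  split.
    by apply: measurable_maxr => //; exact: measurable_minr.
  exists M => z _; rewrite ler_norml le_max lexx/= ge_max ge_min lexx andbT.
  by move: M0; lra.
apply: le_lt_trans tM; apply: le_trans (ler_norm _) _; apply: intC_norm_le.
- by apply: measurableT_comp => //; apply: measurable_funB => //; apply: measurable_maxr => //;
    exact: measurable_minr.
- exact: (excess_integrable gI' g0 M0).
- move=> z _; rewrite normr_id.
  case: (leP M (g z)) => Mg; last first.
    case: (leP (- M) (g z)) => Mg'; first by rewrite subrr normr0 le_max lexx orbT.
    by rewrite le_max; apply/orP; left; rewrite !ltr0_norm; lra.
  have -> : Num.max (- M) M = M by apply: max_r; move: M0; lra.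
  by rewrite le_max; apply/orP; left; rewrite !ger0_norm; lra.
Qed.

Definition W0_basic (phi : W0 T) k (hs : 'I_k -> R3 R -> R) (e : R) : set (W0 T) :=
  [set psi | forall i, `|W0_pair (hs i) psi - W0_pair (hs i) phi| < e].

Lemma Lfun_integrableC (g : LfunType (leb_cube T) (lee1n 2)) : leb3.-integrable C (EFin \o g).
Proof.
have foo : leb_cube T setT \is a fin_num by rewrite ge0_fin_numE// leb_cube_oo.
have /(Lfun_subset12 foo)/Lfun1_integrable/integrableP[mg gi] := LfunP g.
apply/integrableP; split; first exact: measurable_funTS.
apply: le_lt_trans gi; rewrite -integral_leb_cube; apply: ge0_le_integral => //.
- by move=> z _; apply: erestrict_ge0 => t _; exact: abse_ge0.
- apply/(measurable_restrictT _ (measurable_cube T)); apply: measurable_funTS.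
  exact: measurableT_comp.
- exact: measurableT_comp.
- by move=> z _; rewrite patchE; case: ifPn => // _; exact: abse_ge0.
Qed.

(** Elements of W0 are bounded by 1, so the pairing is 1-Lipschitz in the test function for the L^1
    norm. Truncating an L^2 test function therefore moves all pairings by little, and bounded
    kernels generate the same topology. *)
Lemma W0_nbhs (phi : W0 T) (G : set (W0 T)) : nbhs phi G ->
  exists k (hs : 'I_k -> R3 R -> R) e, [/\ 0 < e, forall i, bounded_kernel (hs i) &
    W0_basic phi hs e `<=` G].
Proof.
(* The filter of the candidate neighbourhoods. By the universal property of the initial topology it
   converges to phi once every L^2 pairing converges along it. *)
pose F : set_system (W0 T) := [set A | exists k (hs : 'I_k -> R3 R -> R) e,
  [/\ 0 < e, forall i, bounded_kernel (hs i) & W0_basic phi hs e `<=` A]].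
have FF : Filter F.
  split.
  - by exists 0%N, (fun=> cst 0), 1; split => // -[].
  - move=> A B [k1 [h1 [e1 [e10 bh1 hA]]]] [k2 [h2 [e2 [e20 bh2 hB]]]].
    exists (k1 + k2)%N, (fun i : 'I_(k1 + k2) => match fintype.split i with inl a => h1 a | inr b => h2 b end),
      (Num.min e1 e2); split.
    + by rewrite lt_min e10.
    + by move=> i; case: (fintype.split i).
    + move=> psi Hpsi; split.
      * apply: hA => a; have := Hpsi (lshift k2 a); rewrite (unsplitK (inl a)).
        by rewrite lt_min => /andP[].
      * apply: hB => b; have := Hpsi (rshift k1 b); rewrite (unsplitK (inr b)).
        by rewrite lt_min => /andP[].
  - move=> A B AB [k [hs [e [e0 bh hA]]]]; exists k, hs, e; split => //.
    exact: subset_trans AB.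
suff /(_ G) : F --> phi by apply.
apply: (@cvg_initial _ _ (@W0_pairing R T)).
apply/cvg_sup => g; apply: cvg_initial.
apply/cvgrPdist_lt => e e0.
have e30 : 0 < e / 3 by rewrite divr_gt0.
have gI := Lfun_integrableC g.
have [h bh gh] := bounded_kernel_approx gI e30.
have hI := bounded_kernel_integrable bh.
exists 1%N, (fun=> h), (e / 3); split => // psi /(_ ord0) Hpsi.
rewrite /= !W0_pairingE.
have d1 := le_lt_trans (W0_pair_dist psi gI hI) gh.
have d2 := le_lt_trans (W0_pair_dist phi gI hI) gh.
move: Hpsi d1 d2; rewrite !ltr_norml => /andP[? ?] /andP[? ?] /andP[? ?].
by apply/andP; split; lra.
Qed.

End weak_topology.

(** * Weak compactness of W0 *)

Lemma density_le1 d (U : measurableType d) (R : realType) (mu : {measure set U -> \bar R})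
  (D : set U) (f : U -> \bar R) : measurable D -> (mu D < +oo)%E -> measurable_fun D f ->
  (forall x, 0 <= f x)%E ->
  (forall E, measurable E -> E `<=` D -> (\int[mu]_(x in E) f x <= mu E)%E) ->
  {ae mu, forall x, D x -> (f x <= 1)%E}.
Proof.
move=> mD Doo mf f0 fE.
(* On this set f - 1 is nonnegative while its integral is at most 0, so it vanishes almost
   everywhere there. *)
pose E := D `&` f @^-1` `]1%E, +oo[%classic.
have mE : measurable E by apply: mf => //; exact: emeasurable_itv.
have ED : E `<=` D by exact: subIsetl.
have mfE : measurable_fun E f by exact: measurable_funS mf.
have Eoo : (mu E < +oo)%E by apply: le_lt_trans Doo; apply: le_measure; rewrite ?inE.
have fE1 x : E x -> (0 <= f x - 1%:E)%E.
  move=> [_]; rewrite /= in_itv/= andbT => /ltW.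
  by case: (f x) => [r| |] //=; rewrite ?leey// !lee_fin subr_ge0.
have mf1 : measurable_fun E (fun x => f x - 1%:E)%E by exact: emeasurable_funB.
have int0 : (\int[mu]_(x in E) `|f x - 1%:E| = 0)%E.
  rewrite (eq_integral (fun x => f x - 1%:E)%E); last first.
    by move=> x /set_mem Ex; rewrite gee0_abs ?fE1.
  apply/eqP; rewrite eq_le integral_ge0// andbT.
  have := fE E mE ED.
  have -> : (\int[mu]_(x in E) f x = \int[mu]_(x in E) (f x - 1%:E) + mu E)%E.
    rewrite -(mul1e (mu E)) -integral_cst// -ge0_integralD//.
    by apply: eq_integral => x _; rewrite subeK.
  by rewrite -[leRHS]add0e leeD2rE// ge0_fin_numE.
have /ae_eq_integral_abs := int0 => /(_ mE mf1) => fae.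
apply: filterS fae => x Ex0 Dx; rewrite leNgt; apply/negP => fx1.
have Ex : E x by split => //=; rewrite in_itv/= andbT.
move: (Ex0 Ex) fx1; case: (f x) => [r| |] //= [/eqP].
by rewrite subr_eq0 => /eqP ->; rewrite ltxx.
Qed.

Lemma ultra_fmap (S V : Type) (f : S -> V) (F : set_system S) : UltraFilter F -> UltraFilter (f @ F).
Proof.
move=> FU; split; first exact: fmap_proper_filter.
move=> G GF FG; apply/seteqP; split => [A GA|]; last exact: FG.
have [//|nA] := in_ultra_setVsetC (f @^-1` A) FU.
have GnA : G (~` A) by apply: FG.
have : G set0 by rewrite -(setICr A); exact: filterI.
by move/(filter_not_empty G).
Qed.

Lemma sum_indic_le (U : Type) (R : numDomainType) (A : (set U)^nat) n x : trivIset setT A ->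
  \sum_(0 <= i < n) (\1_(A i) x : R) <= \1_(\bigcup_i A i) x.
Proof.
move=> tA; have [[k _ Ak]|nA] := pselect ((\bigcup_i A i) x); last first.
  rewrite big1_seq ?indicE ?ler0n// => i _; rewrite indicE memNset// => Ai.
  by apply: nA; exists i.
have AE i : (\1_(A i) x : R) = (i == k)%:R.
  rewrite indicE; case: eqP => [->|ik]; first by rewrite mem_set.
  by rewrite memNset// => Ai; apply: ik; apply: (tA i k) => //; exists x.
rewrite [leRHS]indicE mem_set; last by exists k.
under eq_bigr do rewrite AE.
have -> : \sum_(0 <= i < n) ((i == k)%:R : R) = (k < n)%N%:R.
  elim: n => [|n IH]; first by rewrite big_geq.
  rewrite big_nat_recr//= IH ltnS [in RHS]leq_eqVlt eq_sym.
  by case: eqP => [->|_]; rewrite ?ltnn ?add0r ?addr0.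
by rewrite ler_nat; case: (k < n)%N.
Qed.

Section compactness.
Context {R : realType}.
Variable T : R.
Hypothesis T0 : 0 < T.
Local Notation C := (cube T).
Local Notation intC f := (\int[leb3]_(z in C) f z).

Lemma bounded_kernel_indic (A : set (R3 R)) : measurable A -> bounded_kernel T (\1_A).
Proof.
move=> mA; split; first exact: measurable_indic_cube.
by exists 1 => z _; rewrite indicE; case: (_ \in _); rewrite ?normr1 ?normr0.
Qed.

Lemma bounded_kernelB h1 h2 : bounded_kernel T h1 -> bounded_kernel T h2 ->
  bounded_kernel T (fun z => h1 z - h2 z).
Proof.
move=> [m1 [H1 b1]] [m2 [H2 b2]]; split; first exact: measurable_funB.
by exists (H1 + H2) => z Cz; apply: (le_trans (ler_normB _ _)); apply: lerD; [exact: b1|exact: b2].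
Qed.

Lemma bounded_kernelD h1 h2 : bounded_kernel T h1 -> bounded_kernel T h2 ->
  bounded_kernel T (fun z => h1 z + h2 z).
Proof.
move=> [m1 [H1 b1]] [m2 [H2 b2]]; split; first exact: measurable_funD.
by exists (H1 + H2) => z Cz; apply: (le_trans (ler_normD _ _)); apply: lerD; [exact: b1|exact: b2].
Qed.

Lemma bounded_kernelZ k h : bounded_kernel T h -> bounded_kernel T (fun z => k * h z).
Proof.
move=> [m [H b]]; split; first exact: measurable_funM.
by exists (`|k| * H) => z Cz; rewrite normrM ler_wpM2l// b.
Qed.

Lemma W0_pairB h1 h2 (psi : W0 T) : bounded_kernel T h1 -> bounded_kernel T h2 ->
  W0_pair (fun z => h1 z - h2 z) psi = W0_pair h1 psi - W0_pair h2 psi.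
Proof.
move=> b1 b2; rewrite /W0_pair -intCB; try by apply: W0_pair_integrable; exact: bounded_kernel_integrable.
by apply: eq_Rintegral => z _; rewrite mulrBl.
Qed.

Lemma W0_pairD h1 h2 (psi : W0 T) : bounded_kernel T h1 -> bounded_kernel T h2 ->
  W0_pair (fun z => h1 z + h2 z) psi = W0_pair h1 psi + W0_pair h2 psi.
Proof.
move=> b1 b2; rewrite /W0_pair -intCD; try by apply: W0_pair_integrable; exact: bounded_kernel_integrable.
by apply: eq_Rintegral => z _; rewrite mulrDl.
Qed.

Lemma W0_pairZ k h (psi : W0 T) : bounded_kernel T h ->
  W0_pair (fun z => k * h z) psi = k * W0_pair h psi.
Proof.
move=> b; rewrite /W0_pair -intCZ; last by apply: W0_pair_integrable; exact: bounded_kernel_integrable.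
by apply: eq_Rintegral => z _; rewrite mulrA.
Qed.

Lemma W0_pair_norm h (psi : W0 T) : bounded_kernel T h -> `|W0_pair h psi| <= intC (fun z => `|h z|).
Proof.
move=> bh; have hI := bounded_kernel_integrable T0 bh; apply: intC_norm_le => //.
- by apply: measurable_funM; [case: bh|exact: measurable_W0_clip].
- exact: integrable_norm hI.
- move=> z _; have /andP[c0 c1] := W0_clip01 psi z.
  by rewrite normrM (ger0_norm c0) ler_piMr.
Qed.

Section limit_functional.
Variable F : set_system (W0 T).
Hypothesis FU : UltraFilter F.

(** Limit of the pairings along an ultrafilter; it exists since they remain in a segment that
    depends on h only. On indicators it is a measure dominated by Lebesgue measure, and its density
    is the limit point of F. *)
Definition ulim (h : R3 R -> R) : R := lim (W0_pair h psi @[psi --> F]).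

Lemma ulim_cvg h : bounded_kernel T h -> W0_pair h psi @[psi --> F] --> ulim h.
Proof.
move=> bh; set B := intC (fun z => `|h z|).
have := @segment_compact R (- B) B; rewrite compact_ultra.
move=> /(_ _ (ultra_fmap (W0_pair h) FU)) [|x [_ Fx]].
  apply: (@nearW _ F) => psi /=; rewrite in_itv/= -ler_norml; exact: (W0_pair_norm _ bh).
by apply/cvg_ex; exists x.
Qed.

Lemma ulim_eq h l : W0_pair h psi @[psi --> F] --> l -> ulim h = l.
Proof. by move/cvg_lim; apply. Qed.

Lemma ulimB h1 h2 : bounded_kernel T h1 -> bounded_kernel T h2 ->
  ulim (fun z => h1 z - h2 z) = ulim h1 - ulim h2.
Proof.
move=> b1 b2; apply: ulim_eq.
under eq_fun do rewrite W0_pairB//.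
by apply: cvgB; exact: ulim_cvg.
Qed.

Lemma ulim_ge0 h : bounded_kernel T h -> (forall z, C z -> 0 <= h z) -> 0 <= ulim h.
Proof.
move=> bh h0; apply: limr_ge; first exact/cvgP/ulim_cvg.
apply: nearW => psi; apply: Rintegral_ge0 => z Cz.
by rewrite mulr_ge0 ?h0//; case/andP: (W0_clip01 psi z).
Qed.

Lemma ulim_le h : bounded_kernel T h -> (forall z, C z -> 0 <= h z) -> ulim h <= intC h.
Proof.
move=> bh h0; apply: limr_le; first exact/cvgP/ulim_cvg.
apply: nearW => psi; apply: (le_trans (ler_norm _)); apply: (le_trans (W0_pair_norm psi bh)).
have hI := bounded_kernel_integrable T0 bh.
by apply: intC_le => //; [exact: integrable_norm hI|move=> z Cz; rewrite ger0_norm ?h0].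
Qed.

(** The absolute value makes this nonnegative on every set, as a measure must be; on measurable sets
    it changes nothing ([ulim_measureE]). *)
Definition ulim_measure (A : set (R3 R)) : \bar R := (`|ulim (\1_A)|)%:E.

Lemma ulim_measureE A : measurable A -> ulim_measure A = (ulim (\1_A))%:E.
Proof.
move=> mA; rewrite /ulim_measure ger0_norm//; apply: ulim_ge0; first exact: bounded_kernel_indic.
by move=> z _; rewrite indicE ler0n.
Qed.

Let ulim_measure0 : ulim_measure set0 = 0%E.
Proof.
rewrite ulim_measureE//; congr EFin; apply: ulim_eq.
rewrite (_ : (fun psi => _) = cst 0); first exact: cvg_cst.
apply/funext => psi; rewrite /W0_pair /=.
under eq_Rintegral do rewrite indic0 mul0r.
by rewrite Rintegral_cube_cst// mul0r.
Qed.

Let ulim_measure_ge0 A : (0 <= ulim_measure A)%E.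
Proof. by rewrite lee_fin normr_ge0. Qed.

(** A limit along an ultrafilter is only finitely additive in general. Here the remainder [S n]
    satisfies 0 <= ulim (S n) <= intC (S n), and the right-hand side tends to 0 by dominated
    convergence. *)
Let ulim_measure_sigma_additive : semi_sigma_additive ulim_measure.
Proof.
move=> A mA tA mU; set U := \bigcup_n A n.
pose S n z : R := \1_U z - \sum_(0 <= i < n) \1_(A i) z.
have bS n : bounded_kernel T (S n) /\ ulim (S n) = ulim (\1_U) - \sum_(0 <= i < n) ulim (\1_(A i)).
  elim: n => [|n [bS IH]].
    have -> : S 0%N = \1_U by apply/funext => z; rewrite /S big_geq// subr0.
    by rewrite big_geq// subr0; split => //; exact: bounded_kernel_indic.
  have -> : S n.+1 = (fun z => S n z - \1_(A n) z).
    by apply/funext => z; rewrite /S big_nat_recr//= opprD addrA.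
  split; first by apply: bounded_kernelB => //; exact: bounded_kernel_indic.
  by rewrite ulimB ?IH ?big_nat_recr//= ?opprD ?addrA//; exact: bounded_kernel_indic.
have S0 n z : C z -> 0 <= S n z by move=> _; rewrite subr_ge0; exact: sum_indic_le.
have Scv : intC (S n) @[n --> \oo] --> intC (fun=> 0 : R).
  apply: (bounded_dominated (measurable_cube T) (leb3_cube_oo T0) (M := 1) _ _ _).2.
  - by move=> n; case: (bS n) => -[].
  - move=> n z Cz; rewrite ger0_norm ?S0// lerBlDr -[leLHS]addr0; apply: lerD.
      by rewrite indicE; case: (_ \in _); rewrite ?ler01.
    by apply: sumr_ge0 => i _; rewrite indicE ler0n.
  - move=> z Cz; apply: cvg_near_cst.
    have [[k _ Ak]|nU] := pselect (U z); last first.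
      apply: nearW => n; apply/eqP; rewrite eq_le S0// andbT /S indicE memNset// sub0r oppr_le0.
      by apply: sumr_ge0 => i _; rewrite indicE ler0n.
    near=> n.
    have kn : (k < n)%N by near: n; exact: nbhs_infty_gt.
    apply/eqP; rewrite eq_le S0// andbT subr_le0 indicE mem_set; last by exists k.
    rewrite (bigD1_seq k) ?mem_index_iota ?iota_uniq//= indicE mem_set// lerDl.
    by apply: sumr_ge0 => i _; rewrite indicE ler0n.
rewrite Rintegral_cube_cst// mul0r in Scv.
under eq_fun do under eq_bigr do rewrite ulim_measureE//.
rewrite ulim_measureE//; under eq_fun do rewrite sumEFin.
apply: cvg_EFin; first exact: nearW.
rewrite (_ : _ \o _ = fun n => ulim (\1_U) - ulim (S n)); last first.
  by apply/funext => n /=; rewrite (bS n).2 subKr.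
rewrite -[X in _ --> X]subr0; apply: cvgB; first exact: cvg_cst.
apply: (squeeze_cvgr _ (cvg_cst _) Scv); apply: nearW => n.
by have [bn _] := bS n; apply/andP; split; [exact: (ulim_ge0 bn (S0 n))|exact: (ulim_le bn (S0 n))].
Unshelve. all: end_near. Qed.

HB.instance Definition _ := isMeasure.Build _ _ _ ulim_measure ulim_measure0 ulim_measure_ge0
  ulim_measure_sigma_additive.

Let ulim_measure_fin : fin_num_fun ulim_measure.
Proof. by []. Qed.

HB.instance Definition _ := Measure_isFinite.Build _ _ _ ulim_measure ulim_measure_fin.

Lemma ulim_measure_le A : measurable A -> A `<=` C -> (ulim_measure A <= leb3 A)%E.
Proof.
move=> mA AC; rewrite ulim_measureE//.
have -> : leb3 A = (intC (\1_A))%:E.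
  rewrite Rintegral_indic//; last exact: measurable_cube.
  rewrite setIidl// fineK// ge0_fin_numE//.
  apply: le_lt_trans (leb3_cube_oo T0); apply: le_measure; rewrite ?inE//; exact: measurable_cube.
rewrite lee_fin; apply: ulim_le; first exact: bounded_kernel_indic.
by move=> z _; rewrite indicE ler0n.
Qed.

Lemma intC_indic A : measurable A -> leb3 (A `&` C) = (intC (\1_A))%:E.
Proof.
move=> mA; rewrite Rintegral_indic//; last exact: measurable_cube.
rewrite fineK// ge0_fin_numE//; apply: le_lt_trans (leb3_cube_oo T0).
apply: le_measure; rewrite ?inE//; last exact: measurable_cube.
by apply: measurableI => //; exact: measurable_cube.
Qed.

Lemma eq_W0_pair h1 h2 (psi : W0 T) : (forall z, C z -> h1 z = h2 z) -> W0_pair h1 psi = W0_pair h2 psi.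
Proof. by move=> h12; apply: eq_Rintegral => z /set_mem /h12 ->. Qed.

(** Radon-Nikodym with respect to Lebesgue measure on the cube. The domination that gives absolute
    continuity also bounds the density by 1, so its class lies in W0. *)
Lemma ulim_density : exists psi : W0 T, forall A, measurable A -> ulim (\1_A) = W0_pair (\1_A) psi.
Proof.
pose nu : {finite_measure set (R3 R) -> \bar R} := ulim_measure.
pose mu : {finite_measure set (R3 R) -> \bar R} := mfrestr (measurable_cube T) (leb3_cube_oo T0).
have numu : nu `<< mu.
  apply/null_content_dominatesP => A mA mA0; apply/eqP; rewrite eq_le measure_ge0 andbT.
  rewrite -mA0 /nu /mu /= ulim_measureE// /mfrestr /mrestr intC_indic// lee_fin.
  apply: ulim_le; first exact: bounded_kernel_indic.
  by move=> z _; rewrite indicE ler0n.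
have [f [f0 fI fE]] := radon_nikodym_finite numu.
have fE' E : measurable E -> E `<=` C -> (\int[leb3]_(z in E) f z)%E = nu E.
  move=> mE EC; rewrite (fE E mE).
  apply: eq_measure_integral => A mA AE.
  by rewrite /mu /= /mfrestr /mrestr (setIidl (subset_trans AE EC)).
have mf : measurable_fun setT f by case/integrableP: fI.
have f1 : {ae leb3, forall z, C z -> (f z <= 1)%E}.
  apply: (density_le1 (measurable_cube T) (leb3_cube_oo T0)) => //.
    exact: measurable_funTS.
  by move=> E mE EC; rewrite fE'//; exact: ulim_measure_le.
pose phi z : R := fine (mine (f z) 1%E).
have mphi : measurable_fun C phi.
  apply: measurable_funTS; apply: measurableT_comp => //; exact: measurable_mine.
have phi01 z : C z -> 0 <= phi z <= 1.
  move=> _; rewrite /phi; move: (f0 z); case: (f z) => [r| |]//= r0; last by rewrite ler01 lexx.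
  by rewrite -EFin_min/= le_min ler01 -lee_fin r0 ge_min lexx orbT.
have phiE : {ae leb3, forall z, C z -> f z = (phi z)%:E}.
  apply: filterS f1 => z fz1 /fz1; rewrite /phi; move: (f0 z); case: (f z) => [r| |]//= r0 r1.
  by rewrite -EFin_min/= min_l.
exists (W0_class T phi).
have clE : {ae leb3, forall z, C z -> W0_clip (W0_class T phi) z = phi z}.
  apply: filterS2 (W0_clipE (W0_class T phi)) (ae_leb_cube (W0_classE mphi phi01)) => z H1 H2 Cz.
  by rewrite -H1// H2.
move=> A mA; have mAC : measurable (A `&` C) by apply: measurableI => //; exact: measurable_cube.
have -> : W0_pair (\1_A) (W0_class T phi) = intC (fun z => \1_A z * phi z).
  have mi : measurable_fun C (\1_A : R3 R -> R) by exact: measurable_indic_cube.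
  apply: eq_ae_intC; [|exact: measurable_funM|].
    by apply: measurable_funM => //; exact: measurable_W0_clip.
  by apply: filterS clE => z H /H ->.
have -> : ulim (\1_A) = ulim (\1_(A `&` C)).
  congr (lim (_ @ F)); apply/funext => psi; apply: eq_W0_pair => z Cz.
  by rewrite !indicE in_setI (mem_set Cz) andbT.
apply: EFin_inj; rewrite -ulim_measureE//.
have -> : ulim_measure (A `&` C) = nu (A `&` C) by [].
rewrite -fE'//.
rewrite (@ae_eq_integral _ _ _ _ _ (EFin \o phi))//; last 3 first.
- exact: measurable_funTS.
- by apply/measurable_EFinP; apply: measurable_funS mphi => //; exact: measurable_cube.
- by apply: filterS phiE => z H [_ /H ->].
rewrite setIC integral_mkcondr /Rintegral fineK; last first.
  apply: integrable_fin_num; first exact: measurable_cube.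
  apply: (cube_integrable T0 (M := 1)).
    by apply: measurable_funM => //; exact: measurable_indic_cube.
  move=> z /phi01/andP[p0 p1]; rewrite normrM (ger0_norm p0) indicE.
  by case: (_ \in _); rewrite ?normr1 ?normr0 ?mul1r ?mul0r.
apply: eq_integral => z _; rewrite patchE indicE; case: ifPn => _ /=; first by rewrite mul1r.
by rewrite mul0r.
Qed.

(** From indicators to [0, 1]-valued kernels by the halving of [approximable_dyadic]: after m rounds
    the remaining kernel contributes at most 2^-m T, uniformly over W0. *)
Lemma ultra_W0_pair (psi : W0 T) (h : R3 R -> R) m (e : R) : (forall A, measurable A -> ulim (\1_A) = W0_pair (\1_A) psi) ->
  measurable_fun C h -> (forall z, C z -> 0 <= h z <= 1) -> 2 ^- m * T < e ->
  \forall phi \near F, `|W0_pair h phi - W0_pair h psi| < e.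
Proof.
move=> psiE; have FF : Filter F by exact: filter_filter.
have bk (f : R3 R -> R) : measurable_fun C f -> (forall z, C z -> 0 <= f z <= 1) -> bounded_kernel T f.
  by move=> mf f01; split => //; exists 1 => z Cz; rewrite norm_le1// f01.
elim: m h e => [|m IH] f e mf f01 Te.
  rewrite expr0 invr1 mul1r in Te; apply: nearW => phi; apply: le_lt_trans Te.
  have fp (x : W0 T) : 0 <= W0_pair f x <= T.
    apply/andP; split.
      apply: Rintegral_ge0 => z /f01/andP[f0 _]; rewrite mulr_ge0//.
      by case/andP: (W0_clip01 x z).
    apply: (le_trans (ler_norm _)); apply: (le_trans (W0_pair_norm x (bk f mf f01))).
    have fI := bounded_kernel_integrable T0 (bk f mf f01).
    rewrite -[leRHS]mul1r -(Rintegral_cube_cst T0); apply: intC_le.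
    - exact: integrable_norm fI.
    - by apply: (cube_integrable T0 (M := 1)) => // z _; rewrite normr1.
    - by move=> z /f01/norm_le1.
  move: (fp phi) (fp psi) => /andP[? ?] /andP[? ?].
  by rewrite ler_norml; apply/andP; split; lra.
pose A := C `&` [set z | 2^-1 <= f z].
have mA : measurable A.
  have -> : A = C `&` f @^-1` `[2^-1, +oo[%classic.
    by apply/seteqP; split => z; rewrite /A /= in_itv/= andbT.
  by apply: mf => //; exact: measurable_cube.
pose f' z : R := 2 * f z - \1_A z.
have mf' : measurable_fun C f'.
  by apply: measurable_funB; [exact: measurable_funM|exact: measurable_indic_cube].
have f'01 z : C z -> 0 <= f' z <= 1.
  move=> Cz; have /andP[f0 f1] := f01 z Cz; rewrite /f' indicE.
  have [/set_mem[_ /= fz]|] := boolP (z \in A); first by apply/andP; split; lra.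
  rewrite notin_setE /A /= => /not_andP[//|/negP].
  by rewrite -ltNge => fz; apply/andP; split; lra.
pose e1 := (2 * e - 2 ^- m * T) / 2.
have Te' : 2 ^- m * T < 2 * e.
  by rewrite -ltr_pdivrMl// mulrA -invfM -exprS.
have e10 : 0 < e1 by rewrite divr_gt0// subr_gt0.
have n1 : \forall phi \near F, `|W0_pair (\1_A) phi - W0_pair (\1_A) psi| < e1.
  have /cvgrPdist_lt/(_ _ e10) := ulim_cvg (bounded_kernel_indic mA).
  by rewrite psiE//; apply: filterS => phi; rewrite distrC.
have n2 : \forall phi \near F, `|W0_pair f' phi - W0_pair f' psi| < 2 ^- m * T + e1.
  by apply: IH => //; rewrite ltrDl.
have fE (x : W0 T) : W0_pair f x = 2^-1 * (W0_pair (\1_A) x + W0_pair f' x).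
  have bA := bounded_kernel_indic mA; have bf' := bk f' mf' f'01.
  rewrite -W0_pairD// -W0_pairZ; last exact: bounded_kernelD.
  by apply: eq_W0_pair => z _; rewrite /f'; field.
apply: filterS2 n1 n2 => phi; rewrite !fE !ltr_norml => /andP[? ?] /andP[? ?].
have e1E : 2 * e = e1 + (2 ^- m * T + e1) by rewrite /e1; field; rewrite expf_neq0.
by apply/andP; split; lra.
Qed.

Lemma ultra_W0_cvg : exists psi : W0 T, F --> psi.
Proof.
have FF : Filter F by exact: filter_filter.
have [psi psiE] := ulim_density; exists psi => G /W0_nbhs -/(_ T0)[k [hs [e [e0 bh hG]]]].
apply: (filterS hG); apply: filter_forall => i; have [mh [H hH]] := bh i.
pose H' := `|H| + 1; have H'0 : 0 < H' by rewrite ltr_wpDl.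
pose f z := (hs i z + H') / (2 * H').
have mf : measurable_fun C f by apply: measurable_funM => //; exact: measurable_funD.
have f01 z : C z -> 0 <= f z <= 1.
  move=> /hH hz; rewrite /f.
  have : `|hs i z| <= H' by apply: (le_trans hz); apply: (le_trans (ler_norm H)); rewrite lerDl.
  rewrite ler_norml => /andP[h1 h2]; rewrite divr_ge0 ?mulr_ge0 ?(ltW H'0)//=; last by lra.
  by rewrite ler_pdivrMr ?mulr_gt0// mul1r; lra.
(* As h = 2 H' f - H', the two errors enter with total weight 3 H'. *)
have e' : 0 < e / (4 * H') by rewrite divr_gt0// mulr_gt0.
have [m mT] : exists m, 2 ^- m * T < e / (4 * H').
  have /cvgrPdist_lt/(_ _ e')[m _ /(_ m (leqnn m))] : 2^-1 ^+ m * T @[m --> \oo] --> (0 : R).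
    rewrite -[X in _ --> X](mul0r T); apply: cvgMl; apply: cvg_expr.
    by rewrite ger0_norm// invf_lt1// ltr1n.
  rewrite /= sub0r normrN ger0_norm ?mulr_ge0 ?exprn_ge0 ?(ltW T0)// exprVn => mT.
  by exists m.
have bf : bounded_kernel T f.
  by split => //; exists 1 => z Cz; rewrite norm_le1// f01.
have b1 : bounded_kernel T (fun=> 1) by split => //; exists 1 => z _; rewrite normr1.
have hE (x : W0 T) : W0_pair (hs i) x = 2 * H' * W0_pair f x - H' * W0_pair (fun=> 1) x.
  rewrite -!W0_pairZ// -W0_pairB; try exact: bounded_kernelZ.
  by apply: eq_W0_pair => z _; rewrite /f; field; rewrite gt_eqF.
have i1 (z : R3 R) : C z -> 0 <= (1 : R) <= 1 by rewrite ler01 lexx.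
have n1 := ultra_W0_pair psiE (measurable_cst _) i1 mT.
apply: filterS2 n1 (ultra_W0_pair psiE mf f01 mT) => phi d1 d2.
rewrite !hE.
rewrite (_ : _ - _ = 2 * H' * (W0_pair f phi - W0_pair f psi) -
   H' * (W0_pair (fun=> 1) phi - W0_pair (fun=> 1) psi)); last by ring.
apply: (le_lt_trans (ler_normB _ _)); rewrite !normrM (gtr0_norm H'0) ger0_norm//.
move: d1 d2; rewrite !ltr_pdivlMr ?mulr_gt0//; set x := `|_|; set y := `|_|.
by move: e0; lra.
Qed.

End limit_functional.

Lemma W0_compact : compact [set: W0 T].
Proof.
rewrite compact_ultra => F FU _.
by have [psi Fpsi] := ultra_W0_cvg FU; exists psi.
Qed.

End compactness.

(** * The rate as a supremum *)

Section truncated_shrink.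
Context {R : realType}.
Variables (e M u p q c : R).
Hypotheses (e0 : 0 < e) (e1 : e <= 1) (M0 : 0 <= M) (u01 : 0 <= u <= 1).
Hypotheses (c0 : 0 < c) (cp : c <= p) (cq : c <= q).

(* The truncation makes dQ1 bounded; [p / (p + q)] is the zero of Q1. *)
Definition tshrink : R := if p + q <= M then shrink e u else p / (p + q).

Let p0 : 0 < p. Proof. exact: lt_le_trans cp. Qed.
Let q0 : 0 < q. Proof. exact: lt_le_trans cq. Qed.
Let pq0 : 0 < p + q. Proof. exact: addr_gt0. Qed.

Lemma equilibrium01 : 0 < p / (p + q) < 1.
Proof. by rewrite divr_gt0//= ltr_pdivrMr// mul1r ltrDl. Qed.

Lemma Q1_equilibrium : Q1 (p / (p + q)) p q = 0.
Proof.
rewrite /Q1 (_ : p * (1 - _) = q * (p / (p + q))) ?subrr ?expr0n//.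
by field; rewrite gt_eqF.
Qed.

Lemma dQ1_equilibrium : dQ1 (p / (p + q)) p q = 0.
Proof.
have s0 : 0 < Num.sqrt (p * q) by rewrite sqrtr_gt0 mulr_gt0.
have -> : dQ1 (p / (p + q)) p q =
    q - p - Num.sqrt (p * q) * (1 - 2 * (p / (p + q))) / (Num.sqrt (p * q) / (p + q)).
  rewrite /dQ1; congr (_ - _ / _).
  rewrite (_ : _ / _ * _ = p * q * (p + q)^-1 ^+ 2); last by field; rewrite gt_eqF.
  by rewrite sqrtrM ?mulr_ge0 ?(ltW p0) ?(ltW q0)// sqrtr_sqr ger0_norm// invr_ge0 ltW.
by field; rewrite !gt_eqF.
Qed.

Lemma tshrink01 : 0 < tshrink < 1.
Proof. by rewrite /tshrink; case: ifP => _; [exact: shrink01|exact: equilibrium01]. Qed.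

(** Measuring the excess from M / 2 makes it comparable to p + q itself wherever p + q > M. Every
    cost of the truncation is thus bounded by an integrable quantity that is small for large M. *)
Let excess : ~~ (p + q <= M) -> p + q <= 2 * Num.max (p + q - M / 2) 0.
Proof.
rewrite -ltNge => pqM; apply: (@le_trans _ _ (2 * (p + q - M / 2))); first by lra.
by rewrite ler_pM2l// le_max lexx.
Qed.

Let excess0 : 0 <= Num.max (p + q - M / 2) 0. Proof. by rewrite le_max lexx orbT. Qed.

Lemma tshrink_dist : `|tshrink - u| <= e ^+ 2 / 2 + Num.max (p + q - M / 2) 0 / c.
Proof.
rewrite /tshrink; case: ifPn => [_|/excess ex].
  by apply: (le_trans (shrink_dist e u01)); rewrite lerDl divr_ge0// ltW.
have /andP[v0 v1] := equilibrium01; have /andP[u0 u1] := u01.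
apply: (@le_trans _ _ 1).
  by rewrite ler_norml; apply/andP; split; lra.
apply: (@le_trans _ _ (Num.max (p + q - M / 2) 0 / c)).
  by rewrite ler_pdivlMr// mul1r; move: ex cp cq; lra.
by rewrite lerDr divr_ge0// sqr_ge0.
Qed.

Lemma Q1_tshrink : Q1 tshrink p q <= Q1 u p q + 2 * e * (p + q).
Proof.
rewrite /tshrink; case: ifPn => _.
  have := Q1_shrink e0 e1 u01 p0 q0; rewrite ler_norml => /andP[_].
  by rewrite lerBlDl.
by rewrite Q1_equilibrium addr_ge0 ?sqr_ge0// !mulr_ge0// ltW.
Qed.

Lemma Q1_le_add : Q1 u p q <= p + q.
Proof.
rewrite Q1E ?(ltW p0) ?(ltW q0)//; case/andP: u01 => u0 u1.
have : 0 <= 2 * Num.sqrt (p * q) * Num.sqrt (u * (1 - u)) by rewrite !mulr_ge0.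
have : p * (1 - u) <= p by rewrite ler_piMr ?(ltW p0)//; lra.
have : q * u <= q by rewrite ler_piMr ?(ltW q0).
lra.
Qed.

(** Below the level M, [Lam_dQ1] gives equality at the shrunk point; moving back to u costs 2 e (p +
    q) in [Q1] and e (p + q) in the linear term. Above it the right-hand side is 0, and the
    left-hand side is nonpositive since [Q1] <= p + q. *)
Lemma Lam_tshrink : Q1 u p q - 3 * e * (p + q) - 2 * Num.max (p + q - M / 2) 0 <=
  dQ1 tshrink p q * u - Lam (dQ1 tshrink p q) p q.
Proof.
rewrite (Lam_dQ1 tshrink01 p0 q0) /tshrink; case: ifPn => [_|/excess ex].
  have := Q1_shrink e0 e1 u01 p0 q0; have := dQ1_shrink_dist e0 e1 u01 p0 q0.
  rewrite !ler_norml mulrBr => /andP[h1 _] /andP[h2 _]; move: excess0 h1 h2; lra.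
rewrite dQ1_equilibrium Q1_equilibrium !mul0r subrr.
have : 0 <= e * (p + q) by rewrite mulr_ge0// ltW.
by move: Q1_le_add; lra.
Qed.

Lemma dQ1_tshrink_bound : `|dQ1 tshrink p q| <= M * (1 + e^-1).
Proof.
have e'0 : 0 <= 1 + e^-1 by rewrite addr_ge0// invr_ge0 ltW.
rewrite /tshrink; case: ifPn => [pqM|_]; last by rewrite dQ1_equilibrium normr0 mulr_ge0.
by apply: (le_trans (dQ1_shrink_bound e0 e1 u01 p0 q0)); rewrite ler_wpM2r.
Qed.

End truncated_shrink.

Section rate_variational.
Context {R : realType}.
Variables (T c : R) (p q : R3 R -> R).
Hypotheses (T0 : 0 < T) (c0 : 0 < c).
Local Notation C := (cube T).
Local Notation intC f := (\int[leb3]_(z in C) f z).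
Hypotheses (pI : leb3.-integrable C (EFin \o p)) (qI : leb3.-integrable C (EFin \o q)).
Hypotheses (pc : forall z, C z -> c <= p z) (qc : forall z, C z -> c <= q z).

Let mp : measurable_fun C p. Proof. exact: integrableC_measurable. Qed.
Let mq : measurable_fun C q. Proof. exact: integrableC_measurable. Qed.
Let pqI : leb3.-integrable C (EFin \o (fun z => p z + q z)). Proof. exact: integrableCD. Qed.

Definition rate_int (u : R3 R -> R) : R := intC (fun z => Q1 (u z) (p z) (q z)).

Lemma measurable_Q1 (u : R3 R -> R) : measurable_fun C u -> measurable_fun C (fun z => Q1 (u z) (p z) (q z)).
Proof.
move=> mu; apply: measurable_funX; apply: measurable_funB; apply: measurable_fun_sqrt;
  apply: measurable_funM => //; exact: measurable_funB.
Qed.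

Lemma Q1_integrable (u : R3 R -> R) : measurable_fun C u -> (forall z, C z -> 0 <= u z <= 1) ->
  leb3.-integrable C (EFin \o (fun z => Q1 (u z) (p z) (q z))).
Proof.
move=> mu u01; apply: (integrableC_le (g := fun z => p z + q z)) => //; first exact: measurable_Q1.
by move=> z Cz; rewrite ger0_norm ?sqr_ge0//; apply: (Q1_le_add (u01 z Cz) c0); [exact: pc|exact: qc].
Qed.

Lemma rate_int_young (h u : R3 R -> R) : bounded_kernel T h -> measurable_fun C u ->
  (forall z, C z -> 0 <= u z <= 1) -> intC (fun z => h z * u z) - Lam_int T p q h <= rate_int u.
Proof.
move=> [mh [H hH]] mu u01; have LI := Lam_integrable T0 c0 pI qI pc qc mh hH.
have huI : leb3.-integrable C (EFin \o (fun z => h z * u z)).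
  apply: (cube_integrable T0 (M := H)); first exact: measurable_funM.
  move=> z Cz; rewrite normrM -[leRHS]mulr1; apply: ler_pM => //; first exact: hH.
  by rewrite norm_le1// u01.
rewrite -intCB//; apply: intC_le; [exact: integrableCB|exact: Q1_integrable|].
move=> z Cz; apply: Lam_young; [|by apply: lt_le_trans (qc Cz)|exact: u01].
by apply: lt_le_trans (pc Cz).
Qed.

(** One function v serves twice. Its closeness to u in L^1 and in rate is what the lower bound
    needs; the last inequality says that its bounded tilt is nearly optimal at u, which yields the
    rate as a supremum. *)
Lemma good_approximation (u : R3 R -> R) (e : R) : measurable_fun C u -> (forall z, C z -> 0 <= u z <= 1) -> 0 < e ->
  exists v, let g z := dQ1 (v z) (p z) (q z) in
  [/\ measurable_fun C v, forall z, C z -> 0 < v z < 1, bounded_kernel T g &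
    [/\ intC (fun z => `|v z - u z|) <= e, rate_int v <= rate_int u + e &
      rate_int u - e <= intC (fun z => g z * u z) - Lam_int T p q g]].
Proof.
move=> mu u01 e0; pose S := intC (fun z => p z + q z).
have pq0 z : C z -> 0 <= p z + q z.
  by move=> Cz; rewrite addr_ge0// (le_trans (ltW c0))// ?pc ?qc.
have S0 : 0 <= S.
  exact: Rintegral_ge0.
have k0 : 0 < 6 * S + T by rewrite ltr_wpDl// mulr_ge0.
(* With s (6 S + T) <= e, the terms 3 s S and s^2 T / 2 are each at most e / 2, and 2 s S is at most
   e. *)
pose s := Num.min 1 (e / (6 * S + T)).
have s0 : 0 < s by rewrite lt_min ltr01 divr_gt0.
have s1 : s <= 1 by rewrite ge_min lexx.
have sk : s * (6 * S + T) <= e by rewrite -ler_pdivlMr// ge_min lexx orbT.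
have s2 : s ^+ 2 <= s by rewrite expr2 ger_pMl.
(* The excess is divided by c in [tshrink_dist] and doubled in [Lam_tshrink]; both contributions are
   to be at most e / 2. *)
have t0 : 0 < Num.min (c * e / 2) (e / 4) by rewrite lt_min !divr_gt0// mulr_gt0.
have [M2 M20 tM] := excess_small T0 pqI pq0 t0.
pose M := 2 * M2; have M0 : 0 <= M by rewrite mulr_ge0.
have M2E : M2 = M / 2 by rewrite /M; field.
rewrite M2E lt_min in tM; case/andP: tM => tM1 tM2.
pose B z := Num.max (p z + q z - M / 2) 0.
have BI : leb3.-integrable C (EFin \o B) by apply: (excess_integrable pqI pq0); rewrite divr_ge0.
pose v z := tshrink s M (u z) (p z) (q z).
have v01 z : C z -> 0 < v z < 1.
  by move=> Cz; apply: (tshrink01 _ s0 s1 (u01 z Cz) c0); [exact: pc|exact: qc].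
have v01' z : C z -> 0 <= v z <= 1 by move=> /v01/andP[? ?]; rewrite !ltW.
have mv : measurable_fun C v.
  apply: measurable_fun_if; first exact: measurable_cube.
  - by apply: measurable_fun_ler => //; exact: measurable_funD.
  - apply: (measurable_funS (measurable_cube T)); first exact: subIsetl.
    by apply: measurable_funD => //; exact: measurable_funM.
  - apply: (measurable_funS (measurable_cube T)); first exact: subIsetl.
    apply: measurable_funM => //; apply: measurable_fun_inv; last exact: measurable_funD.
    by move=> z Cz; rewrite addr_gt0// (lt_le_trans c0)// ?pc ?qc.
pose g z := dQ1 (v z) (p z) (q z).
have gb z : C z -> `|g z| <= M * (1 + s^-1).
  by move=> Cz; apply: (dQ1_tshrink_bound s0 s1 M0 (u01 z Cz) c0); [exact: pc|exact: qc].
have mg : measurable_fun C g.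
  apply: measurable_funB; first exact: measurable_funB.
  apply: measurable_funM.
    apply: measurable_funM; first by apply: measurable_fun_sqrt; exact: measurable_funM.
    by apply: measurable_funB => //; exact: measurable_funM.
  apply: measurable_fun_inv.
    by move=> z /v01/andP[v0 v1]; rewrite sqrtr_gt0 mulr_gt0// subr_gt0.
  by apply: measurable_fun_sqrt; apply: measurable_funM => //; exact: measurable_funB.
have bg : bounded_kernel T g by split => //; exists (M * (1 + s^-1)).
have Q1u := Q1_integrable mu u01; have Q1v := Q1_integrable mv v01'.
have cstI (k : R) : leb3.-integrable C (EFin \o (fun=> k)) by apply: (cube_integrable T0 (M := `|k|)).
have c'B := integrableCZ c^-1 BI; have B2 := integrableCZ 2 BI.
have pq2 := integrableCZ (2 * s) pqI; have pq3 := integrableCZ (3 * s) pqI.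
exists v; split => //; split.
- apply: le_trans (_ : intC (fun z => s ^+ 2 / 2 + c^-1 * B z) <= _).
    apply: intC_le; last 2 first.
    + exact: integrableCD.
    + move=> z Cz; rewrite [c^-1 * _]mulrC.
      by apply: (tshrink_dist s M (u01 z Cz) c0); [exact: pc|exact: qc].
    apply: integrable_norm; apply: integrableCB.
    + by apply: (cube_integrable T0 mv (M := 1)) => z /v01'/norm_le1.
    + by apply: (cube_integrable T0 mu (M := 1)) => z /u01/norm_le1.
  rewrite intCD// Rintegral_cube_cst// intCZ//.
  have t1 : s ^+ 2 / 2 * T <= e / 2.
    have sT : s * T <= e by apply: le_trans sk; rewrite ler_pM2l// lerDr mulr_ge0.
    have : s ^+ 2 * T <= s * T by rewrite ler_pM2r.
    lra.
  have t2 : c^-1 * intC B <= e / 2.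
    by rewrite mulrC ler_pdivrMr//; apply: ltW; apply: (lt_le_trans tM1); lra.
  by move: t1 t2; set x := c^-1 * _; lra.
- apply: le_trans (_ : intC (fun z => Q1 (u z) (p z) (q z) + 2 * s * (p z + q z)) <= _).
    apply: intC_le => //; first exact: integrableCD.
    by move=> z Cz; apply: (Q1_tshrink _ s0 s1 (u01 z Cz) c0); [exact: pc|exact: qc].
  rewrite intCD// intCZ// lerD2l -/S; have : 0 <= s * T by rewrite mulr_ge0 ?ltW.
  have : 0 <= s * S by rewrite mulr_ge0// ltW.
  by move: sk; rewrite mulrDr; lra.
- have LI := Lam_integrable T0 c0 pI qI pc qc mg gb.
  have guI : leb3.-integrable C (EFin \o (fun z => g z * u z)).
    apply: (cube_integrable T0 (M := M * (1 + s^-1))); first exact: measurable_funM.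
    move=> z Cz; rewrite normrM -[leRHS]mulr1; apply: ler_pM => //; first exact: gb.
    by rewrite norm_le1// u01.
  rewrite -intCB//.
  apply: le_trans (_ : intC (fun z => Q1 (u z) (p z) (q z) - 3 * s * (p z + q z) - 2 * B z) <= _).
    rewrite !intCB// ?intCZ//; last exact: integrableCB.
    rewrite -/S -/(rate_int u); have : 0 <= s * T by rewrite mulr_ge0 ?ltW.
    by move: sk tM2; rewrite mulrDr -/(B _); set x := intC B; set y := s * S; set x' := s * T; lra.
  apply: intC_le; [by apply: integrableCB => //; exact: integrableCB|exact: integrableCB|].
  by move=> z Cz; apply: (Lam_tshrink M s0 s1 (u01 z Cz) c0); [exact: pc|exact: qc].
Qed.

End rate_variational.

(** * A countable base of W0 and Borel measurability *)

Section countable_base.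
Context {R : realType}.
Variable T : R.
Hypothesis T0 : 0 < T.
Local Notation C := (cube T).
Local Notation intC f := (\int[leb3]_(z in C) f z).

(** Rational values on (n + 1)^3 boxes: countably many kernels, dense in L^1 among the bounded ones.
    Together with rational intervals they make W0 second countable ([rat_open_base]). *)
Definition rat_grid : countType := {n : nat & {ffun 'I_n.+1 * 'I_n.+1 * 'I_n.+1 -> rat}}.

Definition rat_kernel (v : rat_grid) : R3 R -> R :=
  gridf T (tag v).+1 (fun i j k => ratr (tagged v (i, j, inord k))).

Lemma bounded_rat_kernel v : bounded_kernel T (rat_kernel v).
Proof.
split; first exact: measurable_gridf.
pose M : R := \sum_x `|ratr (tagged v x)|; exists M => z Cz.
have vM x : `|ratr (tagged v x)| <= M.
  by rewrite /M (bigD1 x)//= lerDl; apply: sumr_ge0.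
have vb i j k : - M <= ratr (tagged v (i, j, inord k)) <= M by rewrite -ler_norml.
by rewrite ler_norml; exact: (gridf_itv T0 (ltn0Sn _) (ltn0Sn _) vb Cz).
Qed.

Lemma rat_kernel_dense h e : bounded_kernel T h -> 0 < e ->
  exists v, intC (fun z => `|h z - rat_kernel v z|) < e.
Proof.
move=> [mh [H hH]] e0; have e20 : 0 < e / 2 by rewrite divr_gt0.
have e2T : 0 < e / 2 / T by rewrite divr_gt0.
pose H' := `|H| + 1.
have HH : - H' < H' by rewrite /H'; have := normr_ge0 H; lra.
have hH' z : C z -> - H' <= h z <= H'.
  move=> /hH hz; rewrite -ler_norml; apply: (le_trans hz); apply: (le_trans (ler_norm H)).
  by rewrite lerDl.
have [n /(_ n.+1 n.+1 (ltnSn n) (ltnSn n))[G Gb Ge]] := approximable_bounded T0 HH mh hH' e20.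
have q_ex (x : R) : exists q : rat, x < ratr q < x + e / 2 / T.
  have /rat_in_itvoo[q] : x < x + e / 2 / T by rewrite ltrDl.
  by rewrite in_itv/= => qx; exists q.
have /choice[f fP] := q_ex.
pose v : {ffun 'I_n.+1 * 'I_n.+1 * 'I_n.+1 -> rat} :=
  [ffun x : 'I_n.+1 * 'I_n.+1 * 'I_n.+1 => f (G x.1.1 x.1.2 (x.2 : nat))].
exists (Tagged _ v : rat_grid).
have hb : bounded_kernel T h by split => //; exists H.
have hI := bounded_kernel_integrable T0 hb.
have vI := bounded_kernel_integrable T0 (bounded_rat_kernel (Tagged _ v : rat_grid)).
have GI : leb3.-integrable C (EFin \o gridf T n.+1 G).
  apply: (cube_integrable T0 (measurable_gridf n.+1 G) (M := H')) => z Cz.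
  by rewrite ler_norml; exact: (gridf_itv T0 (ltn0Sn _) (ltn0Sn _) Gb Cz).
have cI : leb3.-integrable C (EFin \o (fun=> e / 2 / T)).
  by apply: (cube_integrable T0 (M := `|e / 2 / T|)).
have dI := integrable_norm (integrableCB hI GI).
apply: le_lt_trans (_ : intC (fun z => `|h z - gridf T n.+1 G z| + e / 2 / T) < _); last first.
  rewrite intCD// Rintegral_cube_cst// divfK ?gt_eqF//.
  by rewrite [ltRHS]splitr ltrD2r.
apply: intC_le; [exact: integrable_norm (integrableCB hI vI)|exact: integrableCD|].
move=> z Cz; rewrite /rat_kernel /=.
have [i [j [k kn [_ _ gE]]]] := gridf_ex T0 (ltn0Sn n) (ltn0Sn n) Cz.
rewrite !gE ffunE /= inordK//.
have /andP[q1 q2] := fP (G i j k).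
rewrite -(subrK (G i j k) (h z)) -addrA addrK.
apply: (le_trans (ler_normD _ _)); rewrite lerD2l.
by rewrite ler_norml; apply/andP; split; move: q1 q2 e2T; lra.
Qed.

Definition rat_open (l : seq (rat_grid * rat * rat)) : set (W0 T) :=
  [set psi | all (fun t => ratr t.1.2 < W0_pair (rat_kernel t.1.1) psi < ratr t.2) l].

Lemma rat_open_base (G : set (W0 T)) psi : nbhs psi G -> exists2 l, rat_open l psi & rat_open l `<=` G.
Proof.
move=> /W0_nbhs -/(_ T0)[k [hs [e [e0 bh hG]]]].
have e30 : 0 < e / 4 by rewrite divr_gt0.
have tex i : exists t : rat_grid * rat * rat, rat_open [:: t] psi /\
    forall phi, rat_open [:: t] phi -> `|W0_pair (hs i) phi - W0_pair (hs i) psi| < e.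
  have [v hv] := rat_kernel_dense (bh i) e30.
  set x := W0_pair (rat_kernel v) psi.
  have /rat_in_itvoo[a] : x - e / 4 < x by rewrite ltrBlDr ltrDl.
  rewrite in_itv/= => /andP[a1 a2].
  have /rat_in_itvoo[b] : x < x + e / 4 by rewrite ltrDl.
  rewrite in_itv/= => /andP[b1 b2].
  exists (v, a, b); split; first by rewrite /rat_open /= -/x a2 b1.
  move=> phi; rewrite /rat_open /= andbT => /andP[y1 y2].
  have hI := bounded_kernel_integrable T0 (bh i).
  have vI := bounded_kernel_integrable T0 (bounded_rat_kernel v).
  have d1 := le_lt_trans (W0_pair_dist phi hI vI) hv.
  have d2 := le_lt_trans (W0_pair_dist psi hI vI) hv.
  move: d1 d2; rewrite -/x !ltr_norml => /andP[? ?] /andP[? ?].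
  by apply/andP; split; lra.
have /choice[t tP] := tex.
exists [seq t i | i <- enum 'I_k].
  rewrite /rat_open /= all_map; apply/allP => i _ /=.
  by have [+ _] := tP i; rewrite /rat_open /= andbT.
move=> phi; rewrite /rat_open /= all_map => /allP hphi; apply: hG => i.
have [_] := tP i; apply; rewrite /rat_open /= andbT.
exact: (hphi i (mem_enum _ i)).
Qed.

(** Measurability of the pairings controls basic open sets; the countable base writes any open set
    as a countable union of those. *)
Lemma measurable_W0_map d (Omega : measurableType d) (Y : Omega -> W0 T) :
  (forall h, bounded_kernel T h -> measurable_fun setT (fun w => W0_pair h (Y w))) ->
  forall G, open G -> measurable (Y @^-1` G).
Proof.
move=> mY G oG.
have -> : Y @^-1` G = \bigcup_l (if `[< rat_open l `<=` G >] then Y @^-1` rat_open l else set0).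
  apply/seteqP; split => [w Gw|w [l _]].
    have [l lw lG] := rat_open_base (open_nbhs_nbhs (conj oG Gw)).
    by exists l => //; case: asboolP.
  by case: asboolP => // lG; exact: lG.
apply: countable_bigcupT_measurable; first exact: countableP.
move=> l; case: asboolP => // _; elim: l => [|t l IH].
  by rewrite (_ : _ @^-1` _ = setT)//; apply/seteqP; split.
have -> : Y @^-1` rat_open (t :: l) =
    (fun w => W0_pair (rat_kernel t.1.1) (Y w)) @^-1` `]ratr t.1.2, ratr t.2[%classic `&` Y @^-1` rat_open l.
  apply/seteqP; split => w; rewrite /rat_open /= in_itv/= => /andP//.
apply: measurableI => //; rewrite -[X in measurable X]setTI; apply: mY => //.
exact: bounded_rat_kernel.
Qed.

End countable_base.

Section graphon_process_measurable.
Context {R : realType} d (Omega : measurableType d) (P : probability Omega R).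
Variables (T : R) (pn qn : forall n, 'I_n -> 'I_n -> R -> R) (a : nat -> R).
Variables (x0 : forall n, 'I_n -> 'I_n -> bool) (X : forall n, 'I_n -> 'I_n -> R -> Omega -> bool).
Hypothesis T0 : 0 < T.
Hypothesis hX : forall n (i j : 'I_n), markov_chain P T (@X n i j) (@x0 n i j)
  (fun t => a n * @pn n i j t) (fun t => a n * @qn n i j t).
Local Notation C := (cube T).

Lemma W0_pair_graphon_process n h w : (0 < n)%N -> bounded_kernel T h ->
  W0_pair h (graphon_process T X n w) = \int[leb3]_(z in C) (h z * sample_kernel (@X n) w z).
Proof.
move=> n0 [mh _].
have ms := measurable_sample_kernel T0 hX w n0.
have s01 z := @sample_kernel01 _ _ _ _ X n w z n0.
apply: eq_ae_intC; [|exact: measurable_funM|].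
  by apply: measurable_funM => //; exact: measurable_W0_clip.
apply: filterS2 (W0_clipE (graphon_process T X n w)) (ae_leb_cube (W0_classE ms (s01 _))) => z H1 H2 Cz.
by rewrite -H1// H2.
Qed.

Lemma measurable_graphon_process n (G : set (W0 T)) : open G ->
  measurable (graphon_process T X n @^-1` G).
Proof.
case: n => [|n] oG.
  (* For n = 0 the kernel is an empty sum, so the process does not depend on w. *)
  have Y0 w w' : graphon_process T X 0 w = graphon_process T X 0 w'.
    by congr W0_class; apply/funext => z; rewrite /step_kernel !big_ord0.
  have [[w Gw]|nG] := pselect (exists w, G (graphon_process T X 0 w)).
    have -> : graphon_process T X 0 @^-1` G = setT; last exact: measurableT.
    by apply/seteqP; split => // w' _; rewrite /= (Y0 w' w).
  have -> : graphon_process T X 0 @^-1` G = set0; last exact: measurable0.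
  by apply/seteqP; split => // w Gw; apply: nG; exists w.
apply: (measurable_W0_map T0 _ oG) => h bh; have [mh [H hH]] := bh.
under eq_fun => w do rewrite (W0_pair_graphon_process w (ltn0Sn n) bh).
exact: (measurable_pairing T0 hX (ltn0Sn n) mh hH).
Qed.

End graphon_process_measurable.

(** * Large deviations *)

Section large_deviation_principle.
Context {R : realType} d (Omega : measurableType d) (P : probability Omega R).
Variables (T c : R) (p q : R3 R -> R).
Hypotheses (T0 : 0 < T) (c0 : 0 < c).
Local Notation C := (cube T).
Local Notation intC f := (\int[leb3]_(z in C) f z).
Hypotheses (pI : leb3.-integrable C (EFin \o p)) (qI : leb3.-integrable C (EFin \o q)).
Hypotheses (pc : forall z, C z -> c <= p z) (qc : forall z, C z -> c <= q z).
Variables (Y : nat -> Omega -> W0 T) (b : nat -> R).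
Hypothesis mY : forall n (G : set (W0 T)), open G -> measurable (Y n @^-1` G).
Hypothesis boo : b n @[n --> \oo] --> +oo.
Hypothesis pressure : forall h e, bounded_kernel T h -> 0 < e -> \forall n \near \oo,
  expR (b n * (Lam_int T p q h - e)) <= \int[P]_w expR (b n * W0_pair h (Y n w)) <=
  expR (b n * (Lam_int T p q h + e)).

Let J (phi : W0 T) : R := rate_int T p q (W0_clip phi).

Lemma rate_int_ge0 phi : 0 <= J phi.
Proof. by apply: Rintegral_ge0 => z _; exact: sqr_ge0. Qed.

Lemma rate_separation l phi : l < J phi ->
  exists h, bounded_kernel T h /\ l + Lam_int T p q h < W0_pair h phi.
Proof.
move=> lJ; have e0 : 0 < (J phi - l) / 2 by rewrite divr_gt0// subr_gt0.
have [v [_ _ bg [_ _ vJ]]] := good_approximation T0 c0 pI qI pc qc (measurable_W0_clip phi)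
  (fun z _ => W0_clip01 phi z) e0.
by eexists; split; [exact: bg|move: vJ; rewrite -/(J phi) /W0_pair; move: lJ; lra].
Qed.

Lemma rate_young h phi : bounded_kernel T h -> W0_pair h phi <= J phi + Lam_int T p q h.
Proof.
move=> bh; rewrite -lerBlDr; apply: (rate_int_young T0 c0 pI qI pc qc bh).
  exact: measurable_W0_clip.
by move=> z _; exact: W0_clip01.
Qed.

(** Lower semicontinuity: a kernel that certifies l < J at phi does so at all nearby points, by
    continuity of its pairing and [rate_young]. As W0 is compact, compactness of the level sets
    follows. *)
Lemma open_rate_gt l : open [set phi | l < J phi].
Proof.
rewrite openE => phi /= /rate_separation[h [bh lh]].
have near_h : \forall psi \near phi, l + Lam_int T p q h < W0_pair h psi.
  exact: (cvgr_gt _ (@W0_pair_continuous _ _ T0 _ bh phi) _ lh).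
by apply: filterS near_h => psi /= H; have := rate_young psi bh; move: H; lra.
Qed.

Lemma rate_function_J : rate_function (EFin \o J).
Proof.
split; first by move=> phi; rewrite lee_fin rate_int_ge0.
move=> r; apply: (subclosed_compact _ (W0_compact T0)) => //.
rewrite (_ : [set _ | _] = ~` [set phi | r < J phi]); first exact: open_closedC (open_rate_gt r).
by apply/seteqP; split => phi /=; rewrite lee_fin leNgt => /negP.
Qed.

Lemma measurable_pair_process n h : bounded_kernel T h ->
  measurable_fun setT (fun w => W0_pair h (Y n w)).
Proof.
move=> bh; apply: (measurability _ (RGenOInfty.measurableE R)) => _ [_ [r ->] <-].
rewrite setTI (_ : _ @^-1` _ = Y n @^-1` (W0_pair h @^-1` `]r, +oo[%classic))//.
apply: mY; apply: open_comp; last exact: interval_open.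
by move=> phi _; exact: (W0_pair_continuous T0 bh).
Qed.

Lemma exp_pair_integrable n h : bounded_kernel T h ->
  P.-integrable setT (EFin \o (fun w => expR (b n * W0_pair h (Y n w)))).
Proof.
move=> bh; apply: (@bounded_integrable _ _ _ _ _ _ (expR (`|b n| * intC (fun z => `|h z|)))) => //.
- by rewrite ltey_eq fin_num_measure.
- apply: measurableT_comp => //; apply: measurable_funM => //; exact: measurable_pair_process.
- move=> w _; rewrite ger0_norm ?expR_ge0// ler_expR; apply: (le_trans (ler_norm _)).
  by rewrite normrM ler_wpM2l// (W0_pair_norm T0).
Qed.

Lemma prob_indic (A : set Omega) : measurable A -> \int[P]_w \1_A w = fine (P A).
Proof. by move=> mA; rewrite Rintegral_indic// setIT. Qed.

Lemma indic_integrable (A : set Omega) : measurable A -> P.-integrable setT (EFin \o \1_A).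
Proof.
move=> mA; apply: (@bounded_integrable _ _ _ _ _ _ 1) => //.
  by rewrite ltey_eq fin_num_measure.
by move=> w _; rewrite indicE; case: (_ \in _); rewrite ?normr1 ?normr0.
Qed.

Lemma integrable_Z (f : Omega -> R) k : P.-integrable setT (EFin \o f) ->
  P.-integrable setT (EFin \o (fun w => k * f w)).
Proof.
by move=> fI; rewrite (_ : _ \o _ = fun w => (k%:E * (f w)%:E)%E)//; exact: integrableZl.
Qed.

Lemma integrable_sum_exp (I : finType) (h : I -> R3 R -> R) (k : I -> R) n :
  (forall i, bounded_kernel T (h i)) ->
  P.-integrable setT (EFin \o (fun w => \sum_i k i * expR (b n * W0_pair (h i) (Y n w)))) /\
  \int[P]_w (\sum_i k i * expR (b n * W0_pair (h i) (Y n w))) =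
    \sum_i k i * \int[P]_w expR (b n * W0_pair (h i) (Y n w)).
Proof.
move=> bh; have kI i := integrable_Z (k i) (exp_pair_integrable n (bh i)).
split.
  rewrite (_ : _ \o _ = fun w => (\sum_i (k i * expR (b n * W0_pair (h i) (Y n w)))%:E)%E).
    by apply: integrable_sum => //= i _; exact: kI.
  by apply/funext => w; rewrite /= sumEFin.
rewrite Rintegral_sum//; apply: eq_bigr => i _; rewrite RintegralZl//; exact: exp_pair_integrable.
Qed.

Lemma compact_cover_seq (F : set (W0 T)) l : closed F -> (forall phi, F phi -> l < J phi) ->
  exists (m : nat) (h : 'I_m -> R3 R -> R), (forall i, bounded_kernel T (h i)) /\
    forall phi, F phi -> exists i, l + Lam_int T p q (h i) < W0_pair (h i) phi.
Proof.
move=> cF lF.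
have kF : compact F by apply: (subclosed_compact cF (W0_compact T0)).
pose K := {h : R3 R -> R | bounded_kernel T h}.
have b0 : bounded_kernel T (cst 0 : R3 R -> R) by split => //; exists 0 => z _; rewrite normr0.
pose k0 : K := exist _ _ b0.
(* Compactness is used as a near-covering property, which asks for a filter on an index type. A set
   of lists is large here when it contains every list in which some fixed block s occurs; containing
   a given kernel is thus a large property, and a single list works for all of F. *)
pose N : set_system (seq K) := [set S | exists s, forall u v, S (u ++ s ++ v)].
have NF : Filter N.
  split.
  - by exists [::].
  - move=> A B [s1 H1] [s2 H2]; exists (s1 ++ s2) => u v; split.
      by rewrite -catA; exact: H1.
    by rewrite -catA catA; exact: H2.
  - by move=> A B AB [s H]; exists s => u v; apply: AB.
pose Q (s : seq K) (x : W0 T) := exists2 i, (i < size s)%N &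
  l + Lam_int T p q (sval (nth k0 s i)) < W0_pair (sval (nth k0 s i)) x.
have /compact_near_coveringP/(_ _ N Q NF) := kF.
case.
  move=> x /lF/rate_separation[h [bh lh]].
  exists ([set psi | l + Lam_int T p q h < W0_pair h psi], [set s | exists u v, s = u ++ [:: exist _ h bh : K] ++ v]).
    split => /=; first exact: (cvgr_gt _ (@W0_pair_continuous _ _ T0 _ bh x) _ lh).
    by exists [:: exist _ h bh] => u v; exists u, v.
  move=> [psi s] /= [H [u [v ->]]]; exists (size u).
    by rewrite size_cat /= addnS ltnS leq_addr.
  by rewrite nth_cat ltnn subnn.
move=> s /(_ [::] [::]); rewrite /= cats0 => sF.
exists (size s), (fun i => sval (nth k0 s i)); split; first by move=> i; exact: svalP.
by move=> phi /sF[i is_ H]; exists (Ordinal is_).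
Qed.

Lemma upper_estimate (F : set (W0 T)) l e : closed F -> (forall phi, F phi -> l < J phi) -> 0 < e ->
  exists N : nat, \forall n \near \oo, fine (P (Y n @^-1` F)) <= N%:R * expR (b n * (e - l)).
Proof.
move=> cF lF e0; have [m [h [bh hF]]] := compact_cover_seq cF lF.
have nearh : \forall n \near \oo, forall i, \int[P]_w expR (b n * W0_pair (h i) (Y n w)) <=
    expR (b n * (Lam_int T p q (h i) + e)).
  by apply: filter_forall => i; apply: filterS (pressure (bh i) e0) => n /andP[].
exists m; near=> n.
have bn0 : 0 < b n by near: n; move/cvgryPgt: boo; apply.
have Hn : forall i, \int[P]_w expR (b n * W0_pair (h i) (Y n w)) <=
    expR (b n * (Lam_int T p q (h i) + e)) by near: n.
have mF : measurable (Y n @^-1` F).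
  have /measurableC : measurable (Y n @^-1` (~` F)) by apply: mY; exact: closed_openC.
  by rewrite -preimage_setC setCK.
have [sI sE] := integrable_sum_exp (fun i => expR (- (b n * (l + Lam_int T p q (h i))))) n bh.
rewrite -prob_indic//.
apply: (le_trans (le_Rintegral measurableT (indic_integrable mF) sI _)).
  move=> w _; rewrite indicE; have [|_] := boolP (w \in _); last first.
    by apply: sumr_ge0 => i _; rewrite mulr_ge0 ?expR_ge0.
  move=> /set_mem /hF[i hi]; rewrite (bigD1 i isT) -expRD.
  apply: le_trans (_ : expR (- (b n * (l + Lam_int T p q (h i))) + b n * W0_pair (h i) (Y n w)) <= _).
    by rewrite -expR0 ler_expR addrC subr_ge0 ler_pM2l// ltW.
  by rewrite lerDl; apply: sumr_ge0 => j _; rewrite mulr_ge0 ?expR_ge0.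
rewrite sE; apply: (@le_trans _ _ (\sum_(i < m) expR (b n * (e - l)))); last first.
  by rewrite sumr_const card_ord mulr_natl.
apply: ler_sum => i _; apply: (le_trans (ler_wpM2l (expR_ge0 _) (Hn i))).
rewrite -expRD ler_expR le_eqVlt; apply/orP; left; apply/eqP; ring.
Unshelve. all: end_near. Qed.

Lemma Lam_int_tilt (v k : R3 R -> R) (K t : R) : measurable_fun C v -> (forall z, C z -> 0 < v z < 1) ->
  bounded_kernel T (fun z => dQ1 (v z) (p z) (q z)) -> measurable_fun C k ->
  (forall z, C z -> `|k z| <= K) ->
  Lam_int T p q (fun z => dQ1 (v z) (p z) (q z) + t * k z) <=
  Lam_int T p q (fun z => dQ1 (v z) (p z) (q z)) + t * intC (fun z => k z * v z) +
    t ^+ 2 * K ^+ 2 / (8 * c) * T.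
Proof.
move=> mv v01 bg mk kK.
have bk : bounded_kernel T k by split => //; exists K.
have [mgt [Hgt gtH]] := bounded_kernelD bg (bounded_kernelZ t bk).
have [mg [Hg gH]] := bg.
have I1 := Lam_integrable T0 c0 pI qI pc qc mgt gtH.
have I2 := Lam_integrable T0 c0 pI qI pc qc mg gH.
have I3 : leb3.-integrable C (EFin \o (fun z => k z * v z)).
  apply: (cube_integrable T0 (M := K)); first exact: measurable_funM.
  move=> z Cz; rewrite normrM -[leRHS]mulr1; apply: ler_pM => //; first exact: kK.
  by have /andP[v0 v1] := v01 z Cz; rewrite norm_le1// !ltW.
have I4 : leb3.-integrable C (EFin \o (fun=> t ^+ 2 * K ^+ 2 / (8 * c))).
  exact: (cube_integrable T0 (M := `|t ^+ 2 * K ^+ 2 / (8 * c)|)).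
have I3t := integrableCZ t I3; have I23 := integrableCD I2 I3t.
rewrite -(Rintegral_cube_cst T0) -intCZ// /Lam_int -intCD// -intCD//.
apply: intC_le => //; first exact: integrableCD.
move=> z Cz; have cp := pc Cz; have cq := qc Cz.
apply: (le_trans (Lam_dQ1D (t * k z) (v01 z Cz) c0 cp cq)).
rewrite (Lam_dQ1 (v01 z Cz)) ?(lt_le_trans c0)// mulrA lerD2l.
have c80 : 0 < 8 * c by rewrite mulr_gt0.
rewrite ler_pM2r ?invr_gt0// exprMn ler_wpM2l ?sqr_ge0//.
by rewrite -real_normK ?num_real// lerXn2r ?nnegrE// ?kK// (le_trans _ (kK z Cz)).
Qed.

(** The moment E exp(b <g, Y>) is bounded from below by the pressure and from above by two
    contributions. On {Y in G} the weight is at most exp(b (m g + dl)). Otherwise some pairing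
    exceeds its mean under v by dl, and Chebyshev's inequality with the extra tilt t makes this part
    at most half of the moment. *)
Lemma lower_estimate (G : set (W0 T)) phi e : open G -> G phi -> 0 < e ->
  \forall n \near \oo, 2^-1 * expR (- (b n * (J phi + e))) <= fine (P (Y n @^-1` G)).
Proof.
move=> oG Gphi e0.
have [k [hs [d0 [d00 bh hG]]]] := W0_nbhs T0 (open_nbhs_nbhs (conj oG Gphi)).
have [Hs Hs0 hsH] : exists2 H, 0 < H & forall i z, C z -> `|hs i z| <= H.
  have /choice[H hH] : forall i, exists H, forall z, C z -> `|hs i z| <= H.
    by move=> i; case: (bh i) => _ [H hH]; exists H.
  exists (\sum_i `|H i| + 1); first by rewrite ltr_wpDl// sumr_ge0.
  move=> i z Cz; apply: (le_trans (hH i z Cz)); apply: (le_trans (ler_norm _)).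
  rewrite (bigD1 i)//= -addrA lerDl addr_ge0// sumr_ge0//.
(* The second bound turns the L^1 distance of v to phi into at most d0 / 2 for each pairing with
   [hs i]. *)
pose e1 := Num.min (e / 4) (d0 / (2 * Hs)).
have e10 : 0 < e1 by rewrite lt_min !divr_gt0// mulr_gt0.
have [v [mv v01 bg [vu Jv _]]] := good_approximation T0 c0 pI qI pc qc (measurable_W0_clip phi)
  (fun z _ => W0_clip01 phi z) e10.
set g := (fun z => dQ1 (v z) (p z) (q z)) in bg.
have v01' z : C z -> 0 <= v z <= 1 by move=> /v01/andP[? ?]; rewrite !ltW.
(* [None] caps the pairing with g itself, hence the exponential weight; the signed kernels keep the
   process in the basic neighbourhood inside G. *)
pose kap (o : option (bool * 'I_k)) : R3 R -> R :=
  match o with None => g | Some (true, i) => hs i | Some (false, i) => fun z => -1 * hs i z end.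
have bkap o : bounded_kernel T (kap o).
  by case: o => [[[] i]|] //=; exact: bounded_kernelZ.
have [Hg0 gH0] : exists H, forall z, C z -> `|g z| <= H by case: bg.
pose K := Hs + `|Hg0|.
have K0 : 0 < K by rewrite ltr_wpDr.
have kapK o z : C z -> `|kap o z| <= K.
  move=> Cz; case: o => [[[] i]|] /=.
  - by apply: (le_trans (hsH i z Cz)); rewrite lerDl.
  - by rewrite normrM normrN1 mul1r; apply: (le_trans (hsH i z Cz)); rewrite lerDl.
  - by apply: (le_trans (gH0 z Cz)); apply: (le_trans (ler_norm _)); rewrite lerDr ltW.
pose m (h : R3 R -> R) := intC (fun z => h z * v z).
have vI : leb3.-integrable C (EFin \o v) by apply: (cube_integrable T0 mv (M := 1)) => z /v01'/norm_le1.
have hvI h : bounded_kernel T h -> leb3.-integrable C (EFin \o (fun z => h z * v z)).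
  move=> [mh [H hH]]; apply: (cube_integrable T0 (M := H)); first exact: measurable_funM.
  move=> z Cz; rewrite normrM -[leRHS]mulr1; apply: ler_pM => //; first exact: hH.
  exact/norm_le1/v01'.
pose dl := Num.min (d0 / 2) (e / 4).
have dl0 : 0 < dl by rewrite lt_min !divr_gt0.
have c80 : 0 < 8 * c by rewrite mulr_gt0.
(* With eta = t dl / 8, the quadratic cost t^2 K^2 T / (8 c) is at most t dl / 2 = 4 eta, against a
   linear gain t dl = 8 eta. After one more eta for the pressure, each bad term has exponent at most
   Lam g - 3 eta, while the whole moment has at least Lam g - eta. *)
pose t := Num.min 1 (4 * c * dl / (K ^+ 2 * T)).
have KT0 : 0 < K ^+ 2 * T by rewrite mulr_gt0// exprn_gt0.
have t0 : 0 < t by rewrite lt_min ltr01 divr_gt0// !mulr_gt0.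
have t1 : t <= 1 by rewrite ge_min lexx.
have tK : t * (K ^+ 2 * T) <= 4 * c * dl by rewrite -ler_pdivlMr// ge_min lexx orbT.
pose eta := t * dl / 8.
have eta0 : 0 < eta by rewrite divr_gt0// mulr_gt0.
have etadl : eta <= dl by rewrite /eta ler_pdivrMr// mulrC ler_pM2l// (le_trans t1)// ler1n.
pose gt o z := g z + t * kap o z.
have bgt o : bounded_kernel T (gt o) by apply: bounded_kernelD => //; exact: bounded_kernelZ.
have Lamgt o : Lam_int T p q (gt o) <= Lam_int T p q g + t * m (kap o) + 4 * eta.
  have [mk _] := bkap o.
  apply: (le_trans (Lam_int_tilt t mv v01 bg mk (kapK o))); rewrite lerD2l.
  have -> : t ^+ 2 * K ^+ 2 / (8 * c) * T = t * (t * (K ^+ 2 * T)) / (8 * c).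
    by field; rewrite gt_eqF.
  rewrite ler_pdivrMr// /eta.
  have : t * (t * (K ^+ 2 * T)) <= t * (4 * c * dl) by rewrite ler_pM2l.
  by move/le_trans; apply; rewrite le_eqVlt; apply/orP; left; apply/eqP; field.
have LamE : Lam_int T p q g = m g - rate_int T p q v.
  rewrite /m /rate_int -(intCB (hvI _ bg) (Q1_integrable c0 pI qI pc qc mv v01')).
  apply: eq_Rintegral => z /set_mem Cz; apply: Lam_dQ1; first exact: v01.
    exact: lt_le_trans c0 (pc Cz).
  exact: lt_le_trans c0 (qc Cz).
(* If no [kap o] exceeds its mean by [dl], then [Y n] is in [G]. *)
have evG n w : (forall o, W0_pair (kap o) (Y n w) < m (kap o) + dl) -> G (Y n w).
  move=> H; apply: hG => i.
  have d1 : `|m (hs i) - W0_pair (hs i) phi| <= d0 / 2.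
    rewrite /m /W0_pair -intCB; [|exact: hvI|by apply: W0_pair_integrable; exact: bounded_kernel_integrable].
    apply: (@le_trans _ _ (intC (fun z => Hs * `|v z - W0_clip phi z|))).
      apply: intC_norm_le.
      - apply: measurable_funB; apply: measurable_funM => //; try by case: (bh i).
        exact: measurable_W0_clip.
      - apply: integrableCZ; apply: integrable_norm; apply: integrableCB => //.
        apply: (cube_integrable T0 (measurable_W0_clip phi) (M := 1)) => z _.
        exact/norm_le1/W0_clip01.
      - by move=> z Cz; rewrite -mulrBr normrM ler_wpM2r// hsH.
    rewrite intCZ; last first.
      apply: integrable_norm; apply: integrableCB => //.
      apply: (cube_integrable T0 (measurable_W0_clip phi) (M := 1)) => z _.
      exact/norm_le1/W0_clip01.
    apply: (le_trans (ler_wpM2l (ltW Hs0) vu)).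
    apply: (@le_trans _ _ (Hs * (d0 / (2 * Hs)))); first by rewrite ler_pM2l// ge_min lexx orbT.
    by rewrite le_eqVlt; apply/orP; left; apply/eqP; field; rewrite gt_eqF.
  have := H (Some (true, i)); have := H (Some (false, i)); rewrite /= W0_pairZ//.
  have -> : m (fun z => -1 * hs i z) = -1 * m (hs i).
    by rewrite /m -intCZ; [apply: eq_Rintegral => z _; ring|exact: hvI].
  have : dl <= d0 / 2 by rewrite ge_min lexx.
  move: d1; rewrite ler_norml ltr_norml => /andP[? ?] ? ? ?.
  by apply/andP; split; lra.
pose I := option (bool * 'I_k).
have nearI : \forall n \near \oo, forall o : I, \int[P]_w expR (b n * W0_pair (gt o) (Y n w)) <=
    expR (b n * (Lam_int T p q (gt o) + eta)).
  by apply: filter_forall => o; apply: filterS (pressure (bgt o) eta0) => n /andP[].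
have nearg : \forall n \near \oo, expR (b n * (Lam_int T p q g - eta)) <= \int[P]_w expR (b n * W0_pair g (Y n w)).
  by apply: filterS (pressure bg eta0) => n /andP[].
near=> n.
have bn0 : 0 < b n by near: n; move/cvgryPgt: boo; apply.
have HI : forall o : I, \int[P]_w expR (b n * W0_pair (gt o) (Y n w)) <=
    expR (b n * (Lam_int T p q (gt o) + eta)) by near: n.
have Hg : expR (b n * (Lam_int T p q g - eta)) <= \int[P]_w expR (b n * W0_pair g (Y n w)) by near: n.
(* The margin 2 eta absorbs the number of bad terms and the factor 1/2. *)
have bnL : ln (2 * #|{: I}|%:R) <= b n * (2 * eta).
  by rewrite -ler_pdivrMr ?mulr_gt0//; apply: ltW; near: n; move/cvgryPgt: boo; apply.
have mG := mY n oG.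
have [sI sE] := integrable_sum_exp (fun o : I => expR (- (b n * (t * (m (kap o) + dl))))) n bgt.
have iG := integrable_Z (expR (b n * (m g + dl))) (indic_integrable mG).
have sumI : P.-integrable setT (EFin \o (fun w => expR (b n * (m g + dl)) * \1_(Y n @^-1` G) w +
    \sum_(o : I) expR (- (b n * (t * (m (kap o) + dl)))) * expR (b n * W0_pair (gt o) (Y n w)))).
  rewrite (_ : _ \o _ = fun w => ((expR (b n * (m g + dl)) * \1_(Y n @^-1` G) w)%:E +
    (\sum_(o : I) expR (- (b n * (t * (m (kap o) + dl)))) * expR (b n * W0_pair (gt o) (Y n w)))%:E)%E)//.
  exact: integrableD.
have tilted : \int[P]_w expR (b n * W0_pair g (Y n w)) <= expR (b n * (m g + dl)) * fine (P (Y n @^-1` G)) +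
    \sum_(o : I) expR (b n * (Lam_int T p q g - 3 * eta)).
  apply: (le_trans (le_Rintegral measurableT (exp_pair_integrable n bg) sumI _)).
    move=> w _; have [H|] := pselect (forall o, W0_pair (kap o) (Y n w) < m (kap o) + dl).
      rewrite indicE mem_set ?mulr1; last exact: evG H.
      apply: ler_wpDr; last by rewrite ler_expR ler_pM2l// ltW// (H None).
      by apply: sumr_ge0 => o _; rewrite mulr_ge0 ?expR_ge0.
    move=> /existsNP[x /negP]; rewrite -leNgt => ho.
    apply: ler_wpDl; first by rewrite mulr_ge0 ?expR_ge0// indicE.
    rewrite (bigD1 x)//=; apply: ler_wpDr.
      by apply: sumr_ge0 => j _; rewrite mulr_ge0 ?expR_ge0.
    have -> : W0_pair (gt x) (Y n w) = W0_pair g (Y n w) + t * W0_pair (kap x) (Y n w).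
      by rewrite -(W0_pairZ T0 t (Y n w) (bkap x)) -(W0_pairD T0 (Y n w) bg (bounded_kernelZ t (bkap x))).
    rewrite -expRD ler_expR (_ : _ + _ = b n * W0_pair g (Y n w) +
      b n * (t * (W0_pair (kap x) (Y n w) - (m (kap x) + dl)))); last by ring.
    by rewrite lerDl !mulr_ge0 ?(ltW bn0) ?(ltW t0)// subr_ge0.
  rewrite RintegralD// RintegralZl//; last exact: indic_integrable.
  rewrite prob_indic// lerD2l sE; apply: ler_sum => o _.
  apply: (le_trans (ler_wpM2l (expR_ge0 _) (HI o))).
  rewrite -expRD ler_expR -mulrN -mulrDr ler_pM2l//.
  have := Lamgt o; have : t * dl = 8 * eta by rewrite /eta; field.
  by rewrite mulrDr; set x := t * m _; set y := Lam_int _ _ _ _; set x' := t * dl; lra.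
have half : \sum_(o : I) expR (b n * (Lam_int T p q g - 3 * eta)) <=
    2^-1 * expR (b n * (Lam_int T p q g - eta)).
  rewrite sumr_const -[X in X <= _]mulr_natl ler_pdivlMl// mulrA.
  have I0 : 0 < 2 * #|{: I}|%:R :> R.
    by rewrite mulr_gt0// ltr0n; apply/card_gt0P; exists None.
  rewrite -[2 * #|_|%:R](lnK (I0 : _ \is Num.pos)) -expRD ler_expR.
  by move: bnL; set x := ln _; rewrite !mulrBr; lra.
have low : 2^-1 * expR (b n * (Lam_int T p q g - eta)) <= expR (b n * (m g + dl)) * fine (P (Y n @^-1` G)).
  by move: Hg tilted half; set x := expR _; set y := \sum_(o : I) _; lra.
rewrite -(ler_pM2l (expR_gt0 (b n * (m g + dl)))); apply: le_trans low.
rewrite mulrCA ler_pM2l// -expRD ler_expR -mulrN -mulrDr ler_pM2l//.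
have : dl <= e / 4 by rewrite ge_min lexx orbT.
have : e1 <= e / 4 by rewrite ge_min lexx.
by move: Jv; rewrite LamE -/(J phi); lra.
Unshelve. all: end_near. Qed.

End large_deviation_principle.

(** * From probability estimates to the large deviation principle *)

Lemma limn_esup_le (R : realType) (u : (\bar R)^nat) (x : \bar R) :
  (\forall n \near \oo, (u n <= x)%E) -> (limn_esup u <= x)%E.
Proof.
move=> ux; apply: ge_ereal_inf; exists (ereal_sup [set u n | n in [set n | (u n <= x)%E]]).
  by exists [set n | (u n <= x)%E].
by apply: ge_ereal_sup => _ [n /= unx <-].
Qed.

Lemma limn_einf_ge (R : realType) (u : (\bar R)^nat) (x : \bar R) :
  (\forall n \near \oo, (x <= u n)%E) -> (x <= limn_einf u)%E.
Proof.
move=> xu; rewrite /limn_einf leeNr; apply: limn_esup_le.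
by apply: filterS xu => n; rewrite leeN2.
Qed.

Section scaled_log.
Context {R : realType}.
Variables (b k x : R).
Hypothesis b0 : 0 < b.

(** N + 1 in the logarithm covers an empty cover, N = 0; a null probability is covered by the value
    -oo of [lne]. *)
Lemma scaled_lne_le (N : nat) : x <= N%:R * expR (b * k) ->
  (b^-1%:E * lne x%:E <= (b^-1 * ln N.+1%:R + k)%:E)%E.
Proof.
move=> xN; rewrite /lne; case: ifPn => [_|].
  by rewrite gt0_muleNy ?lte_fin ?invr_gt0// leNye.
rewrite -ltNge => x0; rewrite -EFinM lee_fin -ler_pdivlMl ?invr_gt0// invrK.
rewrite mulrDr mulVKf ?gt_eqF// -[b * k]expRK -lnM ?posrE ?expR_gt0//.
rewrite ler_ln ?posrE ?mulr_gt0 ?expR_gt0//; apply: (le_trans xN).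
by rewrite ler_pM2r ?expR_gt0// ler_nat.
Qed.

Lemma scaled_lne_ge : 2^-1 * expR (- (b * k)) <= x ->
  ((- (b^-1 * ln 2) - k)%:E <= b^-1%:E * lne x%:E)%E.
Proof.
move=> xN; have h0 : 0 < 2^-1 * expR (- (b * k)) by rewrite mulr_gt0 ?expR_gt0.
have x0 : 0 < x by apply: lt_le_trans xN.
have /negbTE xN0 : ~~ (x <= 0) by rewrite -ltNge.
rewrite /lne xN0 -EFinM lee_fin -ler_pdivrMl ?invr_gt0// invrK.
rewrite mulrBr mulrN mulVKf ?gt_eqF// -lnV ?posrE// -[- (b * k)]expRK.
by rewrite -lnM ?posrE ?expR_gt0// ler_ln ?posrE.
Qed.

End scaled_log.

Section ldp_of_pressure.
Context {R : realType} d (Omega : measurableType d) (P : probability Omega R).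
Variables (T c : R) (p q : R3 R -> R).
Hypotheses (T0 : 0 < T) (c0 : 0 < c).
Local Notation C := (cube T).
Hypotheses (pI : leb3.-integrable C (EFin \o p)) (qI : leb3.-integrable C (EFin \o q)).
Hypotheses (pc : forall z, C z -> c <= p z) (qc : forall z, C z -> c <= q z).
Variables (Y : nat -> Omega -> W0 T) (b : nat -> R).
Hypothesis mY : forall n (G : set (W0 T)), open G -> measurable (Y n @^-1` G).
Hypothesis boo : b n @[n --> \oo] --> +oo.
Hypothesis pressure : forall h e, bounded_kernel T h -> 0 < e -> \forall n \near \oo,
  expR (b n * (Lam_int T p q h - e)) <= \int[P]_w expR (b n * W0_pair h (Y n w)) <=
  expR (b n * (Lam_int T p q h + e)).

Let J (phi : W0 T) : R := rate_int T p q (W0_clip phi).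

Let near_small k e : 0 < e -> \forall n \near \oo, 0 < b n /\ (b n)^-1 * k <= e.
Proof.
move=> e0; near=> n.
have bn0 : 0 < b n by near: n; move/cvgryPgt: boo; apply.
split => //; rewrite mulrC ler_pdivrMr// -ler_pdivrMl// mulrC.
by apply: ltW; near: n; move/cvgryPgt: boo; apply.
Unshelve. all: end_near. Qed.

Let probE A : measurable A -> P A = (fine (P A))%:E.
Proof. by move=> mA; rewrite fineK// fin_num_measure. Qed.

Theorem LDP_of_pressure : LDP P Y b (EFin \o J).
Proof.
split => //; first exact: (rate_function_J T0 c0 pI qI pc qc).
- move=> F cF.
  have mYF n : measurable (Y n @^-1` F).
    have /measurableC : measurable (Y n @^-1` (~` F)) by apply: mY; exact: closed_openC.
    by rewrite -preimage_setC setCK.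
  have up l : (forall phi, F phi -> l < J phi) ->
      (limn_esup (fun n => ((b n)^-1)%:E * lne (P (Y n @^-1` F))) <= (- l)%:E)%E.
    move=> lF; apply/lee_addgt0Pr => e e0; rewrite -EFinD.
    have e20 : 0 < e / 2 by rewrite divr_gt0.
    have [N nearF] := upper_estimate T0 c0 pI qI pc qc mY boo pressure cF lF e20.
    apply: limn_esup_le; apply: filterS2 nearF (near_small (ln N.+1%:R) e20) => n Fn [bn0 bN].
    rewrite probE; last exact: mYF.
    apply: (le_trans (scaled_lne_le bn0 Fn)); rewrite lee_fin.
    by move: bN; set x := _ * ln _; lra.
  have s0 : (0 <= ereal_inf [set (EFin \o J) x | x in F])%E.
    by apply: le_ereal_inf_tmp => _ [phi _ <-]; rewrite lee_fin; exact: rate_int_ge0.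
  have lF l : (l%:E < ereal_inf [set (EFin \o J) x | x in F])%E -> forall phi, F phi -> l < J phi.
    move=> ls phi Fphi; rewrite -lte_fin; apply: (lt_le_trans ls).
    by apply: ereal_inf_lbound; exists phi.
  move: s0 lF; case: (ereal_inf _) => [s| |]//= _ lF.
    apply/lee_addgt0Pr => e e0; rewrite -EFinD.
    have -> : - s + e = - (s - e) by ring.
    by apply: up; apply: lF; rewrite lte_fin ltrBlDr ltrDl.
  (* The infimum is +oo here: every real level lies below it, so the upper limit is below every real
     number. *)
  rewrite leeNy_eq; apply/eqP/eq_ninfty => l; rewrite -[l]opprK.
  by apply: up; apply: lF; rewrite ltry.
- move=> G oG; rewrite leeNl; apply: le_ereal_inf_tmp => _ [phi Gphi <-].
  rewrite leeNl /=; apply/lee_subgt0Pr => e e0; rewrite -?EFinN -EFinB.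
  have e20 : 0 < e / 2 by rewrite divr_gt0.
  have nearG := lower_estimate T0 c0 pI qI pc qc mY boo pressure oG Gphi e20.
  apply: limn_einf_ge; apply: filterS2 nearG (near_small (ln 2) e20) => n Gn [bn0 bN].
  rewrite probE; last exact: mY.
  apply: le_trans (scaled_lne_ge bn0 Gn); rewrite lee_fin.
  by move: bN; rewrite -/(J phi); set x := _ * ln _; lra.
Qed.

End ldp_of_pressure.

(** * Reduction to limiting rates that are bounded below everywhere *)

Section truncated_rate.
Context {R : realType}.
Variables (T c : R) (f : R3 R -> R) (fn : forall n, 'I_n -> 'I_n -> R -> R).
Hypotheses (T0 : 0 < T) (hf : rate_assumptions T c f fn).
Local Notation C := (cube T).
Local Notation intC f := (\int[leb3]_(z in C) f z).

(* Truncating from below changes nothing almost everywhere, the approximations being [>= c]. *)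
Let p z := Num.max c (f z).

Let fI : leb3.-integrable C (EFin \o f). Proof. exact: inLp1_integrable (rate_L1 hf). Qed.

Let fnI n : leb3.-integrable C (EFin \o step_kernel (@fn n)).
Proof. exact: inLp1_integrable (rate_n_L1 hf n). Qed.

Lemma truncated_rate_integrable : leb3.-integrable C (EFin \o p).
Proof.
apply: (integrableC_le (g := fun z => `|c| + `|f z|)).
- by apply: measurable_maxr => //; exact: integrableC_measurable fI.
- move=> z _; rewrite /p; case: (leP c (f z)) => _; first by rewrite lerDr.
  by rewrite lerDl.
- apply: integrableCD; last exact: integrable_norm fI.
  by apply: (cube_integrable T0 (M := `|c|)) => // z _; rewrite normr_id.
Qed.

(** The map max(c, .) is a contraction that fixes the values of the step kernels. *)
Let step_dist n z : (0 < n)%N -> C z ->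
  `|step_kernel (@fn n) z - p z| <= `|step_kernel (@fn n) z - f z|.
Proof.
move=> n0 Cz; have [i [j zij]] := cube_cell n0 Cz.
have zT : 0 <= z.2 <= T by case: Cz => _; rewrite /= in_itv.
have := rate_lower_bound hf i j zT; rewrite -(step_kernelE n0 (@fn n) zij).
rewrite /p; case: (leP c (f z)) => // fc cs.
by rewrite !ger0_norm ?subr_ge0 ?(le_trans (ltW fc))// lerD2l lerN2 ltW.
Qed.

Let cvg_f : intC (fun z => `|step_kernel (@fn n) z - f z|) @[n --> \oo] --> 0.
Proof. exact: cvgLp1 (rate_cvg_L1 hf). Qed.

Lemma truncated_rate_cvg : intC (fun z => `|step_kernel (@fn n) z - p z|) @[n --> \oo] --> 0.
Proof.
apply: (squeeze_cvgr _ (cvg_cst 0) cvg_f); near=> n.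
have n0 : (0 < n)%N by near: n; exact: nbhs_infty_gt.
rewrite Rintegral_ge0//=; apply: intC_le.
- exact: integrable_norm (integrableCB (fnI n) truncated_rate_integrable).
- exact: integrable_norm (integrableCB (fnI n) fI).
- by move=> z; exact: step_dist.
Unshelve. all: end_near. Qed.

(** f and p are L^1 limits of the same sequence of step kernels. *)
Lemma truncated_rateE : {ae leb3, forall z, C z -> f z = p z}.
Proof.
have pI := truncated_rate_integrable.
have dI := integrable_norm (integrableCB fI pI).
have d0 : intC (fun z => `|f z - p z|) = 0.
  apply/eqP; rewrite eq_le Rintegral_ge0// andbT.
  have cv : intC (fun z => `|step_kernel (@fn n) z - f z|) + intC (fun z => `|step_kernel (@fn n) z - p z|)
      @[n --> \oo] --> 0 + (0 : R) by apply: cvgD; [exact: cvg_f|exact: truncated_rate_cvg].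
  rewrite -[X in _ <= X](addr0 0) -(cvg_lim _ cv)//; apply: limr_ge; first exact: cvgP cv.
  apply: nearW => n.
  have I1 := integrable_norm (integrableCB (fnI n) fI).
  have I2 := integrable_norm (integrableCB (fnI n) pI).
  rewrite -intCD//; apply: intC_le => //; first exact: integrableCD.
  by move=> z _; rewrite -(distrC (f z)); exact: ler_distD.
pose fp z := f z - p z.
have mfp : measurable_fun C (EFin \o fp).
  by apply/measurable_EFinP; exact: integrableC_measurable (integrableCB fI pI).
have int0 : (\int[leb3]_(z in C) `|(EFin \o fp) z| = 0)%E.
  rewrite -[LHS]fineK; last exact: (integrable_fin_num (measurable_cube T) dI).
  by congr EFin.
have /ae_eq_integral_abs := int0 => /(_ (measurable_cube T) mfp) fp0.
by apply: filterS fp0 => z H Cz; have [/eqP] := H Cz; rewrite subr_eq0 => /eqP.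
Qed.

End truncated_rate.

(** The class and the rates are replaced by representatives that satisfy their bounds at every
    point; the replacement shows that the extended integral is finite. *)
Lemma rate_JE (R : realType) (T c : R) (f g p q : R3 R -> R) (phi : W0 T) : 0 < c ->
  leb3.-integrable (cube T) (EFin \o f) -> leb3.-integrable (cube T) (EFin \o g) ->
  leb3.-integrable (cube T) (EFin \o p) -> leb3.-integrable (cube T) (EFin \o q) ->
  (forall z, cube T z -> c <= p z) -> (forall z, cube T z -> c <= q z) ->
  {ae leb3, forall z, cube T z -> f z = p z} -> {ae leb3, forall z, cube T z -> g z = q z} ->
  rate_J f g phi = (rate_int T p q (W0_clip phi))%:E.
Proof.
move=> c0 fI gI pI qI pc qc fp gq.
have Q1I := Q1_integrable c0 pI qI pc qc (measurable_W0_clip phi) (fun z _ => W0_clip01 phi z).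
rewrite /rate_int /Rintegral fineK; last exact: (integrable_fin_num (measurable_cube T) Q1I).
apply: ae_eq_integral; first exact: measurable_cube.
- apply/measurable_EFinP; apply: measurable_Q1 => //; apply: measurable_funTS.
  exact: measurable_W0_fun.
- by apply/measurable_EFinP; exact: integrableC_measurable Q1I.
- apply: filterS2 (W0_clipE phi) (filterI fp gq) => z H [H1 H2] Cz.
  by rewrite /= H// H1// H2.
Qed.

Theorem theorem3p3 (R : realType) (d : measure_display)
    (Omega : measurableType d) (P : probability Omega R)
    (T : R) (hT : 0 < T)
    (bp bm : R3 R -> R) (bnp bnm : forall n : nat, 'I_n -> 'I_n -> R -> R)
    (c : R) (hc : 0 < c)
    (hbp : rate_assumptions T c bp bnp) (hbm : rate_assumptions T c bm bnm)
    (a : nat -> R) (ha : forall n, (0 < n)%N -> 0 < a n)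
    (ha_oo : a n @[n --> \oo] --> +oo)
    (x0 : forall n : nat, 'I_n -> 'I_n -> bool)
    (X : forall n : nat, 'I_n -> 'I_n -> R -> Omega -> bool)
    (hX : forall n (i j : 'I_n),
      markov_chain P T (X n i j) (x0 n i j)
        (fun t => a n * bnp n i j t) (fun t => a n * bnm n i j t))
    (hind : forall n, mutually_independent P
      (fun ij : 'I_n * 'I_n => past (X n ij.1 ij.2) T))
    (eta : R) (heta : 0 < eta)
    (hbpL : inLp T (1 + eta) bp) (hbmL : inLp T (1 + eta) bm)
    (hbnpL : forall n, inLp T (1 + eta) (step_kernel (bnp n)))
    (hbnmL : forall n, inLp T (1 + eta) (step_kernel (bnm n)))
    (hbp_cvg : cvgLp T (1 + eta) (fun n => step_kernel (bnp n)) bp)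
    (hbm_cvg : cvgLp T (1 + eta) (fun n => step_kernel (bnm n)) bm) :
  LDP P (graphon_process T X) (fun n => a n * n%:R ^+ 2) (rate_J bp bm).
Proof.
pose p z := Num.max c (bp z); pose q z := Num.max c (bm z).
have pI : leb3.-integrable (cube T) (EFin \o p) := truncated_rate_integrable hT hbp.
have qI : leb3.-integrable (cube T) (EFin \o q) := truncated_rate_integrable hT hbm.
have pc z : cube T z -> c <= p z by rewrite /p le_max lexx.
have qc z : cube T z -> c <= q z by rewrite /q le_max lexx.
have pB : \forall n \near \oo, forall i j, [bounded bnp n i j t | t in `[0, T]].
  by apply: filterS (rate_n_left_continuous hbp) => n H i j; case: (H i j).
have qB : \forall n \near \oo, forall i j, [bounded bnm n i j t | t in `[0, T]].
  by apply: filterS (rate_n_left_continuous hbm) => n H i j; case: (H i j).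
(* The given limiting rates are at least c only almost everywhere, while the general result asks for
   it at every point of the cube. *)
have -> : rate_J bp bm = EFin \o (fun phi : W0 T => rate_int T p q (W0_clip phi)).
  apply/funext => phi; apply: (rate_JE (c := c)) => //.
  - exact: inLp1_integrable (rate_L1 hbp).
  - exact: inLp1_integrable (rate_L1 hbm).
  - exact: truncated_rateE hT hbp.
  - exact: truncated_rateE hT hbm.
apply: (LDP_of_pressure hT hc pI qI pc qc).
- exact: (measurable_graphon_process hT hX).
- apply/cvgryPge => A; near=> n.
  have n1 : (1 <= n)%N by near: n; exact: nbhs_infty_ge.
  have an : `|A| <= a n by near: n; move/cvgryPge: ha_oo; apply.
  apply: (le_trans (ler_norm A)); apply: (le_trans an).
  by rewrite ler_peMr ?(ltW (ha n n1))// expr_ge1// ler1n.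
- move=> h e [mh [H hH]] e0.
  have := pressure_limit hT hc pI qI pc qc (truncated_rate_cvg hT hbp) (truncated_rate_cvg hT hbm)
    (rate_n_measurable hbp) (rate_n_measurable hbm) (rate_n_nonneg hbp) (rate_n_nonneg hbm)
    pB qB ha ha_oo hX hind mh hH e0.
  have n0 : \forall n \near \oo, (0 < n)%N by exact: nbhs_infty_gt.
  apply: filterS2 n0 => n n0.
  have bh : bounded_kernel T h by split => //; exists H.
  suff -> : (fun w => expR (a n * n%:R ^+ 2 * W0_pair h (graphon_process T X n w))) =
    (fun w => expR (a n * n%:R ^+ 2 *
      \int[leb3]_(z in cube T) (h z * sample_kernel (X n) w z))) by exact: id.
  by apply/funext => w; rewrite (W0_pair_graphon_process hT hX w n0 bh).
Unshelve. all: end_near. Qed.
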